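(* Let $g_{Sol}=e^{2z}\,dx^{2}+e^{-2z}\,dy^{2}+dz^{2}$ be the Sol metric on $\mathbb{R}^3$ with coordinates $(x,y,z)$. There exists no biharmonic Riemannian submersion $\pi:(\mathbb{R}^3,g_{Sol})\to (N^2,h)$, no matter what the $2$-dimensional Riemannian manifold $(N^2,h)$ is.
   Context: All manifolds and maps are smooth. Sol space is the Riemannian manifold $(\mathbb{R}^3,g_{Sol})$ with $g_{Sol}=e^{2z}dx^2+e^{-2z}dy^2+dz^2$. For a map $\varphi:(M,g)\to(N,h)$ between Riemannian manifolds, the tension field is $\tau(\varphi)=\mathrm{Trace}_g\nabla d\varphi$. The map $\varphi$ is biharmonic if it is a critical point of the bienergy $E^2(\varphi,\Omega)=\frac12\int_\Omega|\tau(\varphi)|^2dx$ for every compact subset $\Omega$ of $M$; equivalently, if its bitension field vanishes identically: $$\tau^2(\varphi):=\mathrm{Trace}_g(\nabla^\varphi\nabla^\varphi-\nabla^\varphi_{\nabla^M})\tau(\varphi)-\mathrm{Trace}_gR^N(d\varphi,\tau(\varphi))d\varphi=0,$$ where $R^N(X,Y)Z=[\nabla^N_X,\nabla^N_Y]Z-\nabla^N_{[X,Y]}Z$. In particular, harmonic maps ($\tau(\varphi)=0$) are biharmonic. A biharmonic Riemannian submersion is a Riemannian submersion that is a biharmonic map. *)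

(* Defs.v *)
From HB Require Import structures.
From mathcomp Require Import all_boot all_order all_algebra.
From mathcomp Require Import all_classical all_reals all_analysis.

Set Implicit Arguments.
Unset Strict Implicit.
Unset Printing Implicit Defensive.

Import Order.TTheory GRing.Theory Num.Theory.
Import numFieldNormedType.Exports.

Local Open Scope classical_set_scope.
Local Open Scope ring_scope.

Section Calculus.
Context {R : realType} {n : nat} {W : normedModType R}.
Implicit Types (f : 'rV[R]_n -> W) (U : set 'rV[R]_n).

Definition partial (i : 'I_n) f : 'rV[R]_n -> W := 'D_(delta_mx 0 i) f.

(* To be used with U open: iterated partial derivatives at a point of U then
   depend only on the values of f on U. *)
Definition smooth_on U f : Prop :=
  forall (s : seq 'I_n) (p : 'rV[R]_n), U p ->
    {for p, continuous (foldr partial f s)} /\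
    forall i, derivable (foldr partial f s) p (delta_mx 0 i).

End Calculus.

Record chart (R : realType) (m : nat) (N : topologicalType) := Chart {
  cdom : set N;
  cmap : N -> 'rV[R]_m;
  cinv : 'rV[R]_m -> N;
  cdom_open : open cdom;
  ccod_open : open (cmap @` cdom);
  cmapK : forall x, cdom x -> cinv (cmap x) = x;
  cmap_cont : {within cdom, continuous cmap};
  cinv_cont : {within cmap @` cdom, continuous cinv} }.

Definition ccod (R : realType) m (N : topologicalType) (c : chart R m N) :
  set 'rV[R]_m := cmap c @` cdom c.

Definition transition (R : realType) m (N : topologicalType)
  (c c' : chart R m N) : 'rV[R]_m -> 'rV[R]_m := cmap c' \o cinv c.

Definition overlap (R : realType) m (N : topologicalType)
  (c c' : chart R m N) : set 'rV[R]_m := ccod c `&` cinv c @^-1` cdom c'.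

(* The atlas need not be maximal. *)
Record manifold (R : realType) (m : nat) := Manifold {
  carrier :> topologicalType;
  mfd_hausdorff : hausdorff_space carrier;
  mfd_countable : @second_countable carrier;
  atlas : set (chart R m carrier);
  atlas_cover : forall x : carrier, exists2 c, atlas c & cdom c x;
  transition_smooth : forall c c', atlas c -> atlas c' ->
    smooth_on (overlap c c') (transition c c') }.

Definition inner (R : realType) n (A : 'M[R]_n) (v w : 'rV[R]_n) : R :=
  (v *m A *m w^T) 0 0.

Record is_metric_on (R : realType) n (U : set 'rV[R]_n)
    (g : 'rV[R]_n -> 'M[R]_n) : Prop := IsMetricOn {
  metric_smooth : smooth_on U g;
  metric_sym : forall p, U p -> (g p)^T = g p;
  metric_pos : forall p v, U p -> v != 0 -> 0 < inner (g p) v v }.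

(* [metric c u] is the matrix of the metric in the chart c, at the point of
   coordinates u. *)
Record riemannian_manifold (R : realType) (m : nat) := RiemannianManifold {
  base_manifold :> manifold R m;
  metric : chart R m base_manifold -> 'rV[R]_m -> 'M[R]_m;
  metricP : forall c, atlas c -> is_metric_on (ccod c) (metric c);
  metric_transition : forall c c', atlas c -> atlas c' ->
    forall u, overlap c c' u -> forall v w : 'rV[R]_m,
    inner (metric c u) v w =
    inner (metric c' (transition c c' u))
      ('d (transition c c') u v) ('d (transition c c') u w) }.

(* [christoffel g k i j p] is Gamma^k_{ij} at p. *)
Definition christoffel (R : realType) n (g : 'rV[R]_n -> 'M[R]_n)
    (k i j : 'I_n) (p : 'rV[R]_n) : R :=
  2^-1 * \sum_l invmx (g p) k l *
    (partial i g p j l + partial j g p i l - partial l g p i j).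

(* R(X,Y)Z = [nabla_X, nabla_Y] Z - nabla_{[X,Y]} Z at the point u. *)
Definition curvature (R : realType) m (h : 'rV[R]_m -> 'M[R]_m)
    (u X Y Z : 'rV[R]_m) : 'rV[R]_m :=
  \row_a \sum_b \sum_c \sum_d
    X 0 b * Y 0 c * Z 0 d *
    (partial b (christoffel h a c d) u - partial c (christoffel h a b d) u
     + \sum_e (christoffel h a b e u * christoffel h e c d u
               - christoffel h a c e u * christoffel h e b d u)).

(* Maps between open subsets of coordinate spaces: g is the metric on the
   source, h the metric on the target. *)
Section LocalFields.
Context {R : realType} {n m : nat}.
Variables (g : 'rV[R]_n -> 'M[R]_n) (h : 'rV[R]_m -> 'M[R]_m).
Variable f : 'rV[R]_n -> 'rV[R]_m.

(* Covariant derivative, along the i-th coordinate field of the source, of a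
   section V of the pull-back of the tangent bundle of the target by f. *)
Definition nabla (i : 'I_n) (V : 'rV[R]_n -> 'rV[R]_m) (p : 'rV[R]_n) :
    'rV[R]_m :=
  partial i V p +
  \row_a \sum_b \sum_c
    christoffel h a b c (f p) * partial i f p 0 b * V p 0 c.

Definition trace (p : 'rV[R]_n) (B : 'I_n -> 'I_n -> 'rV[R]_m) : 'rV[R]_m :=
  \sum_i \sum_j invmx (g p) i j *: B i j.

Definition tension (p : 'rV[R]_n) : 'rV[R]_m :=
  trace p (fun i j =>
    nabla i (partial j f) p - \sum_k christoffel g k i j p *: partial k f p).

Definition bitension (p : 'rV[R]_n) : 'rV[R]_m :=
  trace p (fun i j => nabla i (nabla j tension) p
                      - \sum_k christoffel g k i j p *: nabla k tension p)
  - trace p (fun i j =>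
      curvature h (f p) (partial i f p) (tension p) (partial j f p)).

End LocalFields.

(* Maps from R^n, with the metric g, to a Riemannian manifold N. *)
Section Maps.
Context {R : realType} {n m : nat} {N : riemannian_manifold R m}.
Variables (g : 'rV[R]_n -> 'M[R]_n) (phi : 'rV[R]_n -> N).

Definition smooth_map : Prop :=
  continuous phi /\
  forall c, atlas c -> smooth_on (phi @^-1` cdom c) (cmap c \o phi).

Definition riemannian_submersion : Prop :=
  smooth_map /\
  forall c, atlas c -> forall p, cdom c (phi p) ->
    let dphi : 'rV[R]_n -> 'rV[R]_m := 'd (cmap c \o phi) p in
    let horizontal v := forall w, dphi w = 0 -> inner (g p) v w = 0 in
    (forall u, exists v, dphi v = u) /\
    forall v w, horizontal v -> horizontal w ->
      inner (metric c (cmap c (phi p))) (dphi v) (dphi w) = inner (g p) v w.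

Definition biharmonic : Prop :=
  smooth_map /\
  forall c, atlas c -> forall p, cdom c (phi p) ->
    bitension g (metric c) (cmap c \o phi) p = 0.

End Maps.

Definition sol_metric (R : realType) (p : 'rV[R]_3) : 'M[R]_3 :=
  let z := p 0 (@Ordinal 3 2 isT) in
  diag_mx (\row_(i < 3) [:: expR (2 * z); expR (- (2 * z)); 1]`_i).

(* Main.v *)
From HB Require Import structures.
Require Import Defs.
From mathcomp Require Import all_boot all_order all_algebra.
From mathcomp Require Import all_classical all_reals all_analysis.
From mathcomp Require Import ring lra zify.

Set Implicit Arguments.
Unset Strict Implicit.
Unset Printing Implicit Defensive.

Import Order.TTheory GRing.Theory Num.Theory.
Import numFieldNormedType.Exports.

Local Open Scope classical_set_scope.
Local Open Scope ring_scope.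

(** Let phi be a Riemannian submersion from Sol space to a surface, read in a chart
    as f. Its cometric f_*(g^-1) = h^-1 o f is constant along the fibres, so a
    vertical field, normalised by a coordinate, is a Killing field transversally
    to itself. For a field (p - x, r + y, 1) the resulting equations are
      p_x = (p - x) e^(2z) p_z,  r_y = (r + y) e^(-2z) r_z,
      e^(2z) p_y + e^(-2z) r_x = (r + y) p_z + (p - x) r_z.
    If p_z <> 0 somewhere, they give three commuting derivations, and along a curve
    with p constant a polynomial relation between t and a primitive S of
    f / (D - (t - p0)^2)^2; such an S is transcendental over the rational functions
    of t, and the coefficients of the relation contradict each other. Hence p and r
    are constant (the fields with no d/dz component are elementary), that is, some
    nonzero Killing field of the form (c1 - w x, c2 + w y, w) is vertical on an open set.

    In the frame E = (e^-z d/dx, e^z d/dy, d/dz) let this field be (u, v, w) and let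
    n = u^2 + v^2 + w^2. Then <df E_i, df E_j> = delta_ij - k_i k_j / n with
    k = (u, v, w), so Koszul's formula yields the pulled back connection, and the
    component of the bitension along df E_3 is
      - (u^2 - v^2) (16 u^2 v^2 + 3 n^2 - n (u^2 + v^2)) / n^3.
    If it vanishes then u^2 = v^2 on an open set; differentiating along E_3, then
    along E_1, gives u = v = 0 and w = 0, a contradiction. *)

(** * Differentiability and smooth functions *)

(** The obstacle is that a Riemannian submersion makes its vertical field Killing only
    transversally, which is a nonlinear overdetermined system for [p] and [r]. Where [p_z] has no
    zero, [p] can replace [z] as a coordinate, and the three commuting derivations are d/dx, d/dp,
    d/dy in the coordinates (x, p, y). There e^(-2z) = D - (x - p)^2 with D a function of p and y,
    so the dependence on x is explicit. The mixed equation then gives a primitive in x, and the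
    equation for [r_y] an algebraic relation between this primitive and its derivatives in p and y.
    The primitive is transcendental because it contains a logarithm. The isometry (x, y, z) -> (y,
    x, -z) of Sol exchanges p and -r, so one argument treats both functions. In the bitension
    computation the three vectors df E_i lie in a plane and are dependent, but they form a Parseval
    frame: every X is the sum of the <X, df E_i> df E_i. The frame of Sol can thus be kept, without
    choosing a horizontal one. Everything is local: one chart and successively smaller open sets. *)

Section Directional.
Context {R : realType} {V : normedModType R}.
Implicit Types (f : V -> R) (p v : V).

Lemma is_derive_line f p v (t : R) : derivable f (t *: v + p) v ->
  is_derive t 1 (fun s : R => f (s *: v + p)) ('D_v f (t *: v + p)).
Proof.
move=> df.
have E : (fun h : R => h^-1 *: (f ((h *: 1 + t) *: v + p) - f (t *: v + p))) =
         (fun h : R => h^-1 *: (f (h *: v + (t *: v + p)) - f (t *: v + p))).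
  apply/funext => h; congr (_ *: (f _ - _)).
  by rewrite scalerDl addrA [h *: 1]mulr1.
by apply: DeriveDef; [rewrite /derivable E | rewrite /derive E].
Qed.

Lemma mvt_dir f p v (t : R) :
  (forall s : R, `|s| <= `|t| -> derivable f (s *: v + p) v) ->
  exists2 s : R, `|s| <= `|t| &
    f (t *: v + p) - f p = t * 'D_v f (s *: v + p).
Proof.
move=> df; pose g (s : R) : R := f (s *: v + p); pose dg (s : R) : R := 'D_v f (s *: v + p).
have g0 : g 0 = f p by rewrite /g scale0r add0r.
have dgP (s : R) : `|s| <= `|t| -> is_derive s (1:R) g (dg s).
  by move=> st; apply: is_derive_line; exact: df.
have cg (a b : R) : (forall s : R, s \in `[a, b]%R -> `|s| <= `|t|) ->
    {within `[a, b], continuous g}.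
  move=> ab; apply: derivable_within_continuous => s /ab /dgP.
  by move=> /@ex_derive.
have [t0|t0] := leP 0 t.
  have inn (s : R) : s \in `[0, t]%R -> `|s| <= `|t|.
    by rewrite in_itv /= => /andP[s0 st]; rewrite !ger0_norm.
  have [] := @MVT_segment R g dg 0 t t0.
  - by move=> x xt; apply/dgP/inn; exact: subset_itv_oo_cc xt.
  - exact: cg inn.
  - move=> s st; rewrite g0 subr0 => E; exists s; first exact: inn.
    by rewrite -/(g t) E mulrC.
have inn (s : R) : s \in `[t, 0]%R -> `|s| <= `|t|.
  by rewrite in_itv /= => /andP[ts s0]; rewrite !ler0_norm ?lerN2// ltW.
have [] := @MVT_segment R g dg t 0 (ltW t0).
- by move=> x xt; apply/dgP/inn; exact: subset_itv_oo_cc xt.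
- exact: cg inn.
- move=> s st; rewrite g0 sub0r => E; exists s; first exact: inn.
  by apply: oppr_inj; rewrite opprB -/(g t) E mulrC mulNr.
Qed.

End Directional.

Section C1.
Context {R : realType} {n : nat}.
Implicit Types (f : 'rV[R]_n -> R) (U : set 'rV[R]_n).

Definition lin_form (G : 'I_n -> R) (h : 'rV[R]_n) : R := \sum_i h 0 i * G i.

Lemma lin_form_linear G : linear (lin_form G : 'rV[R]_n -> R^o).
Proof.
move=> a x y; rewrite /lin_form scaler_sumr -big_split; apply: eq_bigr => i _.
by rewrite !mxE mulrDl -mulrA.
Qed.
HB.instance Definition _ G :=
  GRing.isLinear.Build R 'rV[R]_n R^o *:%R (lin_form G) (lin_form_linear G).

Lemma coord_norm_le (h : 'rV[R]_n) i : `|h 0 i| <= `|h|.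
Proof.
by rewrite [leRHS]/Num.Def.normr/= mx_normrE; exact: (le_bigmax _ _ (0, i)).
Qed.

Lemma rV_norm_le (h : 'rV[R]_n) (e : R) : 0 <= e ->
  (forall i, `|h 0 i| <= e) -> `|h| <= e.
Proof.
move=> e0 he; rewrite [leLHS]/Num.Def.normr/= mx_normrE bigmax_le// => -[a b] _.
by rewrite ord1.
Qed.

Lemma lin_form_continuous G : continuous (lin_form G).
Proof.
move=> x; apply: differentiable_continuous; rewrite /lin_form.
have -> : (fun h : 'rV[R]_n => \sum_i h 0 i * G i) =
          \sum_i (fun h : 'rV[R]_n => h 0 i * G i).
  by apply/funext => h; rewrite fct_sumE.
apply: differentiable_sum => i; apply: differentiableM => //.
exact: differentiable_coord.
Qed.

(** The increment is split along a path that changes one coordinate at a time. The mean value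
    theorem turns each leg into a partial derivative at a point near [p], and continuity at [p]
    bounds the error. *)
Lemma c1_differentiable f U (p : 'rV[R]_n) : open U -> U p ->
  (forall q i, U q -> derivable f q (delta_mx 0 i)) ->
  (forall i, {for p, continuous (partial i f)}) ->
  differentiable f p /\ 'd f p = lin_form (fun i => partial i f p) :> (_ -> _).
Proof.
move=> oU Up df cf; pose G i := partial i f p.
suff H : f \o shift p = cst (f p) + lin_form G +o_ (0 : 'rV[R]_n) id.
  have E := diff_unique (@lin_form_continuous G) H.
  split=> //; apply/diff_locallyP; rewrite E; split => //.
  exact: lin_form_continuous.
apply/eqaddoP => _/posnumP[e].
(* The [n] legs share the error [e]; the successor keeps the quotient positive when [n = 0]. *)
have e0 : 0 < e%:num / n.+1%:R by rewrite divr_gt0.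
have : \forall q \near p, U q /\ forall i, `|partial i f p - partial i f q| <= e%:num / n.+1%:R.
  have H i : \forall q \near p, `|partial i f p - partial i f q| <= e%:num / n.+1%:R.
    by have /cvgrPdist_le /(_ _ e0) := cf i.
  have H' := filter_forall _ H.
  by apply: filterI; [exact: open_nbhs_nbhs | exact: H'].
move=> /nbhs_ballP[d /= d0 dB].
near=> h.
have hd : `|h| < d.
  by near: h; apply: (@nbhs0_lt R 'rV[R]_n _ d0).
pose P k : 'rV[R]_n := p + \row_i (if (i < k)%N then h 0 i else 0).
have P0 : P 0%N = p.
  by rewrite /P (_ : \row_i _ = 0) ?addr0//; apply/rowP => i; rewrite !mxE.
have Pn : P n = h + p.
  by rewrite /P addrC; congr (_ + _); apply/rowP => i; rewrite !mxE ltn_ord.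
have PS (k : 'I_n) : P k.+1 = h 0 k *: delta_mx 0 k + P k.
  rewrite /P addrCA; congr (_ + _); apply/rowP => i; rewrite !mxE eqxx /= ltnS.
  rewrite -(inj_eq val_inj) /=; case: ltngtP => [ik|ik|/val_inj ->].
  - by rewrite mulr0 add0r.
  - by rewrite mulr0 add0r.
  - by rewrite mulr1 addr0.
have PB (k : 'I_n) (s : R) : `|s| <= `|h 0 k| ->
    ball p d (s *: delta_mx 0 k + P k).
  move=> sh; rewrite mx_norm_ball /ball_ /= /P opprD addrCA opprD addNKr -opprD normrN.
  apply: le_lt_trans hd; apply: rV_norm_le => // i; rewrite !mxE eqxx /=.
  case: eqVneq => [->|ik] /=.
    by rewrite ltnn mulr1 addr0 (le_trans sh)// coord_norm_le.
  by rewrite mulr0 add0r; case: ifP => _; rewrite ?coord_norm_le// normr0.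
have step (k : 'I_n) : `|f (P k.+1) - f (P k) - h 0 k * G k| <=
    e%:num / n.+1%:R * `|h|.
  rewrite PS; have [s sh ->] : exists2 s : R, `|s| <= `|h 0 k| &
      f (h 0 k *: delta_mx 0 k + P k) - f (P k) =
      h 0 k * partial k f (s *: delta_mx 0 k + P k).
    by apply: mvt_dir => s sh; apply: df; apply: (dB _ (PB _ _ sh)).1.
  rewrite -mulrBr normrM mulrC ler_pM ?coord_norm_le// distrC.
  by apply: (dB _ (PB _ _ sh)).2.
have -> : (f \o shift p - (cst (f p) + lin_form G)) h =
    \sum_(k < n) (f (P k.+1) - f (P k) - h 0 k * G k).
  rewrite sumrB -(big_mkord xpredT (fun k => f (P k.+1) - f (P k))).
  by rewrite telescope_sumr// P0 Pn [LHS]/= opprD addrA.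
apply: (le_trans (ler_norm_sum _ _ _)).
apply: (@le_trans _ _ (\sum_(k < n) e%:num / n.+1%:R * `|h|)).
  by apply: ler_sum => k _; exact: step.
rewrite sumr_const card_ord -[_ *+ n]mulr_natl mulrA ler_wpM2r//.
by rewrite mulrCA ler_piMr// ler_pdivrMr// mul1r ler_nat.
Unshelve. all: by end_near. Qed.

End C1.

Lemma is_derive_translate {R : realType} {V : normedModType R} (f : V -> R)
    (c q v : V) : derivable f (c + q) v ->
  is_derive q v (fun x => f (c + x)) ('D_v f (c + q)).
Proof.
move=> df.
have E : (fun h : R => h^-1 *: (f (c + (h *: v + q)) - f (c + q))) =
         (fun h : R => h^-1 *: (f (h *: v + (c + q)) - f (c + q))).
  by apply/funext => h; rewrite addrCA.
by apply: DeriveDef; [rewrite /derivable E | rewrite /derive E].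
Qed.

Lemma ler_distB_half {R : realFieldType} (a b m e : R) :
  `|a - m| <= e / 2 -> `|b - m| <= e / 2 -> `|a - b| <= e.
Proof.
move=> am bm; rewrite -(subrK m a) -addrA (le_trans (ler_normD _ _))//.
by rewrite [leRHS]splitr lerD// distrC.
Qed.

(** * Symmetry of second partial derivatives *)

Section Schwarz.
Context {R : realType} {n : nat}.
Implicit Types (f : 'rV[R]_n -> R) (U : set 'rV[R]_n).
Local Notation e_ i := (delta_mx 0 i : 'rV[R]_n).

(** The mean value theorem in direction [i] for [f (t *: e_ j + q) - f q], then in direction [j] for
    the partial derivative. As [i != j], the intermediate points stay in the cube of radius [|t|] of
    the sup norm. *)
Lemma second_difference f (i j : 'I_n) (p : 'rV[R]_n) (t : R) :
  (forall q, `|q - p| <= `|t| -> derivable f q (e_ i)) ->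
  (forall q, `|q - p| <= `|t| -> derivable (partial i f) q (e_ j)) ->
  i != j ->
  exists2 q, `|q - p| <= `|t| &
    f (t *: e_ j + (t *: e_ i + p)) - f (t *: e_ i + p)
     - (f (t *: e_ j + p) - f p) = t * (t * partial j (partial i f) q).
Proof.
move=> di dij ij.
have near_p (s s' : R) : `|s| <= `|t| -> `|s'| <= `|t| ->
    `|s' *: e_ j + (s *: e_ i + p) - p| <= `|t|.
  move=> st st'; rewrite addrA addrK; apply: rV_norm_le => // k.
  rewrite !mxE eqxx /=; case: (eqVneq k j) => [->|_].
    by rewrite [j == i]eq_sym (negbTE ij) mulr1 mulr0 addr0.
  by rewrite mulr0 add0r; case: eqP => _; rewrite ?mulr1// mulr0 normr0.
pose g q := f (t *: e_ j + q) - f q.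
have t0 : `|0 : R| <= `|t| by rewrite normr0.
have dg s : `|s| <= `|t| -> is_derive (s *: e_ i + p) (e_ i) g
    (partial i f (t *: e_ j + (s *: e_ i + p)) - partial i f (s *: e_ i + p)).
  move=> st; apply: is_deriveB.
    by apply: is_derive_translate; apply: di; exact: near_p.
  apply: derivableP; apply: di.
  by have := near_p _ _ st t0; rewrite scale0r add0r.
have [|s st E] := @mvt_dir R _ g p (e_ i) t.
  by move=> s /dg/@ex_derive.
change (exists2 q, `|q - p| <= `|t| &
  g (t *: e_ i + p) - g p = t * (t * partial j (partial i f) q)).
rewrite E; have /@derive_val -> := dg _ st.
have [|s' st' ->] := @mvt_dir R _ (partial i f) (s *: e_ i + p) (e_ j) t.
  by move=> s' st'; apply: dij; exact: near_p.
by exists (s' *: e_ j + (s *: e_ i + p)); first exact: near_p.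
Qed.

(** The second difference is symmetric in [i] and [j], so the two mixed derivatives take a common
    value at two points arbitrarily near [p]. *)
Lemma schwarz f U (i j : 'I_n) (p : 'rV[R]_n) : open U -> U p ->
  (forall q k, U q -> derivable f q (e_ k)) ->
  (forall q k l, U q -> derivable (partial k f) q (e_ l)) ->
  (forall k l, {for p, continuous (partial l (partial k f))}) ->
  partial i (partial j f) p = partial j (partial i f) p.
Proof.
move=> oU Up d1 d2 c2; have [->//|ij] := eqVneq i j.
apply/eqP; rewrite -subr_eq0 -normr_eq0; apply/eqP/le_anti.
rewrite normr_ge0 andbT; apply/ler_addgt0Pl => e e0; rewrite addr0.
have e20 : 0 < e / 2 by rewrite divr_gt0.
have : \forall q \near p, [/\ U q,
    `|partial i (partial j f) p - partial i (partial j f) q| <= e / 2 &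
    `|partial j (partial i f) p - partial j (partial i f) q| <= e / 2].
  have H1 : \forall q \near p, `|partial i (partial j f) p - partial i (partial j f) q| <= e / 2.
    by have /cvgrPdist_le /(_ _ e20) := c2 j i.
  have H2 : \forall q \near p, `|partial j (partial i f) p - partial j (partial i f) q| <= e / 2.
    by have /cvgrPdist_le /(_ _ e20) := c2 i j.
  have HU : nbhs p U by exact: open_nbhs_nbhs.
  by apply: filterS3 HU H1 H2 => q Uq h1 h2; split.
move=> /nbhs_ballP[d /= d0 dB].
have dd : d / 2 != 0 by rewrite mulf_neq0 ?gt_eqF.
have inU q : `|q - p| <= `|d / 2| -> ball p d q.
  move=> qp; rewrite mx_norm_ball /ball_ /= distrC (le_lt_trans qp)//.
  by rewrite gtr0_norm ?divr_gt0// ltr_pdivrMr// ltr_pMr// ltr1n.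
have [||q1 q1p E1] := @second_difference f i j p (d / 2) _ _ ij.
- by move=> q /inU/dB[Uq _ _]; exact: d1.
- by move=> q /inU/dB[Uq _ _]; exact: d2.
have ji : j != i by rewrite eq_sym.
have [||q2 q2p E2] := @second_difference f j i p (d / 2) _ _ ji.
- by move=> q /inU/dB[Uq _ _]; exact: d1.
- by move=> q /inU/dB[Uq _ _]; exact: d2.
have comm : d / 2 *: e_ j + (d / 2 *: e_ i + p) = d / 2 *: e_ i + (d / 2 *: e_ j + p).
  exact: addrCA.
have swap (a b c d' : R) : a - b - (c - d') = a - c - (b - d') by ring.
rewrite comm swap in E1; have E3 := etrans (esym E1) E2.
have E : partial j (partial i f) q1 = partial i (partial j f) q2.
  exact: (mulfI dd (mulfI dd E3)).
have [_ _ B1] := dB _ (inU _ q1p); have [_ B2 _] := dB _ (inU _ q2p).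
by rewrite E in B1; exact: ler_distB_half B2 B1.
Qed.

End Schwarz.

(** * Scalar functions of class C^k *)

Section Ck.
Context {R : realType} {n : nat}.
Implicit Types (f g : 'rV[R]_n -> R) (U : set 'rV[R]_n).

(* The scalar maps of class [C^k] on [U] (open): unlike [smooth_on], this allows
   induction on the order of differentiation. *)
Fixpoint Ck k U f : Prop :=
  (forall p, U p -> {for p, continuous f}) /\
  if k is k'.+1 then forall i,
    (forall p, U p -> derivable f p (delta_mx 0 i)) /\ Ck k' U (partial i f)
  else True.

Definition sm U f := forall k, Ck k U f.

Lemma Ck_cont k U f p : Ck k U f -> U p -> {for p, continuous f}.
Proof. by case: k => [|k] [H _]; exact: H. Qed.

Lemma CkS k U f : Ck k.+1 U f -> Ck k U f.
Proof.
elim: k f => [|k IH] f [cf df]; first by split.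
by split=> // i; have [di ci] := df i; split=> //; exact: IH.
Qed.

Lemma open_near U p f g : open U -> U p -> (forall q, U q -> f q = g q) ->
  \near p, f p = g p.
Proof.
move=> oU Up fg; have HU : nbhs p U by exact: open_nbhs_nbhs.
exact: filterS HU.
Qed.

Lemma partial_eqon U f g i p : open U -> (forall q, U q -> f q = g q) -> U p ->
  partial i f p = partial i g p.
Proof. by move=> oU fg Up; apply: near_eq_derive; exact: open_near fg. Qed.

Lemma continuous_eqon U f g p : open U -> (forall q, U q -> f q = g q) -> U p ->
  {for p, continuous f} -> {for p, continuous g}.
Proof.
move=> oU fg Up cf; have fgp := fg _ Up.
have cf' : f @ p --> f p := cf; rewrite fgp in cf'.
have E : \near p, f p = g p by exact: open_near fg.
exact: cvg_trans (@near_eq_cvg _ _ (nbhs p) _ f g E) cf'.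
Qed.

Lemma Ck_eqon k U f g : open U -> (forall q, U q -> f q = g q) ->
  Ck k U f -> Ck k U g.
Proof.
move=> oU; elim: k f g => [|k IH] f g fg [cf df]; split => //.
- by move=> p Up; apply: continuous_eqon fg _ (cf _ Up).
- by move=> p Up; apply: continuous_eqon fg _ (cf _ Up).
- move=> i; have [di ci] := df i; split => [p Up|].
    by apply: near_eq_derivable (di _ Up); exact: open_near fg.
  by apply: IH ci => q Uq; exact: partial_eqon fg _.
Qed.

Lemma Ck_diff k U f p : open U -> Ck k.+1 U f -> U p -> differentiable f p.
Proof.
move=> oU [cf df] Up; have [] // := @c1_differentiable R n f U p oU Up.
- by move=> q i Uq; exact: (df i).1.
- by move=> i; apply: Ck_cont Up; exact: (df i).2.
Qed.

Lemma Ck_cst k U (c : R) : Ck k U (cst c).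
Proof.
elim: k c => [|k IH] c; split => //; try by move=> p _; exact: cst_continuous.
move=> i; split; first by move=> p _; exact: derivable_cst.
rewrite (_ : partial i (cst c) = cst 0); first exact: IH.
by apply/funext => p; rewrite /partial derive_cst.
Qed.

Lemma partial_coord (i j : 'I_n) p :
  partial i (fun q : 'rV[R]_n => q 0 j) p = (i == j)%:R.
Proof.
rewrite /partial /derive; apply/cvg_lim => //.
apply: (@cvg_trans _ (cst ((i == j)%:R : R) @ (0 : R)^')); last exact: cvg_cst.
apply: near_eq_cvg; near=> h => /=.
rewrite !mxE eqxx /= addrK eq_sym.
have h0 : h != 0 by near: h; exact: nbhs_dnbhs_neq.
by rewrite -[_ *: _]/(h^-1 * (h * _)) mulKf.
Unshelve. all: by end_near. Qed.

Lemma Ck_coord k U (j : 'I_n) : Ck k U (fun q : 'rV[R]_n => q 0 j).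
Proof.
have cc p : {for p, continuous (fun q : 'rV[R]_n => q 0 j)}.
  exact: coord_continuous.
case: k => [|k]; split => // i; split.
  by move=> p _; apply: diff_derivable; exact: differentiable_coord.
rewrite (_ : partial i _ = cst ((i == j)%:R : R)); first exact: Ck_cst.
by apply/funext => p; exact: partial_coord.
Qed.

Lemma Ck_add k U f g : open U -> Ck k U f -> Ck k U g ->
  Ck k U (fun q => f q + g q).
Proof.
move=> oU; elim: k f g => [|k IH] f g [cf df] [cg dg]; split => //;
  try by move=> p Up; apply: continuousD; [exact: cf | exact: cg].
move=> i; have [df1 df2] := df i; have [dg1 dg2] := dg i; split.
  by move=> p Up; apply: derivableD; [exact: df1 | exact: dg1].
apply: Ck_eqon oU _ (IH _ _ df2 dg2) => q Uq.
by rewrite /partial (deriveD (df1 _ Uq) (dg1 _ Uq)).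
Qed.

Lemma Ck_mul k U f g : open U -> Ck k U f -> Ck k U g ->
  Ck k U (fun q => f q * g q).
Proof.
move=> oU; elim: k f g => [|k IH] f g Cf Cg; have [cf df] := Cf;
  have [cg dg] := Cg; split => //;
  try by move=> p Up; apply: continuousM; [exact: cf | exact: cg].
move=> i; have [df1 df2] := df i; have [dg1 dg2] := dg i; split.
  by move=> p Up; apply: derivableM; [exact: df1 | exact: dg1].
have := Ck_add oU (IH _ _ (CkS Cf) dg2) (IH _ _ (CkS Cg) df2).
apply: Ck_eqon oU _ => q Uq.
by rewrite /partial (deriveM (df1 _ Uq) (dg1 _ Uq)).
Qed.

Lemma Ck_opp k U f : open U -> Ck k U f -> Ck k U (fun q => - f q).
Proof.
move=> oU Cf; have := Ck_mul oU (Ck_cst k U (-1)) Cf.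
by apply: Ck_eqon => // q _; rewrite /= mulN1r.
Qed.

Lemma Ck_inv k U f : open U -> (forall q, U q -> f q != 0) -> Ck k U f ->
  Ck k U (fun q => (f q)^-1).
Proof.
move=> oU f0; elim: k f f0 => [|k IH] f f0 Cf; have [cf df] := Cf; split => //;
  try by move=> p Up; apply: continuousV; [exact: f0 | exact: cf].
move=> i; have [df1 df2] := df i; split.
  by move=> p Up; apply: derivableV; [exact: f0 | exact: df1].
have Ci := IH _ f0 (CkS Cf).
have := Ck_opp oU (Ck_mul oU (Ck_mul oU Ci Ci) df2).
apply: Ck_eqon oU _ => q Uq.
rewrite /partial (deriveV (f0 _ Uq) (df1 _ Uq)).
by rewrite -[RHS]/(_ * _) mulNr -invfM -expr2.
Qed.

Lemma is_derive_comp1 (phi : R -> R) f p v (a b : R) :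
  is_derive (f p) 1 phi a -> is_derive p v f b ->
  is_derive p v (fun q => phi (f q)) (a * b).
Proof.
move=> dphi df.
have H : is_derive (0 : R) (1 : R) (fun h : R => f (h *: v + p)) b.
  have [d <-] := df; have E := @is_derive_line R _ f p v 0.
  by rewrite scale0r add0r in E; exact: E.
have dphi' : is_derive ((fun h : R => f (h *: v + p)) 0) 1 phi a.
  by rewrite scale0r add0r.
have [d1 d2] := is_derive1_comp dphi' H.
apply: DeriveDef; first exact: (derivable1P (fun q => phi (f q)) p v).2 d1.
rewrite -d2 /derive.
have -> : (fun h : R => h^-1 *: (phi (f (h *: v + p)) - phi (f p))) =
  (fun h : R => h^-1 *: ((phi \o (fun h : R => f (h *: v + p))) (h *: 1 + 0) -
    (phi \o (fun h : R => f (h *: v + p))) 0)).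
  by apply/funext => h; rewrite /= addr0 scale0r add0r [_%:A]mulr1.
by [].
Qed.

Lemma Ck_exp k U f : open U -> Ck k U f -> Ck k U (fun q => expR (f q)).
Proof.
move=> oU; elim: k f => [|k IH] f Cf; have [cf df] := Cf; split => //;
  try by move=> p Up; apply: continuous_comp; [exact: cf | exact: continuous_expR].
move=> i; have [df1 df2] := df i.
have dd p : U p -> is_derive p (delta_mx 0 i) (fun q => expR (f q))
    (expR (f p) * partial i f p).
  by move=> Up; exact: (is_derive_comp1 (is_derive_expR (f p)) (derivableP (df1 _ Up))).
split; first by move=> p /dd/@ex_derive.
have := Ck_mul oU (IH _ (CkS Cf)) df2.
apply: Ck_eqon oU _ => q Uq; rewrite /partial.
by have /@derive_val -> := dd _ Uq.
Qed.

End Ck.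

(** Only the derivative of [f] along [v] is assumed. Restricted to the line through [p], [f] is
    differentiable in one variable, and the usual chain rule applies. *)
Lemma is_derive_chain {R : realType} {V1 V2 : normedModType R} (g : V2 -> R)
    (f : V1 -> V2) (p v : V1) :
  differentiable g (f p) -> derivable f p v ->
  is_derive p v (g \o f) ('d g (f p) ('D_v f p)).
Proof.
move=> dg df; pose L (h : R) := f (h *: v + p).
have L0 : L 0 = f p by rewrite /L scale0r add0r.
have dL : derivable L 0 1 by apply/(derivable1P f p v).
have dL' : differentiable L 0 by apply/derivable1_diffP.
have DL : 'D_1 L 0 = 'D_v f p.
  rewrite /derive.
  have -> : (fun h : R => h^-1 *: (L (h *: 1 + 0) - L 0)) =
            (fun h : R => h^-1 *: (f (h *: v + p) - f p)); last by [].
  by apply/funext => h; rewrite L0 /L addr0 [_%:A]mulr1.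
have dg' : differentiable g (L 0) by rewrite L0.
have dgL : differentiable (g \o L) 0 by exact: differentiable_comp.
have E : 'D_1 (g \o L) 0 = 'd g (f p) ('D_v f p).
  by rewrite deriveE// diff_comp//= L0 -DL deriveE.
have D : derivable (g \o f) p v.
  by apply/(derivable1P (g \o f) p v)/derivable1_diffP.
apply: DeriveDef => //; rewrite -E /derive.
have -> : (fun h : R => h^-1 *: ((g \o L) (h *: 1 + 0) - (g \o L) 0)) =
    (fun h : R => h^-1 *: ((g \o f) (h *: v + p) - (g \o f) p)); last by [].
by apply/funext => h; rewrite /= L0 /L addr0 [_%:A]mulr1.
Qed.

Lemma is_derive_comp_rV {R : realType} {m : nat} {V1 : normedModType R}
    (g : 'rV[R]_m -> R) (f : V1 -> 'rV[R]_m) (V : set 'rV[R]_m) p v : open V -> Ck 1 V g ->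
  V (f p) -> derivable f p v ->
  is_derive p v (g \o f)
    (\sum_b partial b g (f p) * 'D_v (fun q => f q 0 b) p).
Proof.
move=> oV Cg Vfp df; have [cg dg] := Cg.
have [] := @c1_differentiable R m g V (f p) oV Vfp.
- by move=> q i Vq; exact: (dg i).1.
- by move=> i; exact: (@Ck_cont _ _ 0%N V _ _ (dg i).2 Vfp).
move=> dgf E; have H := is_derive_chain dgf df.
apply: is_derive_eq; rewrite E /lin_form derive_mx//.
by apply: eq_bigr => b _; rewrite mxE mulrC.
Qed.

Section Comp.
Context {R : realType} {n m : nat}.
Implicit Types (f : 'rV[R]_n -> 'rV[R]_m) (g : 'rV[R]_m -> R).

Lemma Ck_sum k (U : set 'rV[R]_n) (F : 'I_m -> 'rV[R]_n -> R) : open U ->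
  (forall b, Ck k U (F b)) -> Ck k U (fun q => \sum_b F b q).
Proof.
move=> oU HF; elim: (index_enum _) => [|b s IH].
  by apply: Ck_eqon (Ck_cst k U 0) => // q _; rewrite big_nil.
by apply: Ck_eqon (Ck_add oU (HF b) IH) => // q _; rewrite big_cons.
Qed.

Lemma Ck_comp k (U : set 'rV[R]_n) (V : set 'rV[R]_m) g f :
  open U -> open V -> (forall q, U q -> V (f q)) ->
  (forall b, Ck k U (fun q => f q 0 b)) -> Ck k V g -> Ck k U (g \o f).
Proof.
move=> oU oV fUV; elim: k g => [|k IH] g Cf Cg.
  have cf q : U q -> {for q, continuous f}.
    move=> Uq; have cfb b := (Ck_cont (Cf b) Uq).
    apply/(@cvgrPdist_le _ _ _ (nbhs q) _ f (f q)) => e e0.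
    have H b : \forall t \near q, `|f q 0 b - f t 0 b| <= e.
      by have /cvgrPdist_le /(_ _ e0) := cfb b.
    have HA : \forall t \near q, forall b, `|f q 0 b - f t 0 b| <= e.
      exact: (filter_forall _ H).
    apply: (@filterS _ (nbhs q) _ _ _ _ HA) => t Ht.
    by apply: rV_norm_le => [|i]; [exact: ltW | rewrite !mxE].
  split=> // q Uq; apply: continuous_comp; first exact: cf.
  by apply: Ck_cont Cg _; exact: fUV.
have Cf' b : Ck k U (fun q => f q 0 b) by exact: CkS.
have IHg := IH _ Cf' (CkS Cg).
split; first by move=> q Uq; exact: (Ck_cont IHg Uq).
move=> i; have dfi q : U q -> derivable f q (delta_mx 0 i).
  by move=> Uq; apply/derivable_mxP => a b; rewrite ord1; exact: ((Cf b).2 i).1.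
have C1g : Ck 1 V g.
  case: Cg => c d; split => // j; have [d1 d2] := d j; split=> //; split => // v Vv.
  exact: Ck_cont d2 Vv.
have D q : U q -> is_derive q (delta_mx 0 i) (g \o f)
    (\sum_b partial b g (f q) * partial i (fun q => f q 0 b) q).
  by move=> Uq; apply: (is_derive_comp_rV oV C1g); [exact: fUV | exact: dfi].
split; first by move=> q /D/@ex_derive.
have := @Ck_sum k U (fun b q => partial b g (f q) * partial i (fun q => f q 0 b) q) oU.
move=> S; apply: (Ck_eqon oU _ (S _)).
  by move=> q /D/@derive_val; rewrite /partial => ->.
move=> b; apply: (Ck_mul oU); last exact: ((Cf b).2 i).2.
exact: (IH (partial b g) Cf' (Cg.2 b).2).
Qed.
End Comp.

Section Smooth.
Context {R : realType} {n : nat}.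
Implicit Types (f g : 'rV[R]_n -> R) (U : set 'rV[R]_n).

Lemma smooth_on_partial (W : normedModType R) U (f : 'rV[R]_n -> W) i :
  smooth_on U f -> smooth_on U (partial i f).
Proof.
move=> sf s p Up; have := sf (rcons s i) p Up.
by rewrite foldr_rcons.
Qed.

Lemma smooth_on_sm U f : smooth_on U f -> sm U f.
Proof.
move=> sf k; elim: k f sf => [|k IH] f sf.
  by split => // p Up; exact: (sf [::] p Up).1.
split; first by move=> p Up; exact: (sf [::] p Up).1.
move=> i; split; first by move=> p Up; exact: (sf [::] p Up).2.
by apply: IH; exact: smooth_on_partial.
Qed.

Lemma smooth_on_entry a b U (M : 'rV[R]_n -> 'M[R]_(a, b)) i j : open U ->
  smooth_on U M -> sm U (fun p => M p i j).
Proof.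
move=> oU sM; apply: smooth_on_sm => s.
have E : forall p, U p -> foldr partial (fun p => M p i j) s p = foldr partial M s p i j.
  elim: s => [//|k s IH] p Up /=.
  rewrite (partial_eqon _ oU IH Up) /partial derive_mx ?mxE//.
  exact: (sM s p Up).2.
move=> p Up; have [cM dM] := sM s p Up; split.
  apply: (continuous_eqon oU (fun q Uq => esym (E q Uq)) Up).
  exact: (@continuous_comp _ _ _ (foldr partial M s) (fun N : 'M[R]_(a, b) => N i j) p cM
    (@coord_continuous _ _ _ i j _)).
move=> k; have /derivable_mxP /(_ i j) := dM k.
by apply: near_eq_derivable; apply: (open_near oU Up) => q Uq; rewrite E.
Qed.

Lemma partial_entry a b U (M : 'rV[R]_n -> 'M[R]_(a, b)) i j k p :
  smooth_on U M -> U p -> partial k M p i j = partial k (fun q => M q i j) p.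
Proof.
by move=> sM Up; rewrite /partial derive_mx ?mxE//; exact: (sM [::] p Up).2.
Qed.

Variables (U : set 'rV[R]_n) (oU : open U).

Lemma sm_partial f i : sm U f -> sm U (partial i f).
Proof. by move=> sf k; exact: ((sf k.+1).2 i).2. Qed.

Lemma sm_derivable f i p : sm U f -> U p -> derivable f p (delta_mx 0 i).
Proof. by move=> sf; exact: ((sf 1%N).2 i).1. Qed.

Lemma sm_cont f p : sm U f -> U p -> {for p, continuous f}.
Proof. by move=> sf; exact: (sf 0%N).1. Qed.

Lemma sm_diff f p : sm U f -> U p -> differentiable f p.
Proof. by move=> sf; exact: Ck_diff (sf 1%N). Qed.

Lemma sm_eqon f g : (forall q, U q -> f q = g q) -> sm U f -> sm U g.
Proof. by move=> fg sf k; exact: Ck_eqon fg (sf k). Qed.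

Lemma sm_cst c : sm U (fun=> c). Proof. by move=> k; exact: Ck_cst. Qed.
Lemma sm_coord j : sm U (fun q => q 0 j). Proof. by move=> k; exact: Ck_coord. Qed.
Lemma sm_add f g : sm U f -> sm U g -> sm U (fun q => f q + g q).
Proof. by move=> sf sg k; exact: Ck_add. Qed.
Lemma sm_mul f g : sm U f -> sm U g -> sm U (fun q => f q * g q).
Proof. by move=> sf sg k; exact: Ck_mul. Qed.
Lemma sm_opp f : sm U f -> sm U (fun q => - f q).
Proof. by move=> sf k; exact: Ck_opp. Qed.
Lemma sm_inv f : (forall q, U q -> f q != 0) -> sm U f -> sm U (fun q => (f q)^-1).
Proof. by move=> f0 sf k; exact: Ck_inv. Qed.
Lemma sm_exp f : sm U f -> sm U (fun q => expR (f q)).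
Proof. by move=> sf k; exact: Ck_exp. Qed.
Lemma sm_comp m (V : set 'rV[R]_m) (g : 'rV[R]_m -> R) (f : 'rV[R]_n -> 'rV[R]_m) :
  open V -> (forall q, U q -> V (f q)) -> (forall b, sm U (fun q => f q 0 b)) ->
  sm V g -> sm U (fun q => g (f q)).
Proof.
move=> oV fUV sf sg k.
exact: (@Ck_comp R n m k U V g f oU oV fUV (fun b => sf b k) (sg k)).
Qed.

Lemma partial_cst i c p : partial i (fun _ : 'rV[R]_n => c) p = 0 :> R.
Proof. exact: derive_cst. Qed.
Lemma partial_add f g i p : sm U f -> sm U g -> U p ->
  partial i (fun q => f q + g q) p = partial i f p + partial i g p.
Proof. by move=> sf sg Up; apply: deriveD; exact: sm_derivable. Qed.
Lemma partial_mul f g i p : sm U f -> sm U g -> U p ->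
  partial i (fun q => f q * g q) p = f p * partial i g p + g p * partial i f p.
Proof. by move=> sf sg Up; apply: deriveM; exact: sm_derivable. Qed.
Lemma partial_exp f i p : sm U f -> U p ->
  partial i (fun q => expR (f q)) p = expR (f p) * partial i f p.
Proof.
move=> sf Up; rewrite /partial.
by have /@derive_val -> := is_derive_comp1 (is_derive_expR (f p))
  (derivableP (@sm_derivable f i p sf Up)).
Qed.
Lemma partial_comp m (V : set 'rV[R]_m) (g : 'rV[R]_m -> R)
    (f : 'rV[R]_n -> 'rV[R]_m) i p :
  open V -> (forall b, sm U (fun q => f q 0 b)) -> sm V g -> U p -> V (f p) ->
  partial i (fun q => g (f q)) p =
  \sum_b partial b g (f p) * partial i (fun q => f q 0 b) p.
Proof.
move=> oV sf sg Up Vp; rewrite /partial.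
have df : derivable f p (delta_mx 0 i).
  by apply/derivable_mxP => a b; rewrite ord1; exact: sm_derivable.
by have /@derive_val -> := is_derive_comp_rV oV (sg 1%N) Vp df.
Qed.
Lemma partial_swap f i j p : sm U f -> U p ->
  partial i (partial j f) p = partial j (partial i f) p.
Proof.
move=> sf Up; apply: (@schwarz R n f U) => //.
- by move=> q k Uq; exact: sm_derivable.
- by move=> q k l Uq; apply: sm_derivable Uq; exact: sm_partial.
- by move=> k l; apply: sm_cont Up; do 2 apply: sm_partial.
Qed.

End Smooth.

(** * Partial derivatives and derivations *)

(* [partial] on scalar functions, locked, with its values typed in [R] itself:
   [ring] and [field] would otherwise unfold it when they compare atoms. *)
HB.lock Definition pd {R : realType} {n : nat} (i : 'I_n) (f : 'rV[R]_n -> R)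
  (p : 'rV[R]_n) : R := partial i f p.

Section ScalarPartial.
Context {R : realType} {n : nat}.
Implicit Types (f g : 'rV[R]_n -> R).

Lemma pdE (i : 'I_n) f p : pd i f p = partial i f p. Proof. by rewrite pd.unlock. Qed.
Lemma pd_funE (i : 'I_n) f : pd i f = partial i f. Proof. by rewrite pd.unlock. Qed.

Variables (U : set 'rV[R]_n) (oU : open U).

Lemma pd_eqon f g i p : (forall q, U q -> f q = g q) -> U p -> pd i f p = pd i g p.
Proof. by move=> fg Up; rewrite !pdE; exact: (partial_eqon i oU fg Up). Qed.
Lemma sm_pd f i : sm U f -> sm U (pd i f).
Proof. by move=> sf; rewrite pd_funE; exact: (sm_partial i sf). Qed.
Lemma pd_coord (i j : 'I_n) p : pd i (fun q : 'rV[R]_n => q 0 j) p = (i == j)%:R.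
Proof. rewrite !pdE; exact: partial_coord. Qed.
Lemma pd_cst i (c : R) (p : 'rV[R]_n) : pd i (fun=> c) p = 0.
Proof. rewrite !pdE; exact: partial_cst. Qed.
Lemma pd_add f g i p : sm U f -> sm U g -> U p ->
  pd i (fun q => f q + g q) p = pd i f p + pd i g p.
Proof. rewrite !pdE; exact: partial_add. Qed.
Lemma pd_mul f g i p : sm U f -> sm U g -> U p ->
  pd i (fun q => f q * g q) p = f p * pd i g p + g p * pd i f p.
Proof. rewrite !pdE; exact: partial_mul. Qed.
Lemma pd_exp f i p : sm U f -> U p ->
  pd i (fun q => expR (f q)) p = expR (f p) * pd i f p.
Proof. rewrite !pdE; exact: partial_exp. Qed.
Lemma pd_swap f i j p : sm U f -> U p -> pd i (pd j f) p = pd j (pd i f) p.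
Proof. by move=> sf Up; rewrite !pd_funE; exact: (partial_swap oU i j sf Up). Qed.
Lemma pd_comp m (V : set 'rV[R]_m) (g : 'rV[R]_m -> R)
    (f : 'rV[R]_n -> 'rV[R]_m) i p :
  open V -> (forall b, sm U (fun q => f q 0 b)) -> sm V g -> U p -> V (f p) ->
  pd i (fun q => g (f q)) p =
  \sum_b partial b g (f p) * pd i (fun q => f q 0 b) p.
Proof. move=> oV sf sg Up Vp; rewrite pdE (partial_comp i oV sf sg Up Vp).
by apply: eq_bigr => b _; rewrite pdE. Qed.

End ScalarPartial.

Section Derivation.
Context {R : realType} {n : nat}.
Implicit Types (f g : 'rV[R]_n -> R) (U : set 'rV[R]_n).

(** Partial derivatives, vector fields and scaled frame fields share this interface; [der_eqon] is
    locality, since functions are total but identities hold on [U] only. *)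
Record derivation U (D : ('rV[R]_n -> R) -> 'rV[R]_n -> R) : Prop := Derivation {
  der_sm : forall f, sm U f -> sm U (D f);
  der_eqon : forall f g, (forall q, U q -> f q = g q) ->
    forall q, U q -> D f q = D g q;
  der_cst : forall c p, U p -> D (fun=> c) p = 0;
  der_add : forall f g p, sm U f -> sm U g -> U p ->
    D (fun q => f q + g q) p = D f p + D g p;
  der_mul : forall f g p, sm U f -> sm U g -> U p ->
    D (fun q => f q * g q) p = f p * D g p + g p * D f p }.

(** Smoothness travels with the value, so that [der] can assemble the derivative of a compound
    expression from those of its atoms. *)
Definition isD U D f g := sm U f /\ forall p, U p -> D f p = g p.

Variables (U : set 'rV[R]_n) (oU : open U).
Variables (D : ('rV[R]_n -> R) -> 'rV[R]_n -> R) (dD : derivation U D).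

Lemma isD_self f : sm U f -> isD U D f (D f). Proof. by []. Qed.

Lemma isD_eq f g g' : isD U D f g -> (forall p, U p -> g p = g' p) -> isD U D f g'.
Proof. by move=> [sf fg] gg'; split => // p Up; rewrite fg// gg'. Qed.

Lemma isD_eqon f f' g : (forall p, U p -> f p = f' p) -> isD U D f g -> isD U D f' g.
Proof.
move=> ff' [sf fg]; split; first exact: sm_eqon sf.
by move=> p Up; rewrite -fg//; apply: (der_eqon dD) => // q /ff' ->.
Qed.

Lemma isD_cst c : isD U D (fun=> c) (fun=> 0).
Proof. by split; [exact: sm_cst | exact: der_cst]. Qed.

Lemma isD_add f g f' g' : isD U D f f' -> isD U D g g' ->
  isD U D (fun q => f q + g q) (fun q => f' q + g' q).
Proof.
move=> [sf ff] [sg gg]; split; first exact: sm_add.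
by move=> p Up; rewrite (der_add dD)// ff// gg.
Qed.

Lemma isD_mul f g f' g' : isD U D f f' -> isD U D g g' ->
  isD U D (fun q => f q * g q) (fun q => f q * g' q + g q * f' q).
Proof.
move=> [sf ff] [sg gg]; split; first exact: sm_mul.
by move=> p Up; rewrite (der_mul dD)// ff// gg.
Qed.

Lemma isD_opp f f' : isD U D f f' -> isD U D (fun q => - f q) (fun q => - f' q).
Proof.
move=> Hf; apply: (@isD_eqon (fun q => (-1) * f q)); first by move=> p _; rewrite mulN1r.
apply: isD_eq (isD_mul (isD_cst (-1)) Hf) _ => p _.
by rewrite mulr0 addr0 mulN1r.
Qed.

Lemma isD_inv f f' : (forall q, U q -> f q != 0) -> isD U D f f' ->
  isD U D (fun q => (f q)^-1) (fun q => - ((f q)^-1 * (f q)^-1 * f' q)).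
Proof.
move=> f0 Hf; have [sf ff] := Hf; have sg := sm_inv oU f0 sf; split => // p Up.
have E : D (fun q => f q * (f q)^-1) p = 0.
  rewrite -(der_cst dD 1 Up); apply: (der_eqon dD) => // q Uq.
  by rewrite mulfV// f0.
move: E; rewrite (der_mul dD)// ff// => /eqP; rewrite addr_eq0 => /eqP E.
apply: (mulfI (f0 _ Up)); rewrite E mulrN !mulrA mulfV ?f0//.
by rewrite mul1r.
Qed.

End Derivation.

Lemma pd_derivation {R : realType} {n : nat} (U : set 'rV[R]_n) (k : 'I_n) :
  open U -> derivation U (pd k).
Proof.
move=> oU; split.
- by move=> f; exact: sm_pd.
- by move=> f g fg q Uq; exact: (pd_eqon oU k fg Uq).
- by move=> c p _; exact: pd_cst.
- by move=> f g p; exact: pd_add.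
- by move=> f g p; exact: pd_mul.
Qed.

HB.lock Definition vd {R : realType} {n : nat} (c : 'I_n -> 'rV[R]_n -> R)
  (F : 'rV[R]_n -> R) (q : 'rV[R]_n) : R := \sum_i c i q * pd i F q.

Section VectorField.
Context {R : realType} {n : nat}.
Implicit Types (f g F : 'rV[R]_n -> R) (U : set 'rV[R]_n).

Lemma vdE c F q : vd c F q = \sum_i c i q * pd i F q. Proof. by rewrite vd.unlock. Qed.
Lemma vd_funE c F : vd c F = fun q => \sum_i c i q * pd i F q.
Proof. by rewrite vd.unlock. Qed.

Variables (U : set 'rV[R]_n) (oU : open U).

Lemma sm_sum (I : finType) (F : I -> 'rV[R]_n -> R) :
  (forall i, sm U (F i)) -> sm U (fun q => \sum_i F i q).
Proof.
move=> HF; elim: (index_enum _) => [|b s IH].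
  by apply: (sm_eqon oU _ (sm_cst U 0)) => q _; rewrite big_nil.
by apply: (sm_eqon oU _ (sm_add oU (HF b) IH)) => q _; rewrite big_cons.
Qed.

Lemma pd_sum (I : finType) (F : I -> 'rV[R]_n -> R) j p :
  (forall i, sm U (F i)) -> U p ->
  pd j (fun q => \sum_i F i q) p = \sum_i pd j (F i) p.
Proof.
move=> HF Up.
suff H s : sm U (fun q => \sum_(i <- s) F i q) /\
   pd j (fun q => \sum_(i <- s) F i q) p = \sum_(i <- s) pd j (F i) p.
  exact: (H (index_enum I)).2.
elim: s => [|b s [IH1 IH2]].
  split; first by apply: (sm_eqon oU _ (sm_cst U 0)) => q _; rewrite big_nil.
  rewrite big_nil -[RHS](pd_cst j 0 p).
  by apply: (pd_eqon oU _ _ Up) => q _; rewrite big_nil.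
split; first by apply: (sm_eqon oU _ (sm_add oU (HF b) IH1)) => q _; rewrite big_cons.
rewrite big_cons -IH2 -(pd_add _ (HF b) IH1 Up).
by apply: (pd_eqon oU _ _ Up) => q _; rewrite big_cons.
Qed.

Lemma vd_derivation c : (forall i, sm U (c i)) -> derivation U (vd c).
Proof.
move=> sc; split.
- by move=> f sf; rewrite vd_funE; apply: sm_sum => i; apply: sm_mul => //; exact: sm_pd.
- move=> f g fg q Uq; rewrite !vdE; apply: eq_bigr => i _; congr (_ * _).
  exact: (pd_eqon oU _ fg Uq).
- by move=> a p Up; rewrite vdE big1// => i _; rewrite pd_cst mulr0.
- move=> f g p sf sg Up; rewrite !vdE -big_split; apply: eq_bigr => i _ /=.
  by rewrite (pd_add i sf sg Up) mulrDr.
- move=> f g p sf sg Up; rewrite !vdE !mulr_sumr -big_split.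
  by apply: eq_bigr => i _ /=; rewrite (pd_mul i sf sg Up); ring.
Qed.

(** The second order terms cancel by symmetry of the second partial derivatives. Two fields
    therefore commute once the coefficients of their bracket vanish. *)
Lemma vd_bracket c c' F p : (forall i, sm U (c i)) -> (forall i, sm U (c' i)) ->
  sm U F -> U p ->
  vd c (vd c' F) p - vd c' (vd c F) p =
  \sum_k (vd c (c' k) p - vd c' (c k) p) * pd k F p.
Proof.
move=> sc sc' sF Up.
have expand a b : (forall i, sm U (a i)) -> (forall i, sm U (b i)) ->
    vd a (vd b F) p = \sum_i \sum_k (a i p * b k p * pd i (pd k F) p)
                    + \sum_k vd a (b k) p * pd k F p.
  move=> sa sb.
  have -> : vd a (vd b F) p = \sum_i \sum_k (a i p * b k p * pd i (pd k F) p +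
      a i p * pd i (b k) p * pd k F p).
    rewrite vdE; apply: eq_bigr => i _.
    have -> : pd i (vd b F) p = \sum_k pd i (fun q => b k q * pd k F q) p.
      by rewrite vd_funE; apply: (@pd_sum _ (fun k q => b k q * pd k F q) i p) => // k;
        apply: sm_mul => //; exact: sm_pd.
    rewrite mulr_sumr; apply: eq_bigr => k _.
    by rewrite (pd_mul i (sb k) (sm_pd k sF) Up); ring.
  under eq_bigr do rewrite big_split.
  rewrite big_split; congr (_ + _); rewrite exchange_big; apply: eq_bigr => k _.
  by rewrite vdE mulr_suml.
rewrite (expand _ _ sc sc') (expand _ _ sc' sc).
rewrite [X in _ - (X + _)]exchange_big /=.
rewrite [X in _ - (X + _)](eq_bigr (fun i => \sum_k c i p * c' k p * pd i (pd k F) p)).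
  by rewrite opprD addrACA subrr add0r -sumrB; apply: eq_bigr => k _; rewrite mulrBl.
move=> i _; apply: eq_bigr => k _.
by rewrite (pd_swap oU k i sF Up) [c' k p * _]mulrC.
Qed.

End VectorField.

Lemma isD_exp {R : realType} {m : nat} (U : set 'rV[R]_m) (oU : open U) D
    (dD : derivation U D) f f' k :
  isD U D f f' -> isD U D (fun q => f q ^+ k) (fun q => k%:R * f q ^+ k.-1 * f' q).
Proof.
move=> Hf; elim: k => [|k IH].
  by apply: isD_eq (isD_cst dD 1) _ => q _; rewrite !mul0r.
have H := isD_mul oU dD Hf IH.
apply: (@isD_eqon _ _ _ oU _ dD (fun q => f q * f q ^+ k)); first by move=> q _; rewrite exprS.
apply: isD_eq H _ => q _; case: k {IH} => [|k]; rewrite /=; first by ring.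
by rewrite exprS -[k.+2]addn1 natrD; ring.
Qed.

(* Solves [isD U D F ?G] for a compound [F], from hypotheses on its atoms. *)
Ltac der oU dD :=
  repeat first [ eassumption
    | apply: (isD_cst dD) | apply: (isD_add oU dD) | apply: (isD_opp oU dD)
    | apply: (isD_exp oU dD) | apply: (isD_mul oU dD) | apply: (isD_inv oU dD) ].

(** * Transcendence of a primitive of a rational function *)

(* Comparing orders of vanishing at a simple root of [A]: there is no rational
   function [v / u] with [A * (v / u)^`() = c]. *)
Lemma log_poly {R : numFieldType} (u v A1 : {poly R}) (c rho : R) : c != 0 ->
  A1.[rho] != 0 ->
  (A1 * ('X - rho%:P)) * (u * v^`() - u^`() * v) = c *: (u * u) -> u = 0.
Proof.
move=> c0 A1r; set x := 'X - rho%:P; set A := A1 * x => E.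
have [//|u0] := eqVneq u 0; exfalso.
have Ar : A.[rho] = 0 by rewrite hornerM !hornerE subrr mulr0.
have x0 : x != 0 by rewrite polyXsubC_eq0.
have xr : x.[rho] = 0 by rewrite !hornerE subrr.
have dx : x^`() = 1 by rewrite derivB derivX derivC subr0.
have [i [u1 [u1r defu]]] : exists i u1, u1.[rho] != 0 /\ u = u1 * x ^+ i.
  have [i [u1 /implyP /(_ u0) Hu1 E1]] := multiplicity_XsubC u rho.
  by exists i, u1.
have u10 : u1 != 0 by apply: contraNneq u1r => ->; rewrite horner0.
have dxn k : (x ^+ k.+1)^`() = x ^+ k *+ k.+1.
  by rewrite deriv_exp dx mul1r.
have [v0|v0] := eqVneq v 0.
  move: E; rewrite v0 deriv0 !mulr0 subr0 mulr0 => /esym/eqP.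
  by rewrite scaler_eq0 (negbTE c0) mulf_eq0 (negbTE u0).
have [j [v1 [v1r defv]]] : exists j v1, v1.[rho] != 0 /\ v = v1 * x ^+ j.
  have [j [v1 /implyP /(_ v0) Hv1 E1]] := multiplicity_XsubC v rho.
  by exists j, v1.
clearbody x.
have red k (a b : {poly R}) : (a * x ^+ k) * (b * x ^+ k)^`() - (a * x ^+ k)^`() * (b * x ^+ k)
    = x ^+ k * x ^+ k * (a * b^`() - a^`() * b).
  by rewrite !derivM; ring.
(* If [v / u] is regular at [rho], cancelling [x ^+ i] twice leaves a left side that vanishes at
   [rho] and a right side that does not. *)
have [ij|ij] := leqP i j.
  have E' : A * (u1 * (v1 * x ^+ (j - i))^`() - u1^`() * (v1 * x ^+ (j - i))) = c *: (u1 * u1).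
    have : x ^+ i * x ^+ i != 0 by rewrite mulf_neq0 ?expf_neq0.
    move=> /mulfI; apply.
    have -> : x ^+ i * x ^+ i * (A * (u1 * (v1 * x ^+ (j - i))^`() - u1^`() * (v1 * x ^+ (j - i))))
      = A * (x ^+ i * x ^+ i * (u1 * (v1 * x ^+ (j - i))^`() - u1^`() * (v1 * x ^+ (j - i)))) by ring.
    have E2 : v1 * x ^+ (j - i) * x ^+ i = v by rewrite -mulrA -exprD subnK.
    by rewrite -red E2 -defu E [in LHS]defu -!mul_polyC; ring.
  have /eqP := congr1 (horner ^~ rho) E'.
  rewrite hornerM Ar mul0r hornerZ hornerM eq_sym.
  by rewrite !mulf_eq0 (negbTE c0) (negbTE u1r).
(* Here [v / u] has a pole of order [k.+1]; its derivative has one of order [k.+2], which the simple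
   zero of [A] lowers by one only. *)
have [k defk] : exists k, (i = j + k.+1)%N.
  by exists (i - j).-1; rewrite prednK ?subn_gt0// subnKC// ltnW.
have E' : A1 * (u1 * (x * v1^`()) - (u1^`() * x + u1 *+ k.+1) * v1) =
    c *: (u1 * u1) * x ^+ k.+1.
  have : x ^+ j * x ^+ j * (x * x ^+ k) != 0 by rewrite !mulf_neq0 ?expf_neq0.
  move=> /mulfI; apply.
  have -> : x ^+ j * x ^+ j * (x * x ^+ k) * (c *: (u1 * u1) * x ^+ k.+1) = c *: (u * u).
    by rewrite defu defk exprD !exprS -!mul_polyC; ring.
  have E2 : u = (u1 * x ^+ k.+1) * x ^+ j by rewrite defu defk -mulrA -exprD addnC.
  rewrite -E /A E2 defv red.
  by rewrite derivM dxn exprS -mulr_natl -[_ *+ k.+1]mulr_natl; ring.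
have /eqP := congr1 (horner ^~ rho) E'.
rewrite !(hornerM, hornerD, hornerN, hornerMn, hornerZ, horner_exp) xr.
rewrite expr0n /= !(mul0r, mulr0) sub0r add0r mulrN oppr_eq0 !mulf_eq0.
by rewrite (negbTE A1r) (negbTE v1r) mulrn_eq0 /= (negbTE u1r).
Qed.

Lemma poly_itv_eq0 {R : realFieldType} (p : {poly R}) (lo hi : R) : lo < hi ->
  (forall t, lo < t < hi -> p.[t] = 0) -> p = 0.
Proof.
move=> lh H; apply/eqP/negPn/negP => p0.
pose f (k : nat) : R := lo + (hi - lo) * (k.+1%:R / (size p).+2%:R).
have d0 : 0 < hi - lo by rewrite subr_gt0.
have fI : injective f.
  move=> i j /addrI/(mulfI (lt0r_neq0 d0)) /(mulIf _) E.
  have /eqP : i.+1%:R = j.+1%:R :> R by apply: E; rewrite invr_neq0// pnatr_eq0.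
  by rewrite eqr_nat => /eqP [].
have := @max_poly_roots R p (map f (iota 0 (size p))) p0.
rewrite size_map size_iota ltnn => /(_ _ _)/negP; apply => //; last first.
  by rewrite map_inj_uniq ?iota_uniq.
apply/allP => _ /mapP[k + ->]; rewrite mem_iota /= add0n => ks.
apply/rootP/H; rewrite /f ltrDl mulr_gt0 ?divr_gt0// -ltrBrDl gtr_pMr//.
by rewrite ltr_pdivrMr// mul1r ltr_nat ltnS ltnS ltnW.
Qed.

(** * Polynomial relations satisfied by a logarithm on an interval *)

Section Interval.
Context {R : realType}.
Implicit Types (F G : R -> R) (lo hi : R).

Lemma itv_near lo hi t : lo < t < hi -> \forall x \near t, lo < x < hi.
Proof.
move=> th; have H : nbhs t [set` `]lo, hi[].
  by apply: open_nbhs_nbhs; split; [exact: interval_open | rewrite /= in_itv].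
by apply: filterS H => x /=; rewrite in_itv.
Qed.

Lemma is_derive_itv0 lo hi F t d : (forall x, lo < x < hi -> F x = 0) ->
  lo < t < hi -> is_derive t 1 F d -> d = 0.
Proof.
move=> F0 tI [_ <-].
rewrite (@near_eq_derive _ _ _ F (cst 0)) ?derive_cst//.
by apply: filterS (itv_near tI) => x /F0.
Qed.

Lemma derive0_itv_cst lo hi F : (forall x, lo < x < hi -> is_derive x 1 F 0) ->
  forall s t, lo < s < hi -> lo < t < hi -> F s = F t.
Proof.
move=> dF; suff H s t : s <= t -> lo < s < hi -> lo < t < hi -> F s = F t.
  move=> s t sI tI; case: (leP s t) => [st|/ltW ts]; first exact: H.
  by rewrite (H t s).
move=> st /andP[ls sh] /andP[lt th].
have [|| c _] := @MVT_segment R F (fun=> 0) s t st.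
- by move=> x; rewrite in_itv /= => /andP[sx xt]; apply: dF; rewrite (lt_trans ls)// (lt_trans xt).
- apply: derivable_within_continuous => x; rewrite in_itv /= => /andP[sx xt].
  by apply: ex_derive; apply: dF; rewrite (lt_le_trans ls)// (le_lt_trans xt).
- by rewrite mul0r => /eqP; rewrite subr_eq0 => /eqP ->.
Qed.

Variables (A1 : {poly R}) (rho c lo hi : R) (L : R -> R).
Let A := A1 * ('X - rho%:P).
Hypotheses (c0 : c != 0) (A1r : A1.[rho] != 0) (lh : lo < hi).
Hypothesis (A0 : forall t, lo < t < hi -> A.[t] != 0).
Hypothesis (dL : forall t, lo < t < hi -> is_derive t 1 L (c / A.[t])).

(** Otherwise [L = - v / u] would be a rational function with [A L' = c], which [log_poly]
    excludes. *)
Lemma log_linear (u v : {poly R}) :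
  (forall t, lo < t < hi -> u.[t] * L t + v.[t] = 0) -> u = 0 /\ v = 0.
Proof.
move=> H; suff u0 : u = 0.
  split=> //; apply: (poly_itv_eq0 lh) => t tI.
  by have := H t tI; rewrite u0 horner0 mul0r add0r.
have cN0 : - c != 0 by rewrite oppr_eq0.
apply: (@log_poly _ u v A1 (- c) rho cN0 A1r); apply/eqP; rewrite -subr_eq0; apply/eqP.
apply: (poly_itv_eq0 lh) => t tI; have := A0 tI; rewrite -/A.
have dI : is_derive t 1 (fun x => u.[x] * L x + v.[x])
    (u.[t] * (c / A.[t]) + L t * (u^`()).[t] + (v^`()).[t]).
  apply: is_deriveD; have := is_deriveM (is_derive_poly u t) (dL tI).
  exact.
have E := is_derive_itv0 H tI dI; have Ht := H t tI.
rewrite hornerD hornerN [(A * _).[t]]hornerM hornerZ => At0.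
move: (A.[t]) E At0 => a E At0; rewrite !(hornerD, hornerN, hornerM).
have {}Ht : v.[t] = - (u.[t] * L t) by apply/eqP; rewrite -addr_eq0 addrC Ht.
have {}E : (v^`()).[t] = - (u.[t] * (c / a) + L t * (u^`()).[t]).
  by apply/eqP; rewrite -addr_eq0 addrC E.
by rewrite E Ht; field.
Qed.

Lemma log_quadratic (q2 q1 q0 : {poly R}) :
  (forall t, lo < t < hi -> q2.[t] * (L t * L t) + q1.[t] * L t + q0.[t] = 0) ->
  [/\ q2 = 0, q1 = 0 & q0 = 0].
Proof.
move=> H; suff q20 : q2 = 0.
  have [|q10 q00] := @log_linear q1 q0; last by split.
  by move=> t tI; have := H t tI; rewrite q20 horner0 mul0r add0r.
(* [u L + v] is [A] times the combination of [q2] times the derivative of the relation minus [q2']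
   times the relation, in which [L ^ 2] cancels. That [u] vanishes means [A (q1 / q2)' = - 2 c]. *)
pose u := (2 * c) *: (q2 * q2) + A * (q2 * q1^`() - q2^`() * q1).
pose v := c *: (q1 * q2) + A * (q2 * q0^`() - q2^`() * q0).
have [|u0 _] := @log_linear u v.
  move=> t tI; have At0 := A0 tI.
  have dLL := is_deriveM (dL tI) (dL tI).
  have dI : is_derive t 1 (fun x => q2.[x] * (L x * L x) + q1.[x] * L x + q0.[x])
    (q2.[t] * (L t * (c / A.[t]) + L t * (c / A.[t])) + (L t * L t) * (q2^`()).[t]
     + (q1.[t] * (c / A.[t]) + L t * (q1^`()).[t]) + (q0^`()).[t]).
    apply: is_deriveD; apply: is_deriveD.
    - exact: (is_deriveM (is_derive_poly q2 t) dLL).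
    - exact: (is_deriveM (is_derive_poly q1 t) (dL tI)).
  have E := is_derive_itv0 H tI dI; have Ht := H t tI.
  rewrite /u /v 2!hornerD ![(A * _).[t]]hornerM !hornerZ.
  move: (A.[t]) E At0 => a E At0; rewrite !(hornerD, hornerN, hornerM).
  have {}Ht : q0.[t] = - (q2.[t] * (L t * L t) + q1.[t] * L t).
    by apply/eqP; rewrite -addr_eq0 addrC Ht.
  have {}E : (q0^`()).[t] = - (q2.[t] * (L t * (c / a) + L t * (c / a)) + (L t * L t) * (q2^`()).[t]
     + (q1.[t] * (c / a) + L t * (q1^`()).[t])).
    by apply/eqP; rewrite -addr_eq0 addrC E.
  by rewrite E Ht; field.
have cN0 : - (2 * c) != 0 by rewrite oppr_eq0 mulf_neq0.
apply: (@log_poly _ q2 q1 A1 (- (2 * c)) rho cN0 A1r).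
by apply/eqP; rewrite scaleNr -addr_eq0 addrC -/A -/u u0.
Qed.

End Interval.

(** * The relation along a curve of constant [p]: [t] is [x], and [S], [T1], [T2] are [S], [Y S],
    [Z S] *)

Section Curve.
Context {R : realType}.
Variables (kap p0 D f k l fy lo hi : R) (S T1 T2 : R -> R).
Let A (t : R) : R := D - (t - p0) ^+ 2.
Let X (t : R) : R := kap - t.
Hypotheses (lh : lo < hi) (Apos : forall t, lo < t < hi -> 0 < A t).
Hypothesis dS : forall t, lo < t < hi -> is_derive t 1 S (f / A t ^+ 2).
Hypothesis dT1 : forall t, lo < t < hi ->
  is_derive t 1 T1 (l / A t ^+ 2 + 4 * f * X t / A t ^+ 3).
Hypothesis dT2 : forall t, lo < t < hi ->
  is_derive t 1 T2 (fy / A t ^+ 2 + 4 * f ^+ 2 / A t ^+ 3).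
Hypothesis rel : forall t, lo < t < hi ->
  X t ^+ 2 * (X t * T2 t - l * S t - X t ^+ 2) =
  (f * X t + S t * A t ^+ 2) * (X t * T1 t - k * S t).

Let e := kap - p0.
Let pxi : {poly R} := 'X - p0%:P.
Let pA : {poly R} := D%:P - pxi ^+ 2.
Let pX : {poly R} := kap%:P - 'X.

Let pxiE t : pxi.[t] = t - p0. Proof. by rewrite !hornerE. Qed.
Let pAE t : pA.[t] = A t. Proof. by rewrite /pA !hornerE. Qed.
Let pXE t : pX.[t] = X t. Proof. by rewrite !hornerE. Qed.

Let mid : lo < (lo + hi) / 2 < hi.
Proof. by have [-> ->] := midf_lt lh. Qed.

Let D0 : 0 < D.
Proof.
have := Apos mid; rewrite subr_gt0; apply: le_lt_trans; exact: sqr_ge0.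
Qed.

Let A_neq0 t : lo < t < hi -> A t != 0.
Proof. by move=> /Apos /lt0r_neq0. Qed.

Let dA (t : R) : is_derive t (1 : R) A (- (2 * (t - p0))).
Proof.
have := is_derive_poly pA t; rewrite (_ : horner pA = A); last by apply/funext => x; exact: pAE.
move=> H; apply: is_derive_eq H _.
by rewrite derivB derivC deriv_exp derivB derivX derivC !hornerE /=; ring.
Qed.

Let dAV (t : R) : lo < t < hi -> is_derive t (1 : R) (fun x => (A x)^-1) (2 * (t - p0) / A t ^+ 2).
Proof.
move=> tI; apply: is_derive_eq (is_deriveV (A_neq0 tI) (dA t)) _.
by rewrite -[LHS]/(_ * _); field; exact: A_neq0.
Qed.

Let dlin (a b t : R) : is_derive t (1 : R) (fun x : R => a * (x - p0) + b) a.
Proof.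
have := is_derive_poly (a *: pxi + b%:P) t.
rewrite (_ : horner _ = fun x : R => a * (x - p0) + b); last first.
  by apply/funext => x; rewrite !hornerE.
by move=> H; apply: is_derive_eq H _; rewrite derivD derivZ derivB derivX !derivC !hornerE; ring.
Qed.

(** Up to rational functions, [T1] and [T2] are constant multiples of [S], and [S] is a logarithm
    [L]. The relation becomes quadratic in [L] with polynomial coefficients, which must all
    vanish. *)
Lemma curve_f_neq0 : f != 0 -> False.
Proof.
move=> f0; have Dn0 : D != 0 by rewrite gt_eqF.
(* With [xi = t - p0], the derivative of [xi / (4 D A^2)] is [1 / A^3 - 3 / (4 D A^2)]. This turns
   the [1 / A^3] terms into multiples of [S'], with [X = e - xi] in the case of [T1]. *)
pose al := (l + 3 * f * e / D) / f; pose be := (fy + 3 * f ^+ 2 / D) / f.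
have dAV2 t : lo < t < hi -> is_derive t (1 : R) (fun x => (A x)^-1 * (A x)^-1)
    (4 * (t - p0) / A t ^+ 3).
  move=> tI; apply: is_derive_eq (is_deriveM (dAV tI) (dAV tI)) _.
  by rewrite -![_ *: _]/(_ * _); field; exact: A_neq0.
have [c1 Hc1] : exists c1, forall t, lo < t < hi ->
    T1 t = al * S t + f * (e * (t - p0) - D) / (D * A t ^+ 2) + c1.
  pose F t := T1 t + (- al * S t + (- f * e / D * (t - p0) + f) * ((A t)^-1 * (A t)^-1)).
  exists (F ((lo + hi) / 2)) => t tI.
  have -> : F ((lo + hi) / 2) = F t.
    apply: (@derive0_itv_cst R lo hi F _ _ _ mid tI) => s sI.
    have As := A_neq0 sI.
    have H := is_deriveD (dT1 sI) (is_deriveD (is_deriveZ (- al) (dS sI))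
      (is_deriveM (dlin (- f * e / D) f s) (dAV2 s sI))).
    apply: is_derive_eq H _; rewrite /al -![_ *: _]/(_ * _) /X /e.
    by move: As; rewrite /A => As; field; rewrite As f0 Dn0.
  by rewrite /F; field; rewrite A_neq0.
have [c2 Hc2] : exists c2, forall t, lo < t < hi ->
    T2 t = be * S t + f ^+ 2 * (t - p0) / (D * A t ^+ 2) + c2.
  pose F t := T2 t + (- be * S t + (- f ^+ 2 / D * (t - p0) + 0) * ((A t)^-1 * (A t)^-1)).
  exists (F ((lo + hi) / 2)) => t tI.
  have -> : F ((lo + hi) / 2) = F t.
    apply: (@derive0_itv_cst R lo hi F _ _ _ mid tI) => s sI.
    have As := A_neq0 sI.
    have H := is_deriveD (dT2 sI) (is_deriveD (is_deriveZ (- be) (dS sI))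
      (is_deriveM (dlin (- f ^+ 2 / D) 0 s) (dAV2 s sI))).
    apply: is_derive_eq H _; rewrite /be -![_ *: _]/(_ * _).
    by move: As; rewrite /A => As; field; rewrite As f0 Dn0.
  by rewrite /F; field; rewrite A_neq0.
pose pal := al *: pX - k%:P; pose pl := (f * (e ^+ 2 - D) / D)%:P - (f * e / D) *: pX.
pose pr := (c1 *: (pA * pA) + pl - pX * (be *: pX - l%:P)).
pose q1 := f *: (pX * pal) + pX * pr.
pose Q2 := pA * (pA * (pA * pal)).
pose Q1 := (f / D) *: (pxi * (pA * (pA * pal))) + pA * q1.
pose Q0 := (f ^+ 2 / (4 * D ^+ 2)) *: (pA * pal * (pxi * pxi)) +
  (f / (2 * D)) *: (q1 * pxi) +
  pX * pX * (pA * ((f * c1)%:P - c2 *: pX + pX * pX) - (f ^+ 2 / D)%:P).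
(* [(t - p0) / (2 D A)] is the rational part of a primitive of [1 / A^2]; the rest has derivative
   [1 / (2 D A)], with simple poles. *)
pose L t := S t - f / (2 * D) * ((t - p0) / A t).
pose d := Num.sqrt D; have dd : d ^+ 2 = D by rewrite sqr_sqrtr// ltW.
have d0 : d != 0 by rewrite sqrtr_eq0 -ltNge.
pose rho := p0 + d; pose A1 : {poly R} := - (pxi + d%:P).
have pAfac : A1 * ('X - rho%:P) = pA.
  by rewrite /A1 /pA -dd /pxi /rho !rmorphD rmorphXn /=; ring.
have A1r : A1.[rho] != 0.
  have -> : A1.[rho] = - (2 * d) by rewrite /A1 hornerN hornerD pxiE hornerC /rho; ring.
  by rewrite oppr_eq0 mulf_neq0.
have c0 : f / (2 * D) != 0 by rewrite !mulf_neq0 ?invr_eq0 ?mulf_neq0.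
have A0' t : lo < t < hi -> (A1 * ('X - rho%:P)).[t] != 0.
  by move=> tI; rewrite pAfac pAE A_neq0.
have dL t : lo < t < hi -> is_derive t 1 L (f / (2 * D) / (A1 * ('X - rho%:P)).[t]).
  move=> tI; rewrite pAfac pAE; have At := A_neq0 tI.
  have H := is_deriveB (dS tI) (is_deriveZ (f / (2 * D)) (is_deriveM (dlin 1 0 t) (dAV tI))).
  have -> : L = (fun x => S x - (f / (2 * D)) *: ((1 * (x - p0) + 0) * (A x)^-1)).
    by apply/funext => x; rewrite /L mul1r addr0.
  apply: is_derive_eq H _; rewrite -![_ *: _]/(_ * _).
  by move: At; rewrite /A => At; field; rewrite At Dn0.
have [|Q20 Q10 _] := @log_quadratic R A1 rho (f / (2 * D)) lo hi L c0 A1r lh A0' dL Q2 Q1 Q0.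
  move=> t tI; have At := A_neq0 tI; have := rel tI; rewrite (Hc1 _ tI) (Hc2 _ tI).
  rewrite /Q2 /Q1 /Q0 /q1 /pr /pl /pal.
  move: (pxi) (pA) (pX) (pxiE t) (pAE t) (pXE t) => qxi qA qX ex eA eX.
  rewrite !(hornerD, hornerN, hornerM, hornerZ, hornerC) ex eA eX.
  have -> : S t = L t + f / (2 * D) * ((t - p0) / A t) by rewrite /L addrNK.
  move: (L t) => Lt; move: At; rewrite /A /X => At.
  move=> /eqP; rewrite -subr_eq0 => /eqP E.
  (* [Q2], [Q1], [Q0] are the coefficients of the relation after multiplication by [- A], which
     clears the denominators. *)
  apply: (mulfI (_ : -1 / (D - (t - p0) ^+ 2) != 0)).
    by rewrite mulf_neq0 ?oppr_eq0 ?oner_eq0// invr_eq0.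
  rewrite mulr0 -[RHS]E /e.
  by field; rewrite At Dn0.
have pA0 : pA != 0.
  apply: contraNneq Dn0 => E; have := pAE p0.
  by rewrite E horner0 /A subrr expr0n subr0 => <-.
have pX0 : pX != 0.
  apply: contraNneq (oner_neq0 R) => E; have := pXE (kap - 1).
  by rewrite E horner0 /X opprB addrCA subrr addr0 => <-.
have pal0 : pal = 0.
  by move/eqP: Q20; rewrite /Q2 !mulf_eq0 !(negbTE pA0) => /eqP.
have pr0 : pr = 0.
  move/eqP: Q10; rewrite /Q1 /q1 pal0 !mulr0 !scaler0 !add0r.
  by rewrite !mulf_eq0 (negbTE pA0) (negbTE pX0) => /eqP.
have palE x : al * x - k = 0.
  have := congr1 (horner ^~ (kap - x)) pal0.
  by rewrite horner0 /pal hornerD hornerZ hornerN hornerC pXE /X opprB addrCA subrr addr0.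
have al0 : al = 0.
  have := palE 0; rewrite mulr0 sub0r => /eqP; rewrite oppr_eq0 => /eqP k0.
  by have := palE 1; rewrite k0 mulr1 subr0.
pose h x := c1 * (D - (e - x) ^+ 2) ^+ 2 + f * (e ^+ 2 - D) / D - f * e / D * x
  - x * (be * x - l).
have h0 x : h x = 0.
  have := congr1 (horner ^~ (kap - x)) pr0.
  rewrite horner0 /pr /pl; move: (pA) (pX) (pAE (kap - x)) (pXE (kap - x)) => qA qX eA eX.
  rewrite !(hornerD, hornerN, hornerM, hornerZ, hornerC) eA eX.
  have -> : X (kap - x) = x by rewrite /X; ring.
  have -> : A (kap - x) = D - (e - x) ^+ 2 by rewrite /A /e; ring.
  by move=> <-; rewrite /h; ring.
have c10 : c1 = 0.
  (* [h] is a polynomial of degree at most 4 with [c1] as coefficient of degree 4, so its fourth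
     difference is [24 c1]. *)
  have n24 : 24 != 0 :> R by rewrite pnatr_eq0.
  apply: (mulfI n24); rewrite mulr0.
  transitivity (h (e + 2) - 4 * h (e + 1) + 6 * h e - 4 * h (e - 1) + h (e - 2)).
    by rewrite /h; field.
  by rewrite !h0; ring.
(* The constant term of [h] gives [D = e^2], the linear one [l = f e / D], while [al = 0] says
   [l = - 3 f e / D]. Hence [e = 0], against [D > 0]. *)
have De : D = e ^+ 2.
  have := h0 0; rewrite /h c10 !mul0r mulr0 subr0 add0r subr0 => /eqP.
  rewrite !mulf_eq0 (negbTE f0) invr_eq0 (negbTE Dn0) orbF /= subr_eq0.
  by move=> /eqP.
have lE : l = f * e / D.
  have := h0 1; have := h0 (-1); rewrite /h c10 !mul0r !add0r De subrr mulr0 mul0r => E1 E2.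
  have e0 : e != 0 by apply: contraNneq Dn0 => e0; rewrite De e0 expr0n.
  by lra.
have : l + 3 * f * e / D = 0.
  by move/eqP: al0; rewrite /al mulf_eq0 invr_eq0 (negbTE f0) orbF => /eqP.
rewrite lE => E.
have : f * e / D = 0 by lra.
move=> /eqP; rewrite !mulf_eq0 (negbTE f0) invr_eq0 (negbTE Dn0) orbF /= => /eqP e0.
by move: Dn0; rewrite De e0 expr0n eqxx.
Qed.

(** [S], [T1], [T2] are now constant and the relation is a polynomial identity. In the variable
    [x = kap - t] it reads [x^3 (t2 - x) = s A^2 (t1 x - k s)], so the roots [e + d] and [e - d] of
    [A] are roots of the left side. *)
Lemma curve_f_eq0 : f = 0 -> l = 0 -> fy = 0 -> False.
Proof.
move=> f0 l0 fy0; have Dn0 : D != 0 by rewrite gt_eqF.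
pose m := (lo + hi) / 2.
have cS t : lo < t < hi -> S t = S m.
  move=> tI; apply: (@derive0_itv_cst R lo hi S _ _ _ tI mid) => s sI.
  by apply: is_derive_eq (dS sI) _; rewrite f0 mul0r.
have cT1 t : lo < t < hi -> T1 t = T1 m.
  move=> tI; apply: (@derive0_itv_cst R lo hi T1 _ _ _ tI mid) => s sI.
  by apply: is_derive_eq (dT1 sI) _; rewrite f0 l0 mulr0 !mul0r addr0.
have cT2 t : lo < t < hi -> T2 t = T2 m.
  move=> tI; apply: (@derive0_itv_cst R lo hi T2 _ _ _ tI mid) => s sI.
  by apply: is_derive_eq (dT2 sI) _; rewrite f0 fy0 expr0n mulr0 !mul0r addr0.
move: (S m) (T1 m) (T2 m) cS cT1 cT2 => s t1 t2 cS cT1 cT2.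
pose P := pX * pX * (t2 *: pX - pX * pX) - s *: (pA * pA * (t1 *: pX - (k * s)%:P)).
have P0 : P = 0.
  apply: (poly_itv_eq0 lh) => t tI; have := rel tI.
  rewrite (cS _ tI) (cT1 _ tI) (cT2 _ tI) f0 l0 /P.
  move: (pA) (pX) (pAE t) (pXE t) => qA qX eA eX.
  rewrite !(hornerD, hornerN, hornerM, hornerZ, hornerC) eA eX => E.
  apply/eqP; rewrite subr_eq0; apply/eqP; transitivity (X t ^+ 2 * (X t * t2 - 0 * s - X t ^+ 2)).
    by ring.
  by rewrite E; ring.
pose h x := x ^+ 3 * (t2 - x) - s * (D - (e - x) ^+ 2) ^+ 2 * (t1 * x - k * s).
have h0 x : h x = 0.
  have := congr1 (horner ^~ (kap - x)) P0.
  rewrite horner0 /P; move: (pA) (pX) (pAE (kap - x)) (pXE (kap - x)) => qA qX eA eX.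
  rewrite !(hornerD, hornerN, hornerM, hornerZ, hornerC) eA eX.
  have -> : X (kap - x) = x by rewrite /X; ring.
  have -> : A (kap - x) = D - (e - x) ^+ 2 by rewrite /A /e; ring.
  by move=> <-; rewrite /h; ring.
pose d := Num.sqrt D; have dd : d ^+ 2 = D by rewrite sqr_sqrtr// ltW.
have d0 : d != 0 by rewrite sqrtr_eq0 -ltNge.
have r1 : e + d = 0 \/ t2 = e + d.
  have := h0 (e + d); rewrite /h -dd.
  have -> : d ^+ 2 - (e - (e + d)) ^+ 2 = 0 by ring.
  rewrite expr0n mulr0 mul0r subr0 => /eqP; rewrite mulf_eq0 expf_eq0 /=.
  by case/orP => [/eqP|]; [left | rewrite subr_eq0 => /eqP; right].
have r2 : e - d = 0 \/ t2 = e - d.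
  have := h0 (e - d); rewrite /h -dd.
  have -> : d ^+ 2 - (e - (e - d)) ^+ 2 = 0 by ring.
  rewrite expr0n mulr0 mul0r subr0 => /eqP; rewrite mulf_eq0 expf_eq0 /=.
  by case/orP => [/eqP|]; [left | rewrite subr_eq0 => /eqP; right].
(* The two roots are distinct, so one is [0] and the other [t2]. *)
have [De t2E] : D = e ^+ 2 /\ t2 = 2 * e.
  case: r1 r2 => [r1|r1] [r2|r2].
  - by exfalso; move/negP: d0; apply; apply/eqP; lra.
  - by have -> : e = - d; [lra | split; [rewrite -dd; ring | lra]].
  - by have -> : e = d; [lra | split; [rewrite -dd; ring | lra]].
  - by exfalso; move/negP: d0; apply; apply/eqP; lra.
have e0 : e != 0 by apply: contraNneq Dn0 => e0; rewrite De e0 expr0n.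
(* The values of [h] at [e], [- 2 e], [4 e] are [e^4] times three affine forms in [a] and [b]
   without common zero. *)
pose a := k * s ^+ 2; pose b := s * t1 * e.
have e4 : e ^+ 4 != 0 by rewrite expf_neq0.
have E1 : 1 + a - b = 0.
  by apply: (mulfI e4); rewrite mulr0 -(h0 e) /h De t2E /a /b; ring.
have E2 : - 32 + 64 * a + 128 * b = 0.
  by apply: (mulfI e4); rewrite mulr0 -(h0 (- 2 * e)) /h De t2E /a /b; ring.
have E3 : - 128 + 64 * a - 256 * b = 0.
  by apply: (mulfI e4); rewrite mulr0 -(h0 (4 * e)) /h De t2E /a /b; ring.
by lra.
Qed.
End Curve.

(** * Rigidity of transverse Killing fields *)

(* [X], [Y], [Z] commute and [X] is the derivative along the curves on which [p]
   is constant. The functions killed by [X] are then coefficients in the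
   dependence on [x] of [S], [Y S] and [Z S]. *)
Section Transverse.
Context {R : realType} {n : nat}.
Variables (U : set 'rV[R]_n) (oU : open U).
Variables (X Y Z : ('rV[R]_n -> R) -> 'rV[R]_n -> R).
Hypotheses (dX : derivation U X) (dY : derivation U Y) (dZ : derivation U Z).
Hypothesis XY : forall F q, sm U F -> U q -> X (Y F) q = Y (X F) q.
Hypothesis XZ : forall F q, sm U F -> U q -> X (Z F) q = Z (X F) q.
Hypothesis YZ : forall F q, sm U F -> U q -> Y (Z F) q = Z (Y F) q.
Variables (x p A r kap f : 'rV[R]_n -> R).
Hypotheses (Xx : isD U X x (fun=> 1)) (Yx : isD U Y x (fun=> 0)) (Zx : isD U Z x (fun=> 0)).
Hypotheses (Xp : isD U X p (fun=> 0)) (Yp : isD U Y p (fun=> 1)) (Zp : isD U Z p (fun=> 0)).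
Hypothesis XA : isD U X A (fun q => 2 * (p q + - x q)).
Hypothesis YA : isD U Y A (fun q => 2 * (x q + - kap q)).
Hypothesis ZA : isD U Z A (fun q => - (2 * f q)).
Hypotheses (sk : sm U kap) (sf : sm U f) (sr : sm U r).
Hypothesis A_neq0 : forall q, U q -> A q != 0.
Hypothesis kx_neq0 : forall q, U q -> kap q - x q != 0.
Hypothesis Xr : forall q, U q -> X r q = (r q + f q / A q ^+ 2) / (kap q - x q).
Hypothesis rel : forall q, U q ->
  (kap q - x q) * (Z r q - 1) = (f q + r q * A q ^+ 2) * Y r q.

Let comm (D D' : ('rV[R]_n -> R) -> 'rV[R]_n -> R) F G G' :
  (forall F q, sm U F -> U q -> D (D' F) q = D' (D F) q) ->
  derivation U D -> derivation U D' ->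
  isD U D' F G -> isD U D F G' -> forall q, U q -> D G q = D' G' q.
Proof.
move=> C dD dD' [sF FG] [_ FG'] q Uq.
rewrite -(der_eqon dD FG Uq) C//; exact: (der_eqon dD' FG').
Qed.

(** With [X], [Y], [Z] read as d/dx, d/dp, d/dy, the hypotheses say [A = D - (x - p)^2] for some [D]
    independent of [x], with [kap = p - D_p / 2] and [f = - D_y / 2]. The proof compares [X (Y A)]
    with [Y (X A)]; [X_f] and [Z_kap] use the other two pairs. *)
Lemma X_kap : isD U X kap (fun=> 0).
Proof.
split=> // q Uq; have := comm XY dX dY YA XA Uq.
have sk' := isD_self X sk.
eassert (H1 : isD U X (fun q => 2 * (x q + - kap q)) _) by (der oU dX).
eassert (H2 : isD U Y (fun q => 2 * (p q + - x q)) _) by (der oU dY).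
rewrite (H1.2 _ Uq) (H2.2 _ Uq) => E.
by lra.
Qed.

Lemma X_f : isD U X f (fun=> 0).
Proof.
split=> // q Uq; have := comm XZ dX dZ ZA XA Uq.
have sf' := isD_self X sf.
eassert (H1 : isD U X (fun q => - (2 * f q)) _) by (der oU dX).
eassert (H2 : isD U Z (fun q => 2 * (p q + - x q)) _) by (der oU dZ).
rewrite (H1.2 _ Uq) (H2.2 _ Uq) => E.
by lra.
Qed.

Lemma Z_kap : isD U Z kap (Y f).
Proof.
split=> // q Uq; have := comm YZ dY dZ ZA YA Uq.
have sf' := isD_self Y sf; have sk' := isD_self Z sk.
eassert (H1 : isD U Y (fun q => - (2 * f q)) _) by (der oU dY).
eassert (H2 : isD U Z (fun q => 2 * (x q + - kap q)) _) by (der oU dZ).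
rewrite (H1.2 _ Uq) (H2.2 _ Uq) => E.
by lra.
Qed.

Let X_const D F : (forall F q, sm U F -> U q -> X (D F) q = D (X F) q) ->
  derivation U D -> isD U X F (fun=> 0) -> isD U X (D F) (fun=> 0).
Proof.
move=> C dD [sF F0]; split; first exact: (der_sm dD).
by move=> q Uq; rewrite C// (der_eqon dD F0 Uq) (der_cst dD).
Qed.

Lemma X_Ykap : isD U X (Y kap) (fun=> 0). Proof. exact: X_const X_kap. Qed.
Lemma X_Yf : isD U X (Y f) (fun=> 0). Proof. exact: X_const X_f. Qed.
Lemma X_Zf : isD U X (Z f) (fun=> 0). Proof. exact: X_const X_f. Qed.

Let S q := r q * (kap q + - x q).

(** [kap - x] is an integrating factor for the linear equation [Xr], because [X (kap - x) = - 1]. *)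
Lemma X_S : isD U X S (fun q => f q * ((A q)^-1 * (A q)^-1)).
Proof.
have Hk := X_kap; have Hr := isD_self X sr.
eassert (H : isD U X S _) by (rewrite /S; der oU dX).
apply: isD_eq H _ => q Uq; rewrite (Xr Uq).
by field; rewrite A_neq0// kx_neq0.
Qed.

Let S_AA D : derivation U D -> (forall F q, sm U F -> U q -> X (D F) q = D (X F) q) ->
  forall G, isD U D A G -> forall q, U q ->
  X (D S) q = D f q / A q ^+ 2 - 2 * f q * G q / A q ^+ 3.
Proof.
move=> dD C G HA q Uq; have [sS HS] := X_S.
rewrite C// (der_eqon dD HS Uq); have Hf := isD_self D sf.
eassert (H : isD U D (fun q => f q * ((A q)^-1 * (A q)^-1)) _) by (der oU dD).
by rewrite (H.2 _ Uq); field; rewrite A_neq0.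
Qed.

Lemma X_YS q : U q -> X (Y S) q =
  Y f q / A q ^+ 2 + 4 * f q * (kap q - x q) / A q ^+ 3.
Proof. by move=> Uq; rewrite (S_AA dY XY YA Uq); field; rewrite A_neq0. Qed.

Lemma X_ZS q : U q -> X (Z S) q = Z f q / A q ^+ 2 + 4 * f q ^+ 2 / A q ^+ 3.
Proof. by move=> Uq; rewrite (S_AA dZ XZ ZA Uq); field; rewrite A_neq0. Qed.

(** This is [rel] multiplied by [(kap - x)^3], with [r = S / (kap - x)] and with [Z kap] replaced by
    [Y f]. *)
Lemma rel_S q : U q ->
  (kap q - x q) ^+ 2 * ((kap q - x q) * Z S q - Y f q * S q - (kap q - x q) ^+ 2) =
  (f q * (kap q - x q) + S q * A q ^+ 2) * ((kap q - x q) * Y S q - Y kap q * S q).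
Proof.
move=> Uq; have HrY := isD_self Y sr; have HrZ := isD_self Z sr.
have HkY := isD_self Y sk; have HkZ := Z_kap.
eassert (HS : isD U Y S _) by (rewrite /S; der oU dY); rewrite (HS.2 _ Uq) {HS}.
eassert (HS : isD U Z S _) by (rewrite /S; der oU dZ); rewrite (HS.2 _ Uq) {HS}.
have E := rel Uq; have k0 := kx_neq0 Uq.
have {}E : Z r q = 1 + (f q + r q * A q ^+ 2) * Y r q / (kap q - x q).
  apply: (mulfI k0); rewrite mulrDr mulr1 [_ * (_ / _)]mulrC divfK// -E.
  by ring.
by rewrite E /S; field.
Qed.

End Transverse.

(** * Uniqueness for a linear differential equation *)

Section Gronwall.
Context {R : realType}.

(* Gronwall: [u ^+ 2 * expR (k * t)] is monotone for [k = - 2 * C] and [k = 2 * C]. *)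
Lemma linear_ode_zero (u g : R -> R) (C lo hi t0 : R) : lo < t0 < hi ->
  (forall t, lo < t < hi -> is_derive t 1 u (g t * u t)) ->
  (forall t, lo < t < hi -> `|g t| <= C) -> u t0 = 0 ->
  forall t, lo < t < hi -> u t = 0.
Proof.
move=> /andP[lt0 t0h] du gC u0 t /andP[lt th].
have dh (k s : R) : lo < s < hi -> is_derive s (1 : R) (fun x => (u x * u x) * expR (k * x))
    ((2 * g s + k) * (u s ^+ 2 * expR (k * s))).
  move=> sI.
  have dk : is_derive s (1 : R) (fun x : R => k * x) k.
    have := is_derive_poly (k *: 'X) s.
    rewrite (_ : horner _ = fun x : R => k * x); last by apply/funext => x; rewrite !hornerE.
    by move=> H; apply: is_derive_eq H _; rewrite derivZ derivX !hornerE.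
  have de : is_derive s (1 : R) (fun x => expR (k * x)) (expR (k * s) * k).
    exact: (is_derive1_comp (is_derive_expR (k * s)) dk).
  have H := is_deriveM (is_deriveM (du s sI) (du s sI)) de.
  apply: is_derive_eq H _; rewrite -![_ *: _]/(_ * _) /=.
  by rewrite -[(u * u) s]/(u s * u s); ring.
have key (k a b : R) : a <= b -> lo < a -> b < hi -> exists2 c, lo < c < hi &
    u b ^+ 2 * expR (k * b) - u a ^+ 2 * expR (k * a) =
    (2 * g c + k) * (u c ^+ 2 * expR (k * c)) * (b - a).
  move=> ab la bh.
  have inI s : a <= s <= b -> lo < s < hi.
    by move=> /andP[as_ sb]; rewrite (lt_le_trans la)// (le_lt_trans sb).
  have [||c] := @MVT_segment R (fun x => (u x * u x) * expR (k * x))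
    (fun s => (2 * g s + k) * (u s ^+ 2 * expR (k * s))) a b ab.
  - by move=> s; rewrite in_itv /= => /andP[as_ sb]; apply/dh/inI; rewrite !ltW.
  - apply: derivable_within_continuous => s; rewrite in_itv /= => /inI sI.
    by have /@ex_derive := dh k s sI.
  - by rewrite in_itv /= => /inI cI E; exists c => //; by move: E; rewrite -!expr2 /=.
have fin (v w : R) : 0 < w -> v ^+ 2 * w <= 0 -> v = 0.
  move=> w0; rewrite pmulr_lle0// => v0; apply/eqP; rewrite -sqrf_eq0.
  by rewrite eq_le v0 sqr_ge0.
have [tt|/ltW tt] := leP t0 t.
  have [c /gC cC E] := key (- (2 * C)) t0 t tt lt0 th.
  apply: (fin _ (expR (- (2 * C) * t))); first exact: expR_gt0.
  have : (2 * g c - 2 * C) * (u c ^+ 2 * expR (- (2 * C) * c)) * (t - t0) <= 0.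
    rewrite mulr_le0_ge0 ?subr_ge0// mulr_le0_ge0//.
      by move: cC; rewrite ler_norml => /andP[_]; lra.
    exact: mulr_ge0 (sqr_ge0 _) (expR_ge0 _).
  by rewrite -E u0 expr0n mul0r subr0.
have [c /gC cC E] := key (2 * C) t t0 tt lt t0h.
apply: (fin _ (expR (2 * C * t))); first exact: expR_gt0.
have : 0 <= (2 * g c + 2 * C) * (u c ^+ 2 * expR (2 * C * c)) * (t0 - t).
  rewrite mulr_ge0 ?subr_ge0// mulr_ge0//.
    by move: cC; rewrite ler_norml => /andP[]; lra.
  exact: mulr_ge0 (sqr_ge0 _) (expR_ge0 _).
by rewrite -E u0 expr0n mul0r sub0r oppr_ge0.
Qed.

End Gronwall.

Lemma sm_open_neq0 {R : realType} {n : nat} (U : set 'rV[R]_n) (F : 'rV[R]_n -> R) :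
  open U -> sm U F -> open (U `&` [set q | F q != 0]).
Proof.
move=> oU sF; rewrite openE => q [Uq Fq].
have cF := sm_cont sF Uq.
have HU : nbhs q U by exact: open_nbhs_nbhs.
apply: filterI => //; apply: (cF [set y | y != 0]).
by apply: open_nbhs_nbhs; split => //; exact: open_neq.
Qed.

Lemma sm_sub {R : realType} {n : nat} (U V : set 'rV[R]_n) (F : 'rV[R]_n -> R) :
  V `<=` U -> sm U F -> sm V F.
Proof.
move=> VU sF k; have := sF k; elim: k F {sF} => [|k IH] F [cF dF].
  by split=> // p /VU; exact: cF.
split=> [p /VU|i]; first exact: cF.
by have [d1 d2] := dF i; split=> [p /VU|]; [exact: d1 | exact: IH].
Qed.

Lemma sm_curve {R : realType} {n : nat} (U : set 'rV[R]_n) (F : 'rV[R]_n -> R)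
    (g : R -> 'rV[R]_n) (dg : 'I_n -> R) (t : R) : open U -> sm U F -> U (g t) ->
  (forall k, is_derive t 1 (fun x => g x 0 k) (dg k)) ->
  is_derive t 1 (F \o g) (\sum_k pd k F (g t) * dg k).
Proof.
move=> oU sF Ug Hg.
have dgt : derivable g t 1 by apply/derivable_mxP => a k; rewrite ord1; exact: ex_derive.
apply: is_derive_eq (is_derive_comp_rV oU (sF 1%N) Ug dgt) _.
by apply: eq_bigr => k _; rewrite pdE derive_val.
Qed.

Definition iz : 'I_3 := @Ordinal 3 2 isT.

Lemma sum_I3 {R : realType} (i j : 'I_3) (c : 'I_3 -> R) :
  i != j -> i != iz -> j != iz -> \sum_k c k = c i + c j + c iz.
Proof.
move=> ij i2 j2; rewrite (bigD1 i)//= (bigD1 j) 1?eq_sym//=.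
rewrite (bigD1 iz) 1?eq_sym ?i2 1?eq_sym ?j2//= 1?eq_sym ?i2 1?eq_sym ?j2//.
rewrite big1 ?addr0 ?addrA// => k /andP[/andP[ki kj] k2]; exfalso.
move: ij i2 j2 ki kj k2; rewrite -!(inj_eq val_inj) /=.
by have := ltn_ord k; have := ltn_ord i; have := ltn_ord j; lia.
Qed.

(** * The contradiction where [p_z] has no zero *)

Section NoTwist.
Context {R : realType}.
Variables (U : set 'rV[R]_3) (oU : open U) (i j : 'I_3) (s : R).
Hypotheses (ij : i != j) (i2 : i != iz) (j2 : j != iz) (s2 : s * s = 1).
Variables (p r : 'rV[R]_3 -> R) (sp : sm U p) (sr : sm U r).
Let x (q : 'rV[R]_3) := q 0 i.
Let y (q : 'rV[R]_3) := q 0 j.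
Variable A : 'rV[R]_3 -> R.
Hypothesis AE : forall q, A q = expR (- (2 * s) * q 0 iz).
Let p2 := pd iz p.
Let pj := pd j p.
Hypothesis e1 : forall q, U q -> pd i p q = (p q - x q) / A q * (s * p2 q).
Hypothesis e2 : forall q, U q -> pd j r q = (r q + y q) * A q * (s * pd iz r q).
Hypothesis e3 : forall q, U q ->
  pj q / A q + A q * pd i r q = (r q + y q) * (s * p2 q) + (p q - x q) * (s * pd iz r q).
Hypothesis p2_neq0 : forall q, U q -> p2 q != 0.

Let sP : s = 1 \/ s = -1.
Proof.
have /eqP : (s - 1) * (s + 1) = 0 by rewrite mulrDr mulrBl s2; ring.
by rewrite mulf_eq0 subr_eq0 addr_eq0 => /orP[] /eqP ->; [left | right].
Qed.
Let A0 q : A q != 0. Proof. by rewrite AE gt_eqF// expR_gt0. Qed.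
Let A0' q : U q -> A q != 0. Proof. by []. Qed.
Let sp2 : sm U p2. Proof. exact: sm_pd. Qed.
Let spj : sm U pj. Proof. exact: sm_pd. Qed.
Let sx : sm U x. Proof. exact: sm_coord. Qed.
Let sy : sm U y. Proof. exact: sm_coord. Qed.
Let sz : sm U (fun q => - (2 * s) * q 0 iz).
Proof. by apply: sm_mul => //; [exact: sm_cst | exact: sm_coord]. Qed.
Let sA : sm U A. Proof. by apply: (sm_eqon oU _ (sm_exp oU sz)) => q _; rewrite AE. Qed.

Let dpd k := pd_derivation k oU.

Let pdx k : isD U (pd k) x (fun=> (k == i)%:R).
Proof. by split=> // q _; exact: pd_coord. Qed.
Let pdy k : isD U (pd k) y (fun=> (k == j)%:R).
Proof. by split=> // q _; exact: pd_coord. Qed.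
Let pdA k : isD U (pd k) A (fun q => - (2 * s) * (k == iz)%:R * A q).
Proof.
split=> // q Uq; rewrite AE (pd_eqon oU k (fun q _ => AE q) Uq) (pd_exp k sz Uq).
rewrite (pd_mul k (sm_cst U _) (sm_coord U iz) Uq).
by rewrite pd_cst pd_coord; ring.
Qed.
Let pdp k : isD U (pd k) p (pd k p). Proof. by []. Qed.
Let pdp2 k : isD U (pd k) p2 (pd k p2). Proof. by []. Qed.

Let pd_e1 k q : U q -> pd k (pd i p) q =
  s * ((pd k p q - (k == i)%:R) / A q * p2 q + 2 * s * (k == iz)%:R * (p q - x q) / A q * p2 q
       + (p q - x q) / A q * pd k p2 q).
Proof.
move=> Uq; rewrite (pd_eqon oU k (g := fun q => ((p q + - x q) * (A q)^-1) * (s * p2 q)) e1 Uq).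
have Hx := pdx k; have HA := pdA k; have Hp := pdp k; have Hp2 := pdp2 k; have dk := dpd k.
eassert (H : isD U (pd k) (fun q => ((p q + - x q) * (A q)^-1) * (s * p2 q)) _).
  by der oU dk; exact: A0'.
by rewrite (H.2 _ Uq); field.
Qed.

Let p2i q : U q -> pd i p2 q = s * (p2 q ^+ 2 / A q) + 2 * (p q - x q) / A q * p2 q
  + s * (p q - x q) / A q * pd iz p2 q.
Proof.
move=> Uq; rewrite (pd_swap oU i iz sp Uq) (pd_e1 iz Uq) eqxx [iz == i]eq_sym (negbTE i2).
by rewrite -/p2 /=; case: sP => ->; field.
Qed.

Let pji q : U q -> pd i pj q = s * (pj q * p2 q / A q) + s * (p q - x q) / A q * pd j p2 q.
Proof.
move=> Uq; rewrite (pd_swap oU i j sp Uq) (pd_e1 j Uq) eq_sym (negbTE ij) (negbTE j2).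
by rewrite -/pj /=; field.
Qed.

Let pj2 q : U q -> pd iz pj q = pd j p2 q.
Proof. by move=> Uq; rewrite (pd_swap oU iz j sp Uq). Qed.

(** [X], [Y], [Z] are the coordinate fields of [(x, p, y)]: since [p2] has no zero, [p] replaces
    [z]. *)
Let cX (k : 'I_3) : 'rV[R]_3 -> R :=
  if k == i then fun=> 1
  else if k == iz then fun q => - (s * ((p q + - x q) * (A q)^-1)) else fun=> 0.
Let cY (k : 'I_3) : 'rV[R]_3 -> R :=
  if k == iz then fun q => (p2 q)^-1 else fun=> 0.
Let cZ (k : 'I_3) : 'rV[R]_3 -> R :=
  if k == j then fun=> 1
  else if k == iz then fun q => - (pj q * (p2 q)^-1) else fun=> 0.

Let X := vd cX.
Let Y := vd cY.
Let Z := vd cZ.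

Let XE F q : X F q = pd i F q - s * ((p q - x q) / A q) * pd iz F q.
Proof.
rewrite /X vdE (sum_I3 _ ij i2 j2) /cX eqxx [j == i]eq_sym (negbTE ij) (negbTE j2).
by rewrite [iz == i]eq_sym (negbTE i2) eqxx; ring.
Qed.
Let YE F q : Y F q = (p2 q)^-1 * pd iz F q.
Proof.
rewrite /Y vdE (sum_I3 _ ij i2 j2) /cY eqxx (negbTE i2) (negbTE j2).
by ring.
Qed.
Let ZE F q : Z F q = pd j F q - pj q / p2 q * pd iz F q.
Proof.
rewrite /Z vdE (sum_I3 _ ij i2 j2) /cZ eqxx (negbTE ij).
by rewrite [iz == j]eq_sym (negbTE i2) (negbTE j2) eqxx; ring.
Qed.

Let scX k : sm U (cX k).
Proof.
rewrite /cX; case: ifP => _; first exact: sm_cst.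
case: ifP => _; last exact: sm_cst.
apply: sm_opp => //; apply: sm_mul => //; first exact: sm_cst.
apply: sm_mul => //; last exact: sm_inv.
by apply: sm_add => //; exact: sm_opp.
Qed.
Let scY k : sm U (cY k).
Proof. by rewrite /cY; case: ifP => _; [exact: sm_inv | exact: sm_cst]. Qed.
Let scZ k : sm U (cZ k).
Proof.
rewrite /cZ; case: ifP => _; first exact: sm_cst.
case: ifP => _; last exact: sm_cst.
by apply: sm_opp => //; apply: sm_mul => //; exact: sm_inv.
Qed.

Let dX : derivation U X. Proof. exact: vd_derivation. Qed.
Let dY : derivation U Y. Proof. exact: vd_derivation. Qed.
Let dZ : derivation U Z. Proof. exact: vd_derivation. Qed.

Let X_p2 q : U q -> X p2 q = s * p2 q ^+ 2 / A q + 2 * (p q - x q) / A q * p2 q.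
Proof. by move=> Uq; rewrite XE p2i//; field. Qed.
Let X_pj q : U q -> X pj q = s * pj q * p2 q / A q.
Proof. by move=> Uq; rewrite XE pji// pj2//; field. Qed.

Let commute a b : (forall k, sm U (a k)) -> (forall k, sm U (b k)) ->
  (forall k q, U q -> vd a (b k) q = vd b (a k) q) ->
  forall F q, sm U F -> U q -> vd a (vd b F) q = vd b (vd a F) q.
Proof.
move=> sa sb ab F q sF Uq; apply/eqP; rewrite -subr_eq0 (vd_bracket oU sa sb sF Uq).
by rewrite big1// => k _; rewrite ab// subrr mul0r.
Qed.

Let XY F q : sm U F -> U q -> X (Y F) q = Y (X F) q.
Proof.
apply: commute => // k {}q Uq; rewrite -/X -/Y.
rewrite /cX /cY; have [->|ki] := eqVneq k i.
  by rewrite (negbTE i2) (der_cst dX _ Uq) (der_cst dY _ Uq).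
have [_|_] := eqVneq k iz; last by rewrite (der_cst dX _ Uq) (der_cst dY _ Uq).
have Hp2 := isD_self X sp2.
eassert (H1 : isD U X (fun q => (p2 q)^-1) _) by (der oU dX; exact: p2_neq0).
have Hx := pdx iz; have HA := pdA iz; have Hp := pdp iz; have dk := dpd iz.
eassert (H2 : isD U (pd iz) (fun q => - (s * ((p q + - x q) * (A q)^-1))) _).
  by der oU dk; exact: A0'.
rewrite (H1.2 _ Uq) X_p2// YE (H2.2 _ Uq) -/p2 [iz == i]eq_sym (negbTE i2) eqxx /=.
by case: sP => ->; field; rewrite A0 p2_neq0.
Qed.

Let XZ F q : sm U F -> U q -> X (Z F) q = Z (X F) q.
Proof.
apply: commute => // k {}q Uq; rewrite -/X -/Z.
rewrite /cX /cZ; have [->|ki] := eqVneq k i.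
  by rewrite (negbTE ij) (negbTE i2) (der_cst dX _ Uq) (der_cst dZ _ Uq).
have [->|kj] := eqVneq k j.
  by rewrite (negbTE j2) (der_cst dX _ Uq) (der_cst dZ _ Uq).
have [_|_] := eqVneq k iz; last by rewrite (der_cst dX _ Uq) (der_cst dZ _ Uq).
have Hp2 := isD_self X sp2; have Hpj := isD_self X spj.
eassert (H1 : isD U X (fun q => - (pj q * (p2 q)^-1)) _) by (der oU dX; exact: p2_neq0).
have H2 k' : isD U (pd k') (fun q => - (s * ((p q + - x q) * (A q)^-1)))
    (fun q => - (s * ((pd k' p q - (k' == i)%:R) / A q + 2 * s * (k' == iz)%:R * (p q - x q) / A q))).
  have Hx := pdx k'; have HA := pdA k'; have Hp := pdp k'; have dk := dpd k'.
  eassert (H : isD U (pd k') (fun q => - (s * ((p q + - x q) * (A q)^-1))) _).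
    by der oU dk; exact: A0'.
  by apply: isD_eq H _ => q' _; field.
rewrite (H1.2 _ Uq) X_p2// X_pj// ZE !(H2 _).2// -/p2 -/pj.
rewrite [iz == i]eq_sym (negbTE i2) eqxx [j == i]eq_sym (negbTE ij) (negbTE j2) /=.
by case: sP => ->; field; rewrite A0 p2_neq0.
Qed.

Let YZ F q : sm U F -> U q -> Y (Z F) q = Z (Y F) q.
Proof.
apply: commute => // k {}q Uq; rewrite -/Y -/Z.
rewrite /cY /cZ; have [->|kj] := eqVneq k j.
  by rewrite (negbTE j2) (der_cst dY _ Uq) (der_cst dZ _ Uq).
have [_|_] := eqVneq k iz; last by rewrite (der_cst dY _ Uq) (der_cst dZ _ Uq).
have Hp2 := isD_self Y sp2; have Hpj := isD_self Y spj.
eassert (H1 : isD U Y (fun q => - (pj q * (p2 q)^-1)) _) by (der oU dY; exact: p2_neq0).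
have Hp2' := isD_self Z sp2.
eassert (H2 : isD U Z (fun q => (p2 q)^-1) _) by (der oU dZ; exact: p2_neq0).
rewrite (H1.2 _ Uq) (H2.2 _ Uq) !YE !ZE pj2//.
by field; rewrite p2_neq0.
Qed.

(** [kap] and [f] are forced by [Y A = 2 (x - kap)] and [Z A = - 2 f]. *)
Let kap q := x q + s * A q / p2 q.
Let f q := - (s * A q * pj q / p2 q).
Let S q := (r q + y q) * (kap q + - x q).

Let skap : sm U kap.
Proof.
apply: sm_add => //; apply: sm_mul => //; last exact: sm_inv.
by apply: sm_mul => //; exact: sm_cst.
Qed.
Let sf : sm U f.
Proof.
apply: sm_opp => //; apply: sm_mul => //; last exact: sm_inv.
by do 2 apply: sm_mul => //; exact: sm_cst.
Qed.
Let sR : sm U (fun q => r q + y q). Proof. exact: sm_add. Qed.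

Let Xval F G : sm U F -> (forall q, U q -> pd i F q - s * ((p q - x q) / A q) * pd iz F q = G q) ->
  isD U X F G.
Proof. by move=> sF FG; split=> // q Uq; rewrite XE FG. Qed.
Let Yval F G : sm U F -> (forall q, U q -> (p2 q)^-1 * pd iz F q = G q) -> isD U Y F G.
Proof. by move=> sF FG; split=> // q Uq; rewrite YE FG. Qed.
Let Zval F G : sm U F -> (forall q, U q -> pd j F q - pj q / p2 q * pd iz F q = G q) ->
  isD U Z F G.
Proof. by move=> sF FG; split=> // q Uq; rewrite ZE FG. Qed.

Let iji : j == i = false. Proof. by rewrite eq_sym; exact: negbTE. Qed.
Let zi : iz == i = false. Proof. by rewrite eq_sym; exact: negbTE. Qed.
Let zj : iz == j = false. Proof. by rewrite eq_sym; exact: negbTE. Qed.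

Let Xx : isD U X x (fun=> 1).
Proof. by apply: Xval => // q Uq; rewrite !(pdx _).2// eqxx zi mulr0 subr0. Qed.
Let Yx : isD U Y x (fun=> 0).
Proof. by apply: Yval => // q Uq; rewrite !(pdx _).2// zi mulr0. Qed.
Let Zx : isD U Z x (fun=> 0).
Proof. by apply: Zval => // q Uq; rewrite !(pdx _).2// zi iji mulr0 subr0. Qed.
Let Xp : isD U X p (fun=> 0).
Proof. by apply: Xval => // q Uq; rewrite e1// -/p2; ring. Qed.
Let Yp : isD U Y p (fun=> 1).
Proof. by apply: Yval => // q Uq; rewrite -/p2 mulVf// p2_neq0. Qed.
Let Zp : isD U Z p (fun=> 0).
Proof. by apply: Zval => // q Uq; rewrite -/p2 -/pj; field; exact: p2_neq0. Qed.
Let XA : isD U X A (fun q => 2 * (p q + - x q)).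
Proof.
apply: Xval => // q Uq; rewrite !(pdA _).2// (negbTE i2) eqxx /=.
by case: sP => ->; field.
Qed.
Let YA : isD U Y A (fun q => 2 * (x q + - kap q)).
Proof.
apply: Yval => // q Uq; rewrite !(pdA _).2// eqxx /kap /=.
by field; exact: p2_neq0.
Qed.
Let ZA : isD U Z A (fun q => - (2 * f q)).
Proof.
apply: Zval => // q Uq; rewrite !(pdA _).2// (negbTE j2) eqxx /f /=.
by field; exact: p2_neq0.
Qed.

Let kx_neq0 q : U q -> kap q - x q != 0.
Proof.
move=> Uq; rewrite /kap addrC addKr !mulf_neq0 ?invr_eq0 ?p2_neq0//.
by case: sP => ->; rewrite ?oppr_eq0 oner_eq0.
Qed.

Let Xr q : U q -> X (fun q => r q + y q) q =
  ((r q + y q) + f q / A q ^+ 2) / (kap q - x q).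
Proof.
move=> Uq; rewrite XE !(pd_add _ sr sy Uq) !(pdy _).2// (negbTE ij) zj /=.
have E := e3 Uq.
have {}E : pd i r q = ((r q + y q) * (s * p2 q) + (p q - x q) * (s * pd iz r q) - pj q / A q) / A q.
  by apply: (mulfI (A0 q)); rewrite [RHS]mulrC divfK// -E; ring.
have kx : kap q - x q = s * A q / p2 q by rewrite /kap; ring.
rewrite E /f kx; have p2q := p2_neq0 Uq; have Aq := A0 q.
by case: sP => ->; field; rewrite Aq p2q.
Qed.

Let relr q : U q -> (kap q - x q) * (Z (fun q => r q + y q) q - 1) =
  (f q + (r q + y q) * A q ^+ 2) * Y (fun q => r q + y q) q.
Proof.
move=> Uq; rewrite ZE YE !(pd_add _ sr sy Uq) !(pdy _).2// eqxx zj e2// /f /kap /=.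
by case: sP => ->; field; exact: p2_neq0.
Qed.

(** The relation [rel_S] is restricted to the curve of [X] through [q0], on which [p], [kap], [f]
    and their derivatives along [Y] and [Z] are constant. The alternative on [f] is there because
    the case [f q0 = 0] also needs [Y f] and [Z f] to vanish at [q0]. *)
Lemma not_twisted q0 : U q0 -> (f q0 != 0 \/ forall q, U q -> f q = 0) -> False.
Proof.
move=> Uq0 Hf.
have Xkap : isD U X kap (fun=> 0) by exact: (X_kap oU dX dY XY Xx Yx Yp XA YA skap).
have Xf : isD U X f (fun=> 0) by exact: (X_f oU dX dZ XZ Zx Zp XA ZA sf).
have XYkap : isD U X (Y kap) (fun=> 0) by exact: (X_Ykap oU dX dY XY Xx Yx Yp XA YA skap).
have XYf : isD U X (Y f) (fun=> 0) by exact: (X_Yf oU dX dY dZ XY XZ Zx Zp XA ZA sf).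
have XZf : isD U X (Z f) (fun=> 0) by exact: (X_Zf oU dX dZ XZ Zx Zp XA ZA sf).
have XS : isD U X S (fun q => f q * ((A q)^-1 * (A q)^-1))
  by exact: (X_S oU dX dY XY Xx Yx Yp XA YA skap sR A0' kx_neq0 Xr).
have XYS q : U q -> X (Y S) q =
    Y f q / A q ^+ 2 + 4 * f q * (kap q - x q) / A q ^+ 3.
  exact: (X_YS oU dX dY XY Xx Yx Yp XA YA skap sf sR A0' kx_neq0 Xr).
have XZS q : U q -> X (Z S) q = Z f q / A q ^+ 2 + 4 * f q ^+ 2 / A q ^+ 3.
  exact: (X_ZS oU dX dY dZ XY XZ Xx Yx Yp XA YA ZA skap sf sR A0' kx_neq0 Xr).
have relS q : U q ->
    (kap q - x q) ^+ 2 * ((kap q - x q) * Z S q - Y f q * S q - (kap q - x q) ^+ 2) =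
    (f q * (kap q - x q) + S q * A q ^+ 2) * ((kap q - x q) * Y S q - Y kap q * S q).
  exact: (rel_S oU dY dZ YZ Yx Zx YA ZA skap sf sR kx_neq0 relr).
(* On the curve [A] has to be [D - (t - p0)^2], which determines [z]. The curve is thus written in
   closed form, and only afterwards is [p] shown to be constant on it. *)
pose t0 := q0 0 i; pose p0 := p q0; pose D := A q0 + (t0 - p0) ^+ 2.
pose a (t : R) := D - (t - p0) ^+ 2.
pose g (t : R) : 'rV[R]_3 :=
  \row_k (if k == i then t else if k == j then q0 0 j else - (s / 2) * ln (a t)).
have at0 : a t0 = A q0 by rewrite /a /D addrK.
have gi t : g t 0 i = t by rewrite mxE eqxx.
have gj t : g t 0 j = q0 0 j by rewrite mxE iji eqxx.
have gz t : g t 0 iz = - (s / 2) * ln (a t) by rewrite mxE zi zj.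
have I3 k : [\/ k = i, k = j | k = iz].
  have [->|ki] := eqVneq k i; first by constructor 1.
  have [->|kj] := eqVneq k j; first by constructor 2.
  have [->|kz] := eqVneq k iz; first by constructor 3.
  exfalso; move: ij i2 j2 ki kj kz; rewrite -!(inj_eq val_inj) /=.
  by have := ltn_ord k; have := ltn_ord i; have := ltn_ord j; lia.
have gt0 : g t0 = q0.
  apply/rowP => k; case: (I3 k) => ->; [exact: gi | exact: gj | rewrite gz at0 AE expRK].
  by case: sP => ->; field.
have Ag t : 0 < a t -> A (g t) = a t.
  move=> a0; rewrite AE gz; rewrite (_ : - (2 * s) * (- (s / 2) * ln (a t)) = ln (a t)).
    by rewrite lnK// posrE.
  by case: sP => ->; field.
have da (t : R) : is_derive t (1 : R) a (- (2 * (t - p0))).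
  have := is_derive_poly (D%:P - ('X - p0%:P) ^+ 2) t.
  rewrite (_ : horner _ = a); last by apply/funext => v; rewrite !hornerE.
  move=> H; apply: is_derive_eq H _.
  by rewrite derivB derivC deriv_exp derivB derivX derivC !hornerE /=; ring.
pose dg (t : R) k : R := if k == i then 1 else if k == j then 0 else s * (t - p0) / a t.
have Hg (t : R) : 0 < a t -> forall k, is_derive t (1 : R) (fun v => g v 0 k) (dg t k).
  move=> a0 k; case: (I3 k) => ->; rewrite /dg ?eqxx ?iji ?zi ?zj.
  - by rewrite (_ : (fun v => g v 0 i) = id); [exact: is_derive_id | apply/funext].
  - rewrite (_ : (fun v => g v 0 j) = cst (q0 0 j)); first exact: is_derive_cst.
    by apply/funext.
  rewrite (_ : (fun v => g v 0 iz) = (fun v => - (s / 2) *: ln (a v))); last exact/funext.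
  have dln := is_derive1_comp (is_derive1_ln a0) (da t).
  apply: is_derive_eq (is_deriveZ (- (s / 2)) dln) _; rewrite -![_ *: _]/(_ * _).
  by field; rewrite gt_eqF.
have apos : 0 < a t0 by rewrite at0 AE expR_gt0.
have cg : {for t0, continuous g}.
  apply: differentiable_continuous; apply/derivable1_diffP/derivable_mxP => b k.
  by rewrite ord1; have /@ex_derive := Hg t0 apos k.
have ca : {for t0, continuous a}.
  apply: differentiable_continuous; apply/derivable1_diffP.
  by have /@ex_derive := da t0.
pose G (t : R) : R := s * p2 (g t) / a t.
have cG : {for t0, continuous G}.
  apply: continuousM; last by apply: continuousV => //; rewrite gt_eqF.
  apply: continuousM; first exact: cst_continuous.
  by apply: continuous_comp => //; apply: (sm_cont sp2); rewrite gt0.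
have [e e0 He] : exists2 e : R, 0 < e & forall t, t0 - e < t < t0 + e ->
    [/\ U (g t), 0 < a t & `|G t| <= `|G t0| + 1].
  have N1 : \forall t \near t0, U (g t).
    by apply: cg; rewrite gt0; exact: open_nbhs_nbhs.
  have N2 : \forall t \near t0, 0 < a t.
    by apply: (ca [set v | 0 < v]); apply: open_nbhs_nbhs; split => //; exact: open_gt.
  have N3 : \forall t \near t0, `|G t| <= `|G t0| + 1.
    have /cvgrPdist_le /(_ 1 ltr01) := cG; apply: filterS => t Ht.
    rewrite -(subrK (G t0) (G t)) (le_trans (ler_normD _ _))// addrC lerD2l.
    by rewrite distrC.
  have /nbhs_ballP[e /= e0 He] : \forall t \near t0,
      U (g t) /\ (0 < a t /\ `|G t| <= `|G t0| + 1) by exact: (filterI N1 (filterI N2 N3)).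
  exists e => // t tI; have [|n1 [n2 n3]] := He t; last by split.
  by rewrite /ball /= ltr_distlC; move: tI => /andP[? ?]; apply/andP; split; lra.
pose lo := t0 - e; pose hi := t0 + e.
have lh : lo < hi by rewrite /lo /hi; lra.
have t0I : lo < t0 < hi by rewrite /lo /hi; apply/andP; split; lra.
have chain F t : sm U F -> lo < t < hi -> is_derive t (1 : R) (F \o g)
    (pd i F (g t) + s * (t - p0) / a t * pd iz F (g t)).
  move=> sF /He[Ug a0 _].
  apply: is_derive_eq (sm_curve oU sF Ug (Hg t a0)) _.
  by rewrite (sum_I3 _ ij i2 j2) /dg eqxx iji eqxx zi zj; ring.
(* By [e1], [p - p0] satisfies along the curve the linear equation [u' = G u], and [G] is bounded on
   the chosen interval. *)
have pg t : lo < t < hi -> p (g t) = p0.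
  move=> tI; apply/eqP; rewrite -subr_eq0; apply/eqP.
  apply: (@linear_ode_zero R (fun t => p (g t) - p0) G (`|G t0| + 1) lo hi t0 t0I) => //.
  - move=> v vI; have [Ug a0 _] := He v vI.
    have H := is_deriveB (chain p v sp vI) (is_derive_cst p0 v (1 : R)).
    apply: is_derive_eq H _; rewrite subr0 e1// Ag// -/p2 /x gi /G.
    by field; rewrite gt_eqF.
  - by move=> v /He[].
  - by rewrite gt0 subrr.
have dF F t : sm U F -> lo < t < hi -> is_derive t (1 : R) (F \o g) (X F (g t)).
  move=> sF tI; have [Ug a0 _] := He t tI.
  apply: is_derive_eq (chain F t sF tI) _.
  by rewrite XE pg// Ag// /x gi; field; rewrite gt_eqF.
have dcst F t : isD U X F (fun=> 0) -> lo < t < hi -> F (g t) = F q0.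
  move=> [sF F0] tI; rewrite -gt0; apply: (@derive0_itv_cst R lo hi (F \o g) _ _ _ tI t0I).
  by move=> v vI; apply: is_derive_eq (dF F v sF vI) _; rewrite F0//; have [] := He v vI.
have ap t : lo < t < hi -> 0 < D - (t - p0) ^+ 2 by move=> /He[].
have sYS : sm U (Y S) by apply: (der_sm dY); exact: XS.1.
have sZS : sm U (Z S) by apply: (der_sm dZ); exact: XS.1.
have dS1 t : lo < t < hi -> is_derive t (1 : R) (S \o g) (f q0 / (D - (t - p0) ^+ 2) ^+ 2).
  move=> tI; have [Ug a0 _] := He t tI; apply: is_derive_eq (dF S t XS.1 tI) _.
  by rewrite XS.2// dcst// Ag// /a expr2 invfM.
have dT1 t : lo < t < hi -> is_derive t (1 : R) (Y S \o g)
    (Y f q0 / (D - (t - p0) ^+ 2) ^+ 2 + 4 * f q0 * (kap q0 - t) / (D - (t - p0) ^+ 2) ^+ 3).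
  move=> tI; have [Ug a0 _] := He t tI; apply: is_derive_eq (dF _ t sYS tI) _.
  by rewrite XYS// (dcst (Y f))// (dcst f)// (dcst kap)// Ag// /x gi.
have dT2 t : lo < t < hi -> is_derive t (1 : R) (Z S \o g)
    (Z f q0 / (D - (t - p0) ^+ 2) ^+ 2 + 4 * f q0 ^+ 2 / (D - (t - p0) ^+ 2) ^+ 3).
  move=> tI; have [Ug a0 _] := He t tI; apply: is_derive_eq (dF _ t sZS tI) _.
  by rewrite XZS// (dcst (Z f))// (dcst f)// Ag.
have rel1 t : lo < t < hi ->
    (kap q0 - t) ^+ 2 * ((kap q0 - t) * (Z S \o g) t - Y f q0 * (S \o g) t - (kap q0 - t) ^+ 2) =
    (f q0 * (kap q0 - t) + (S \o g) t * (D - (t - p0) ^+ 2) ^+ 2) *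
    ((kap q0 - t) * (Y S \o g) t - Y kap q0 * (S \o g) t).
  move=> tI; have [Ug a0 _] := He t tI; have := relS _ Ug.
  by rewrite (dcst kap)// (dcst f)// (dcst (Y f))// (dcst (Y kap))// Ag// /x gi.
case: Hf => [f0|f0].
  exact: (curve_f_neq0 lh ap dS1 dT1 dT2 rel1 f0).
have D0 (D' : ('rV[R]_3 -> R) -> 'rV[R]_3 -> R) : derivation U D' -> D' f q0 = 0.
  by move=> dD'; rewrite (der_eqon dD' (g := fun=> 0) f0 Uq0) (der_cst dD').
exact: (curve_f_eq0 lh ap dS1 dT1 dT2 rel1 (f0 _ Uq0) (D0 _ dY) (D0 _ dZ)).
Qed.

End NoTwist.

(** The indices [i], [j] and the sign [s] are left free so that the lemma applies both to [p] and,
    through the isometry (x, y, z) -> (y, x, -z), to [- r]. The two cases of [not_twisted] combine: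
    a point with [f] nonzero is impossible, hence [f] vanishes throughout. *)
Lemma pz_eq0 {R : realType} (U : set 'rV[R]_3) (i j : 'I_3) (s : R)
    (p r : 'rV[R]_3 -> R) : open U ->
  i != j -> i != iz -> j != iz -> s * s = 1 -> sm U p -> sm U r ->
  (forall q, U q -> pd i p q =
     (p q - q 0 i) / expR (- (2 * s) * q 0 iz) * (s * pd iz p q)) ->
  (forall q, U q -> pd j r q =
     (r q + q 0 j) * expR (- (2 * s) * q 0 iz) * (s * pd iz r q)) ->
  (forall q, U q ->
     pd j p q / expR (- (2 * s) * q 0 iz) + expR (- (2 * s) * q 0 iz) * pd i r q =
     (r q + q 0 j) * (s * pd iz p q) + (p q - q 0 i) * (s * pd iz r q)) ->
  forall q, U q -> pd iz p q = 0.
Proof.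
move=> oU ij i2 j2 s2 sp sr e1 e2 e3 q0 Uq0; apply/eqP/negPn/negP => p2q0.
pose V := U `&` [set q | pd iz p q != 0].
have oV : open V by apply: sm_open_neq0 => //; exact: sm_pd.
have VU : V `<=` U by move=> q [].
have N := @not_twisted R V oV i j s ij i2 j2 s2 p r (sm_sub VU sp) (sm_sub VU sr)
  (fun q => expR (- (2 * s) * q 0 iz)) (fun=> erefl)
  (fun q Vq => e1 q (VU q Vq)) (fun q Vq => e2 q (VU q Vq))
  (fun q Vq => e3 q (VU q Vq)) (fun q Vq => Vq.2).
apply: (N q0); first by split.
right => q Vq; apply/eqP/negPn/negP => fq.
by apply: (N q Vq); left.
Qed.

(* The transverse Killing equations for the field [(P, Q, 1)], with [P = p - x] and
   [Q = r + y]. *)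
Lemma killing_rigidity {R : realType} (U : set 'rV[R]_3) (i j : 'I_3)
    (p r : 'rV[R]_3 -> R) : open U ->
  i != j -> i != iz -> j != iz -> sm U p -> sm U r ->
  (forall q, U q -> pd i p q = (p q - q 0 i) / expR (- 2 * q 0 iz) * pd iz p q) ->
  (forall q, U q -> pd j r q = (r q + q 0 j) * expR (- 2 * q 0 iz) * pd iz r q) ->
  (forall q, U q ->
     pd j p q / expR (- 2 * q 0 iz) + expR (- 2 * q 0 iz) * pd i r q =
     (r q + q 0 j) * pd iz p q + (p q - q 0 i) * pd iz r q) ->
  forall q k, U q -> pd k p q = 0 /\ pd k r q = 0.
Proof.
move=> oU ij i2 j2 sp sr e1 e2 e3.
pose A (q : 'rV[R]_3) := expR (- 2 * q 0 iz).
have A0 q : A q != 0 by rewrite gt_eqF// expR_gt0.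
have AV (q : 'rV[R]_3) : expR (- (2 * -1) * q 0 iz) = (A q)^-1.
  by rewrite /A -expRN; congr expR; ring.
have pz q : U q -> pd iz p q = 0.
  move: q; apply: (@pz_eq0 R U i j 1 p r) => //; first by rewrite mulr1.
  - by move=> q Uq; rewrite mulr1 mul1r e1.
  - by move=> q Uq; rewrite mulr1 mul1r e2.
  - by move=> q Uq; rewrite mulr1 !mul1r e3.
have sN F : sm U F -> sm U (fun q => - F q) by exact: sm_opp.
have pdN k F q : sm U F -> U q -> pd k (fun q => - F q) q = - pd k F q.
  move=> sF Uq; have HF : isD U (pd k) F (pd k F) by [].
  exact: (isD_opp oU (pd_derivation k oU) HF).2.
have ji : j != i by rewrite eq_sym.
have rz q : U q -> pd iz r q = 0.
  move=> Uq; apply: oppr_inj; rewrite oppr0 -pdN//; move: q Uq.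
  (* The mirrored instance: [x] and [y] exchanged, [z] replaced by [- z], and [(p, r)] by
     [(- r, - p)]. *)
  apply: (@pz_eq0 R U j i (-1) (fun q => - r q) (fun q => - p q)) => //; try exact: sN.
  - by rewrite mulrNN mulr1.
  - by move=> q Uq; rewrite AV !pdN// e2// -/(A q) invrK; ring.
  - by move=> q Uq; rewrite AV !pdN// e1// -/(A q); ring.
  - move=> q Uq; rewrite AV !pdN// invrK; have := e3 q Uq; rewrite -/(A q) => E.
    transitivity (- (pd j p q / A q + A q * pd i r q)); first by ring.
    by rewrite E; ring.
have pi q : U q -> pd i p q = 0 by move=> Uq; rewrite e1// pz// mulr0.
have rj q : U q -> pd j r q = 0 by move=> Uq; rewrite e2// rz// mulr0.
have e4 q : U q -> pd j p q = - (A q * A q * pd i r q).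
  move=> Uq; have := e3 q Uq; rewrite pz// rz// !mulr0 addr0 -/(A q) => E.
  have -> : pd j p q = A q * (pd j p q / A q) by field.
  have -> : pd j p q / A q = - (A q * pd i r q) by apply/eqP; rewrite -addr_eq0 E.
  by ring.
have zero k F q : (forall q, U q -> F q = 0) -> U q -> pd k F q = 0.
  by move=> F0 Uq; rewrite (pd_eqon oU k F0 Uq) pd_cst.
(* Neither [pd j p] nor [pd i r] depends on [z], whereas their ratio [- A^2] does. *)
have ri q : U q -> pd i r q = 0.
  move=> Uq; have sri := sm_pd i sr.
  have E : pd iz (fun q => - (A q * A q * pd i r q)) q = 0.
    by rewrite -(pd_eqon oU iz e4 Uq) (pd_swap oU iz j sp Uq) zero.
  have HA : isD U (pd iz) A (fun q => - 2 * A q).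
    split; first by apply: sm_exp => //; apply: sm_mul => //; [exact: sm_cst | exact: sm_coord].
    move=> q' Uq'; rewrite /A (pd_exp iz (sm_mul oU (sm_cst U (- 2)) (sm_coord U iz)) Uq').
    by rewrite (pd_mul iz (sm_cst U _) (sm_coord U iz) Uq') pd_cst pd_coord eqxx /=; ring.
  have Hri : isD U (pd iz) (pd i r) (fun=> 0).
    by split=> // q' Uq'; rewrite (pd_swap oU iz i sr Uq') zero.
  have dk := pd_derivation iz oU.
  eassert (H : isD U (pd iz) (fun q => - (A q * A q * pd i r q)) _) by der oU dk.
  move: E; rewrite (H.2 _ Uq) => E.
  have {}E : (4 * (A q * A q)) * pd i r q = 0 by rewrite -[RHS]E; ring.
  by move/eqP: E; rewrite !mulf_eq0 !(negbTE (A0 q)) pnatr_eq0 /= => /eqP.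
have pj q : U q -> pd j p q = 0 by move=> Uq; rewrite e4// ri// mulr0 oppr0.
move=> q k Uq; have [->|ki] := eqVneq k i; first by rewrite pi// ri.
have [->|kj] := eqVneq k j; first by rewrite pj// rj.
suff -> : k = iz by rewrite pz// rz.
apply/val_inj; move: ij i2 j2 ki kj; rewrite -!(inj_eq val_inj) /=.
by have := ltn_ord k; have := ltn_ord i; have := ltn_ord j; lia.
Qed.

(** * The vertical field of a submersion from Sol space *)

Definition ix : 'I_3 := @Ordinal 3 0 isT.
Definition iy : 'I_3 := @Ordinal 3 1 isT.

Lemma I3P (k : 'I_3) : [\/ k = ix, k = iy | k = iz].
Proof. by case: k => -[|[|[|//]]] kn; [constructor 1|constructor 2|constructor 3]; apply/val_inj. Qed.

Lemma i3E : (((ix == ix = true) * (ix == iy = false) * (ix == iz = false)) *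
  ((iy == ix = false) * (iy == iy = true) * (iy == iz = false)) *
  ((iz == ix = false) * (iz == iy = false) * (iz == iz = true)))%type.
Proof. by []. Qed.

(** A symmetric bilinear form that vanishes on a basis of the plane is zero. The combinations below
    isolate each coefficient times the square of the determinant. *)
Lemma quad_form_zero {R : fieldType} (u0 v0 u1 v1 a b c : R) :
  u0 * v1 - v0 * u1 != 0 ->
  a * (u0 * u0) + b * (u0 * v0 + v0 * u0) + c * (v0 * v0) = 0 ->
  a * (u0 * u1) + b * (u0 * v1 + v0 * u1) + c * (v0 * v1) = 0 ->
  a * (u1 * u1) + b * (u1 * v1 + v1 * u1) + c * (v1 * v1) = 0 ->
  [/\ a = 0, b = 0 & c = 0].
Proof.
move=> D0 E00 E01 E11; have DD := mulf_neq0 D0 D0.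
split; apply: (mulfI DD); rewrite mulr0.
- transitivity ((a * (u0 * u0) + b * (u0 * v0 + v0 * u0) + c * (v0 * v0)) * (v1 * v1)
    - 2 * (a * (u0 * u1) + b * (u0 * v1 + v0 * u1) + c * (v0 * v1)) * (v0 * v1)
    + (a * (u1 * u1) + b * (u1 * v1 + v1 * u1) + c * (v1 * v1)) * (v0 * v0)); first by ring.
  by rewrite E00 E01 E11; ring.
- transitivity (- (a * (u0 * u0) + b * (u0 * v0 + v0 * u0) + c * (v0 * v0)) * (u1 * v1)
    + (a * (u0 * u1) + b * (u0 * v1 + v0 * u1) + c * (v0 * v1)) * (u0 * v1 + u1 * v0)
    - (a * (u1 * u1) + b * (u1 * v1 + v1 * u1) + c * (v1 * v1)) * (u0 * v0)); first by ring.
  by rewrite E00 E01 E11; ring.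
- transitivity ((a * (u0 * u0) + b * (u0 * v0 + v0 * u0) + c * (v0 * v0)) * (u1 * u1)
    - 2 * (a * (u0 * u1) + b * (u0 * v1 + v0 * u1) + c * (v0 * v1)) * (u0 * u1)
    + (a * (u1 * u1) + b * (u1 * v1 + v1 * u1) + c * (v1 * v1)) * (u0 * u0)); first by ring.
  by rewrite E00 E01 E11; ring.
Qed.

Section Vertical.
Context {R : realType}.
Implicit Types (F G : 'rV[R]_3 -> R) (U V : set 'rV[R]_3).

Definition ez (q : 'rV[R]_3) : R := expR (- 2 * q 0 iz).

(* [<grad F, grad G>] for the Sol metric. *)
Definition grad_form F G (q : 'rV[R]_3) : R :=
  ez q * (pd ix F q * pd ix G q) + (ez q)^-1 * (pd iy F q * pd iy G q)
  + pd iz F q * pd iz G q.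

(* [F] is annihilated by the fields annihilating [f] and [g]. *)
Definition basic U (f g : 'rV[R]_3 -> R) F := forall q, U q ->
  exists c1 c2, forall k, pd k F q = c1 * pd k f q + c2 * pd k g q.

Definition minor (f g : 'rV[R]_3 -> R) (i j : 'I_3) (q : 'rV[R]_3) :=
  pd i f q * pd j g q - pd j f q * pd i g q.

Lemma ez_neq0 q : ez q != 0. Proof. by rewrite gt_eqF// expR_gt0. Qed.

Lemma pd_ez U k : open U ->
  isD U (pd k) ez (fun q => - 2 * (k == iz)%:R * ez q).
Proof.
move=> oU; have sz : sm U (fun q : 'rV[R]_3 => - 2 * q 0 iz).
  by apply: sm_mul => //; [exact: sm_cst | exact: sm_coord].
split; first by exact: (sm_exp oU sz).
move=> q Uq; rewrite /ez (pd_exp k sz Uq) (pd_mul k (sm_cst U _) (sm_coord U iz) Uq).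
by rewrite pd_cst pd_coord; ring.
Qed.

Lemma basic_pairing U (f g : 'rV[R]_3 -> R) F q (xi : 'I_3 -> R) :
  basic U f g F -> U q ->
  \sum_k xi k * pd k f q = 0 -> \sum_k xi k * pd k g q = 0 -> \sum_k xi k * pd k F q = 0.
Proof.
move=> /(_ q) bF Uq f0 g0; have [c1 [c2 E]] := bF Uq.
have -> : \sum_k xi k * pd k F q =
    c1 * (\sum_k xi k * pd k f q) + c2 * (\sum_k xi k * pd k g q).
  by rewrite !mulr_sumr -big_split; apply: eq_bigr => k _ /=; rewrite E; ring.
by rewrite f0 g0 !mulr0 addr0.
Qed.

Lemma sum3 (c : 'I_3 -> R) : \sum_k c k = c ix + c iy + c iz.
Proof. exact: sum_I3. Qed.

Lemma sm_minor U (f g : 'rV[R]_3 -> R) i j : open U -> sm U f -> sm U g ->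
  sm U (minor f g i j).
Proof.
move=> oU sf sg; rewrite /minor.
have sp F k : sm U F -> sm U (pd k F) by exact: sm_pd.
apply: sm_add => //; first by apply: sm_mul => //; exact: sp.
by apply: sm_opp => //; apply: sm_mul => //; exact: sp.
Qed.

Lemma isD_grad_form U F G k : open U -> sm U F -> sm U G ->
  isD U (pd k) (grad_form F G) (fun q =>
    - 2 * (k == iz)%:R * ez q * (pd ix F q * pd ix G q)
    + 2 * (k == iz)%:R / ez q * (pd iy F q * pd iy G q)
    + ez q * (pd ix F q * pd k (pd ix G) q + pd ix G q * pd k (pd ix F) q)
    + (ez q)^-1 * (pd iy F q * pd k (pd iy G) q + pd iy G q * pd k (pd iy F) q)
    + (pd iz F q * pd k (pd iz G) q + pd iz G q * pd k (pd iz F) q)).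
Proof.
move=> oU sF sG.
have HF j : isD U (pd k) (pd j F) (pd k (pd j F)) by split=> //; exact: sm_pd.
have HG j : isD U (pd k) (pd j G) (pd k (pd j G)) by split=> //; exact: sm_pd.
have dk := pd_derivation k oU; have He := pd_ez k oU.
have HF1 := HF ix; have HF2 := HF iy; have HF3 := HF iz.
have HG1 := HG ix; have HG2 := HG iy; have HG3 := HG iz.
eassert (H : isD U (pd k) (grad_form F G) _).
  by rewrite /grad_form; der oU dk; move=> q' _; exact: ez_neq0.
by apply: isD_eq H _ => q' _; field; exact: ez_neq0.
Qed.

(** * Vertical fields with a nonzero d/dz component *)

Section Generic.
Variables (U : set 'rV[R]_3) (oU : open U) (f g P Q : 'rV[R]_3 -> R).
Hypotheses (sf : sm U f) (sg : sm U g) (sP : sm U P) (sQ : sm U Q).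
Hypotheses (bff : basic U f g (grad_form f f)) (bfg : basic U f g (grad_form f g))
  (bgg : basic U f g (grad_form g g)).
Hypothesis m0 : forall q, U q -> minor f g ix iy q != 0.
Hypothesis Kf : forall q, U q -> pd iz f q = - (P q * pd ix f q + Q q * pd iy f q).
Hypothesis Kg : forall q, U q -> pd iz g q = - (P q * pd ix g q + Q q * pd iy g q).

Let dpd k := pd_derivation k oU.

(** The [k]-th derivative of [K F = 0], where [K = P d/dx + Q d/dy + d/dz] is the vertical field. *)
Let Kpd F k q : sm U F ->
  (forall q, U q -> pd iz F q = - (P q * pd ix F q + Q q * pd iy F q)) -> U q ->
  P q * pd ix (pd k F) q + Q q * pd iy (pd k F) q + pd iz (pd k F) q =
  - (pd k P q * pd ix F q + pd k Q q * pd iy F q).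
Proof.
move=> sF KF Uq; have dk := dpd k.
have H1 : isD U (pd k) (pd ix F) (pd k (pd ix F)) by split=> //; exact: sm_pd.
have H2 : isD U (pd k) (pd iy F) (pd k (pd iy F)) by split=> //; exact: sm_pd.
have HP : isD U (pd k) P (pd k P) by []. have HQ : isD U (pd k) Q (pd k Q) by [].
eassert (H : isD U (pd k) (fun q => - (P q * pd ix F q + Q q * pd iy F q)) _) by der oU dk.
rewrite (pd_swap oU ix k sF Uq) (pd_swap oU iy k sF Uq) (pd_swap oU iz k sF Uq).
by rewrite (pd_eqon oU k KF Uq) (H.2 _ Uq); ring.
Qed.

(** [K] annihilates the basic function [<grad F, grad G>], and [d (K F) = d (K G) = 0]. What remains
    after eliminating second derivatives is the Lie derivative of the cometric along [K], evaluated
    on [dF] and [dG]; replacing [F_z] and [G_z] makes it a form on the plane. *)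
Let form_eq F G q : sm U F -> sm U G -> basic U f g (grad_form F G) ->
  (forall q, U q -> pd iz F q = - (P q * pd ix F q + Q q * pd iy F q)) ->
  (forall q, U q -> pd iz G q = - (P q * pd ix G q + Q q * pd iy G q)) -> U q ->
  (- 2 * ez q - 2 * ez q * pd ix P q + 2 * P q * pd iz P q) * (pd ix F q * pd ix G q)
  + (- (ez q * pd ix Q q) - pd iy P q / ez q + Q q * pd iz P q + P q * pd iz Q q)
    * (pd ix F q * pd iy G q + pd iy F q * pd ix G q)
  + (2 / ez q - 2 * pd iy Q q / ez q + 2 * Q q * pd iz Q q) * (pd iy F q * pd iy G q) = 0.
Proof.
move=> sF sG bFG KF KG Uq.
pose xi k : R := if k == ix then P q else if k == iy then Q q else 1.
have xif : \sum_k xi k * pd k f q = 0 by rewrite sum3 /xi !i3E Kf//; ring.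
have xig : \sum_k xi k * pd k g q = 0 by rewrite sum3 /xi !i3E Kg//; ring.
have := basic_pairing bFG Uq xif xig; rewrite sum3 /xi !i3E.
have H k := isD_grad_form k oU sF sG.
rewrite !(H _).2// !i3E /=.
have := Kpd ix sF KF Uq; have := Kpd iy sF KF Uq; have := Kpd iz sF KF Uq.
have := Kpd ix sG KG Uq; have := Kpd iy sG KG Uq; have := Kpd iz sG KG Uq.
move=> Gz Gy Gx Fz Fy Fx E.
have {}Gx : pd iz (pd ix G) q = - (pd ix P q * pd ix G q + pd ix Q q * pd iy G q)
   - (P q * pd ix (pd ix G) q + Q q * pd iy (pd ix G) q) by rewrite -Gx; ring.
have {}Gy : pd iz (pd iy G) q = - (pd iy P q * pd ix G q + pd iy Q q * pd iy G q)
   - (P q * pd ix (pd iy G) q + Q q * pd iy (pd iy G) q) by rewrite -Gy; ring.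
have {}Gz : pd iz (pd iz G) q = - (pd iz P q * pd ix G q + pd iz Q q * pd iy G q)
   - (P q * pd ix (pd iz G) q + Q q * pd iy (pd iz G) q) by rewrite -Gz; ring.
have {}Fx : pd iz (pd ix F) q = - (pd ix P q * pd ix F q + pd ix Q q * pd iy F q)
   - (P q * pd ix (pd ix F) q + Q q * pd iy (pd ix F) q) by rewrite -Fx; ring.
have {}Fy : pd iz (pd iy F) q = - (pd iy P q * pd ix F q + pd iy Q q * pd iy F q)
   - (P q * pd ix (pd iy F) q + Q q * pd iy (pd iy F) q) by rewrite -Fy; ring.
have {}Fz : pd iz (pd iz F) q = - (pd iz P q * pd ix F q + pd iz Q q * pd iy F q)
   - (P q * pd ix (pd iz F) q + Q q * pd iy (pd iz F) q) by rewrite -Fz; ring.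
move: E; rewrite Gx Gy Gz Fx Fy Fz KF// KG// => E.
by rewrite -[RHS]E; field; exact: ez_neq0.
Qed.

Lemma generic_killing q k : U q ->
  pd k P q = - (k == ix)%:R /\ pd k Q q = (k == iy)%:R.
Proof.
pose p q := P q + q 0 ix; pose r q := Q q + - q 0 iy.
have sx j : sm U (fun q : 'rV[R]_3 => q 0 j) by exact: sm_coord.
have sp : sm U p by exact: sm_add.
have sr : sm U r by apply: sm_add => //; exact: sm_opp.
have pdp l q' : U q' -> pd l p q' = pd l P q' + (l == ix)%:R.
  by move=> Uq'; rewrite /p (pd_add l sP (sx ix) Uq') pd_coord.
have pdr l q' : U q' -> pd l r q' = pd l Q q' - (l == iy)%:R.
  move=> Uq'; have dl := dpd l; have HQ : isD U (pd l) Q (pd l Q) by [].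
  have Hy : isD U (pd l) (fun q : 'rV[R]_3 => q 0 iy) (fun=> (l == iy)%:R).
    by split=> // v _; exact: pd_coord.
  by eassert (H : isD U (pd l) r _) by (rewrite /r; der oU dl); rewrite (H.2 _ Uq').
have main q' (Uq' : U q') := quad_form_zero (m0 Uq')
  (form_eq sf sf bff Kf Kf Uq') (form_eq sf sg bfg Kf Kg Uq') (form_eq sg sg bgg Kg Kg Uq').
have prE q' : (p q' - q' 0 ix = P q') * (r q' + q' 0 iy = Q q').
  by rewrite /p /r; split; ring.
move=> Uq; have [] := @killing_rigidity R U ix iy p r oU isT isT isT sp sr _ _ _ q k Uq.
- move=> q' Uq'; rewrite -/(ez q') !pdp// !prE !i3E /= addr0.
  have [E _ _] := main _ Uq'; have e0 := ez_neq0 q'.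
  apply: (mulfI e0).
  have -> : ez q' * (P q' / ez q' * pd iz P q') = P q' * pd iz P q' by field.
  by lra.
- move=> q' Uq'; rewrite -/(ez q') !pdr// !prE !i3E /= subr0.
  have [_ _ E] := main _ Uq'; have e0 := ez_neq0 q'.
  have : ez q' * (2 / ez q' - 2 * pd iy Q q' / ez q' + 2 * Q q' * pd iz Q q') = 0 by rewrite E mulr0.
  have -> : ez q' * (2 / ez q' - 2 * pd iy Q q' / ez q' + 2 * Q q' * pd iz Q q') =
    2 * (Q q' * ez q' * pd iz Q q' - (pd iy Q q' - 1)) by field.
  by move=> ?; lra.
- move=> q' Uq'; rewrite -/(ez q') !pdp// !pdr// !prE !i3E /= !addr0 !subr0.
  by have [_ E _] := main _ Uq'; lra.
rewrite pdp// pdr// => E1 E2; split; first by apply/eqP; rewrite -addr_eq0 E1.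
by apply/eqP; rewrite -subr_eq0 E2.
Qed.

End Generic.
End Vertical.

(** * Vertical fields [T d/dx + d/dy] *)

Section Degenerate.
Context {R : realType}.
Variables (U : set 'rV[R]_3) (oU : open U) (f g T : 'rV[R]_3 -> R).
Hypotheses (sf : sm U f) (sg : sm U g) (sT : sm U T).
Hypotheses (bff : basic U f g (grad_form f f)) (bfg : basic U f g (grad_form f g))
  (bgg : basic U f g (grad_form g g)).
Hypothesis m0 : forall q, U q -> minor f g ix iz q != 0.
Hypothesis Kf : forall q, U q -> pd iy f q = - (T q * pd ix f q).
Hypothesis Kg : forall q, U q -> pd iy g q = - (T q * pd ix g q).

Let dpd k := pd_derivation k oU.

Let Kpd (F : 'rV[R]_3 -> R) k q : sm U F ->
  (forall q, U q -> pd iy F q = - (T q * pd ix F q)) -> U q ->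
  pd iy (pd k F) q = - (pd k T q * pd ix F q) - T q * pd ix (pd k F) q.
Proof.
move=> sF KF Uq; have dk := dpd k.
have H1 : isD U (pd k) (pd ix F) (pd k (pd ix F)) by split=> //; exact: sm_pd.
have HT : isD U (pd k) T (pd k T) by [].
eassert (H : isD U (pd k) (fun q => - (T q * pd ix F q)) _) by der oU dk.
rewrite (pd_swap oU ix k sF Uq) (pd_swap oU iy k sF Uq).
by rewrite (pd_eqon oU k KF Uq) (H.2 _ Uq); ring.
Qed.

Let form_eq (F G : 'rV[R]_3 -> R) q : sm U F -> sm U G -> basic U f g (grad_form F G) ->
  (forall q, U q -> pd iy F q = - (T q * pd ix F q)) ->
  (forall q, U q -> pd iy G q = - (T q * pd ix G q)) -> U q ->
  (2 * T q * pd iy T q / ez q - 2 * ez q * pd ix T q) * (pd ix F q * pd ix G q)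
  + - pd iz T q * (pd ix F q * pd iz G q + pd iz F q * pd ix G q)
  + 0 * (pd iz F q * pd iz G q) = 0.
Proof.
move=> sF sG bFG KF KG Uq.
pose xi k : R := if k == ix then T q else if k == iy then 1 else 0.
have xif : \sum_k xi k * pd k f q = 0 by rewrite sum3 /xi !i3E Kf//; ring.
have xig : \sum_k xi k * pd k g q = 0 by rewrite sum3 /xi !i3E Kg//; ring.
have := basic_pairing bFG Uq xif xig; rewrite sum3 /xi !i3E.
have H k := isD_grad_form k oU sF sG.
rewrite !(H _).2// !i3E /=.
rewrite !(Kpd _ sF KF Uq) !(Kpd _ sG KG Uq) KF// KG// => E.
by rewrite -[RHS]E; field; exact: ez_neq0.
Qed.

(** The form gives [T_z = 0] and [T_x = T T_y e^(4z)]. As [T_x] and [T T_y] do not depend on [z],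
    [T T_y = 0]; where [T_y] is nonzero, [T] would vanish on an open set, and [T_y] with it. *)
Lemma degenerate_killing q k : U q -> pd k T q = 0.
Proof.
have main q' (Uq' : U q') := quad_form_zero (m0 Uq')
  (form_eq sf sf bff Kf Kf Uq') (form_eq sf sg bfg Kf Kg Uq') (form_eq sg sg bgg Kg Kg Uq').
have Tz q' : U q' -> pd iz T q' = 0.
  by move=> /main[_ E _]; apply/eqP; rewrite -oppr_eq0 E.
have Tx q' : U q' -> pd ix T q' = T q' * pd iy T q' * ((ez q')^-1 * (ez q')^-1).
  move=> /main[E _ _]; have e0 := ez_neq0 q'.
  have -> : pd ix T q' = T q' * pd iy T q' * ((ez q')^-1 * (ez q')^-1)
     - (2 * T q' * pd iy T q' / ez q' - 2 * ez q' * pd ix T q') * (ez q')^-1 / 2 by field.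
  by rewrite E !mul0r subr0.
have zero j F q' : (forall q, U q -> F q = 0) -> U q' -> pd j F q' = 0.
  by move=> F0 Uq'; rewrite (pd_eqon oU j F0 Uq') pd_cst.
have TTy q' : U q' -> T q' * pd iy T q' = 0.
  move=> Uq'; have dz := dpd iz; have e0 := ez_neq0 q'.
  have E : pd iz (pd ix T) q' = 0 by rewrite (pd_swap oU iz ix sT Uq') zero.
  have HT : isD U (pd iz) T (fun=> 0) by [].
  have HTy : isD U (pd iz) (pd iy T) (fun=> 0).
    by split=> [|v Uv]; [exact: sm_pd | rewrite (pd_swap oU iz iy sT Uv) zero].
  have He := pd_ez iz oU.
  eassert (H : isD U (pd iz) (fun q => T q * pd iy T q * ((ez q)^-1 * (ez q)^-1)) _).
    by der oU dz; move=> v _; exact: ez_neq0.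
  move: E; rewrite (pd_eqon oU iz Tx Uq') (H.2 _ Uq') eqxx /= => E.
  apply: (mulfI (_ : 4 / (ez q' * ez q') != 0)).
    by rewrite mulf_neq0 ?invr_eq0 ?mulf_neq0// pnatr_eq0.
  by rewrite mulr0 -[RHS]E; field.
have Ty q' : U q' -> pd iy T q' = 0.
  move=> Uq'; apply/eqP/negPn/negP => Ty0.
  pose V := U `&` [set v | pd iy T v != 0].
  have oV : open V by apply: sm_open_neq0 => //; exact: sm_pd.
  have T0 v : V v -> T v = 0.
    by move=> [Uv Tv]; have /eqP := TTy v Uv; rewrite mulf_eq0 (negbTE Tv) orbF => /eqP.
  have Vq' : V q' by split.
  by move: Ty0; rewrite (pd_eqon oV iy (g := fun=> 0) T0 Vq') pd_cst eqxx.
move=> Uq; have Txq : pd ix T q = 0 by rewrite Tx// Ty// mulr0 mul0r.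
by case: (I3P k) => ->; [exact: Txq | exact: Ty | exact: Tz].
Qed.

End Degenerate.

(** The vertical line is spanned by the cross product of the coordinate gradients, whose components
    are the minors up to sign. It is normalised by its z-component if that is somewhere nonzero,
    otherwise by its y-component, and otherwise it is the line of d/dx. The conditions on the
    derivatives of [xi1] and [xi2] describe the fields (c1 - w x, c2 + w y, w) up to local
    constants. *)
Lemma vertical_killing {R : realType} (U : set 'rV[R]_3) (f g : 'rV[R]_3 -> R) q0 :
  open U -> sm U f -> sm U g ->
  basic U f g (grad_form f f) -> basic U f g (grad_form f g) ->
  basic U f g (grad_form g g) ->
  U q0 ->
  (forall q, U q -> minor f g ix iy q = 0 -> minor f g ix iz q = 0 ->
     minor f g iy iz q != 0) ->
  exists V q1 (xi1 xi2 : 'rV[R]_3 -> R) w,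
   [/\ open V, V `<=` U, V q1, sm V xi1 /\ sm V xi2 &
   forall q, V q -> [/\ forall k, pd k xi1 q = - (w * (k == ix)%:R),
      forall k, pd k xi2 q = w * (k == iy)%:R,
      xi1 q * pd ix f q + xi2 q * pd iy f q + w * pd iz f q = 0,
      xi1 q * pd ix g q + xi2 q * pd iy g q + w * pd iz g q = 0 &
      [|| xi1 q != 0, xi2 q != 0 | w != 0]]].
Proof.
move=> oU sf sg bff bfg bgg Uq0 rk.
have restrict V F : V `<=` U -> basic U f g F -> basic V f g F.
  by move=> VU bF q /VU; exact: bF.
have smm i j := sm_minor i j oU sf sg.
have [[q1 [Uq1 m1]]|] := pselect (exists q1, U q1 /\ minor f g ix iy q1 != 0).
  pose V := U `&` [set q | minor f g ix iy q != 0].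
  have oV : open V by exact: sm_open_neq0.
  have VU : V `<=` U by move=> q [].
  have m0 q : V q -> minor f g ix iy q != 0 by move=> [].
  pose P q := minor f g iy iz q * (minor f g ix iy q)^-1.
  pose Q q := - minor f g ix iz q * (minor f g ix iy q)^-1.
  have smV i j := sm_sub VU (smm i j).
  have sP : sm V P by apply: sm_mul => //; exact: sm_inv.
  have sQ : sm V Q by apply: sm_mul => //; [exact: sm_opp | exact: sm_inv].
  have Kf q : V q -> pd iz f q = - (P q * pd ix f q + Q q * pd iy f q).
    move=> /m0; rewrite /P /Q /minor => mq; apply: (mulfI mq).
    by field.
  have Kg q : V q -> pd iz g q = - (P q * pd ix g q + Q q * pd iy g q).
    move=> /m0; rewrite /P /Q /minor => mq; apply: (mulfI mq).
    by field.
  have H q k Vq := @generic_killing R V oV f g P Q (sm_sub VU sf) (sm_sub VU sg) sP sQ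
    (restrict _ _ VU bff) (restrict _ _ VU bfg) (restrict _ _ VU bgg) m0 Kf Kg q k Vq.
  exists V, q1, P, Q, 1; split => // q Vq; split.
  - by move=> k; rewrite (H q k Vq).1 mul1r.
  - by move=> k; rewrite (H q k Vq).2 mul1r.
  - by rewrite Kf//; ring.
  - by rewrite Kg//; ring.
  - by rewrite oner_neq0 !orbT.
move=> /forallNP mxy.
have mxy0 q : U q -> minor f g ix iy q = 0.
  by move=> Uq; apply/eqP/negPn/negP => m; apply: (mxy q).
have [[q1 [Uq1 m1]]|] := pselect (exists q1, U q1 /\ minor f g ix iz q1 != 0).
  pose V := U `&` [set q | minor f g ix iz q != 0].
  have oV : open V by exact: sm_open_neq0.
  have VU : V `<=` U by move=> q [].
  have m0 q : V q -> minor f g ix iz q != 0 by move=> [].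
  pose T q := - minor f g iy iz q * (minor f g ix iz q)^-1.
  have smV i j := sm_sub VU (smm i j).
  have sT : sm V T by apply: sm_mul => //; [exact: sm_opp | exact: sm_inv].
  have Kf q : V q -> pd iy f q = - (T q * pd ix f q).
    move=> Vq; have mq := m0 q Vq; apply: (mulfI mq); rewrite /T.
    have -> : minor f g ix iz q * - (- minor f g iy iz q / minor f g ix iz q * pd ix f q) =
      minor f g iy iz q * pd ix f q by field.
    apply/eqP; rewrite -subr_eq0; apply/eqP.
    transitivity (minor f g ix iy q * pd iz f q); first by rewrite /minor; ring.
    by rewrite mxy0 ?mul0r//; exact: VU.
  have Kg q : V q -> pd iy g q = - (T q * pd ix g q).
    move=> Vq; have mq := m0 q Vq; apply: (mulfI mq); rewrite /T.
    have -> : minor f g ix iz q * - (- minor f g iy iz q / minor f g ix iz q * pd ix g q) =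
      minor f g iy iz q * pd ix g q by field.
    apply/eqP; rewrite -subr_eq0; apply/eqP.
    transitivity (minor f g ix iy q * pd iz g q); first by rewrite /minor; ring.
    by rewrite mxy0 ?mul0r//; exact: VU.
  have H q k Vq := @degenerate_killing R V oV f g T (sm_sub VU sf) (sm_sub VU sg) sT
    (restrict _ _ VU bff) (restrict _ _ VU bfg) (restrict _ _ VU bgg) m0 Kf Kg q k Vq.
  exists V, q1, T, (fun=> 1), 0; split => //; first by split => //; exact: sm_cst.
  move=> q Vq; split.
  - by move=> k; rewrite H// mul0r oppr0.
  - by move=> k; rewrite pd_cst mul0r.
  - by rewrite Kf//; ring.
  - by rewrite Kg//; ring.
  - by rewrite oner_neq0 !orbT.
move=> /forallNP mxz.
have mxz0 q : U q -> minor f g ix iz q = 0.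
  by move=> Uq; apply/eqP/negPn/negP => m; apply: (mxz q).
have myz q : U q -> minor f g iy iz q != 0.
  by move=> Uq; apply: rk; [exact: Uq | exact: mxy0 | exact: mxz0].
have fx F q : U q -> minor f g iy iz q * pd ix F q - minor f g ix iz q * pd iy F q +
    minor f g ix iy q * pd iz F q = 0 -> pd ix F q = 0.
  move=> Uq; rewrite mxy0// mxz0// !mul0r subr0 addr0 => /eqP.
  by rewrite mulf_eq0 (negbTE (myz q Uq)) => /eqP.
exists U, q0, (fun=> 1), (fun=> 0), 0; split => //; first by split; exact: sm_cst.
move=> q Uq; split.
- by move=> k; rewrite pd_cst mul0r oppr0.
- by move=> k; rewrite pd_cst mul0r.
- by rewrite (fx f q Uq) ?mulr0 ?mul0r ?addr0//; rewrite /minor; ring.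
- by rewrite (fx g q Uq) ?mulr0 ?mul0r ?addr0//; rewrite /minor; ring.
- by rewrite oner_neq0.
Qed.

(** * Connections and pull-backs on surfaces *)

Section TwoByTwo.
Context {R : realType}.

Lemma sum2 (V : nmodType) (c : 'I_2 -> V) : \sum_k c k = c 0 + c 1.
Proof. by rewrite big_ord_recl big_ord1; congr (_ + c _); apply/val_inj. Qed.

Lemma I2P (k : 'I_2) : k = 0 \/ k = 1.
Proof. by case: k => -[|[|//]] kn; [left|right]; apply/val_inj. Qed.

Lemma inv2 (M : 'M[R]_2) : M 0 0 * M 1 1 - M 0 1 * M 1 0 != 0 ->
  let D := M 0 0 * M 1 1 - M 0 1 * M 1 0 in
  M \in unitmx /\ [/\ invmx M 0 0 = D^-1 * M 1 1, invmx M 0 1 = D^-1 * - M 0 1,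
      invmx M 1 0 = D^-1 * - M 1 0 & invmx M 1 1 = D^-1 * M 0 0].
Proof.
move=> D0 D; pose N : 'M[R]_2 := \matrix_(i, j)
  (D^-1 * (if i == 0 then (if j == 0 then M 1 1 else - M 0 1)
           else (if j == 0 then - M 1 0 else M 0 0))).
have NM : N *m M = 1%:M.
{   apply/matrixP => i j; rewrite !mxE sum2 !mxE /= /D.
  case: (I2P i) => ->; case: (I2P j) => ->; rewrite ?eqxx /=.
  all: move: D0; rewrite ?eqxx /= ?mulr1n ?mulr0n.
  all: move: (M 0 0) (M 0 1) (M 1 0) (M 1 1) => m00 m01 m10 m11 D0; field.
  all: by []. }
have [_ uM] := mulmx1_unit NM; split=> //.
have -> : invmx M = N.
  by rewrite -[LHS]mul1mx -NM mulmxK.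
by rewrite !mxE.
Qed.

End TwoByTwo.

Section Connection.
Context {R : realType} {n : nat}.
Variables (U : set 'rV[R]_n) (oU : open U) (Om : set 'rV[R]_2) (oOm : open Om).
Variables (h : 'rV[R]_2 -> 'M[R]_2) (f : 'rV[R]_n -> 'rV[R]_2).
Hypotheses (mh : is_metric_on Om h) (fU : forall q, U q -> Om (f q)).
Hypothesis sf : forall b, sm U (fun q => f q 0 b).

Lemma metric_entry_sym u a b : Om u -> h u a b = h u b a.
Proof. by move=> Ou; have /matrixP /(_ a b) := Defs.metric_sym mh Ou; rewrite mxE. Qed.

Lemma metric_det_gt0 u : Om u -> 0 < h u 0 0 * h u 1 1 - h u 0 1 * h u 1 0.
Proof.
move=> Ou.
have innerE (v : 'rV[R]_2) : inner (h u) v v =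
    v 0 0 * (v 0 0 * h u 0 0 + v 0 1 * h u 1 0) + v 0 1 * (v 0 0 * h u 0 1 + v 0 1 * h u 1 1).
  by rewrite /inner !mxE sum2 !mxE !sum2; ring.
pose e0 : 'rV[R]_2 := \row_i (i == 0)%:R.
have h00 : 0 < h u 0 0.
  have e00 : e0 != 0 by apply/eqP => /matrixP /(_ 0 0) /eqP; rewrite !mxE oner_eq0.
  by have := Defs.metric_pos mh Ou e00; rewrite innerE !mxE /=; congr (0 < _); ring.
(* A vector whose squared length is [h00] times the determinant. *)
pose v : 'rV[R]_2 := \row_i (if i == 0 then - h u 1 0 else h u 0 0).
have v0 : v != 0.
  by apply/eqP => /matrixP /(_ 0 1) /eqP; rewrite !mxE /= gt_eqF.
have := Defs.metric_pos mh Ou v0; rewrite innerE !mxE /=.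
have -> : - h u 1 0 * (- h u 1 0 * h u 0 0 + h u 0 0 * h u 1 0) +
  h u 0 0 * (- h u 1 0 * h u 0 1 + h u 0 0 * h u 1 1) =
  h u 0 0 * (h u 0 0 * h u 1 1 - h u 0 1 * h u 1 0) by ring.
by rewrite pmulr_rgt0.
Qed.

Let sh a b : sm Om (fun u => h u a b).
Proof. exact: smooth_on_entry (Defs.metric_smooth mh). Qed.

Lemma sm_invmx_metric a b : sm Om (fun u => invmx (h u) a b).
Proof.
have D0 u : Om u -> h u 0 0 * h u 1 1 + - (h u 0 1 * h u 1 0) != 0.
  by move=> /metric_det_gt0/lt0r_neq0.
have sD : sm Om (fun u => (h u 0 0 * h u 1 1 + - (h u 0 1 * h u 1 0))^-1).
  by apply: sm_inv => //; apply: sm_add => //; [|apply: sm_opp => //]; exact: sm_mul.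
have sN F : sm Om F -> sm Om (fun u => - F u) by exact: sm_opp.
case: (I2P a) => ->; case: (I2P b) => ->.
- by apply: (sm_eqon oOm _ (sm_mul oOm sD (sh 1 1))) => u /D0 /inv2[_ [-> _ _ _]].
- by apply: (sm_eqon oOm _ (sm_mul oOm sD (sN _ (sh 0 1)))) => u /D0 /inv2[_ [_ -> _ _]].
- by apply: (sm_eqon oOm _ (sm_mul oOm sD (sN _ (sh 1 0)))) => u /D0 /inv2[_ [_ _ -> _]].
- by apply: (sm_eqon oOm _ (sm_mul oOm sD (sh 0 0))) => u /D0 /inv2[_ [_ _ _ ->]].
Qed.

Lemma sm_christoffel a b c : sm Om (christoffel h a b c).
Proof.
rewrite /christoffel; apply: sm_mul => //; first exact: sm_cst.
apply: sm_sum => // l; apply: sm_mul => //; first exact: sm_invmx_metric.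
have sp i j k : sm Om (fun p => partial i h p j k).
  apply: (sm_eqon oOm _ (sm_pd i (sh j k))) => u Ou.
  by rewrite (partial_entry j k i (Defs.metric_smooth mh) Ou) pdE.
by apply: sm_add => //; [exact: sm_add | exact: sm_opp].
Qed.

Lemma christoffel_lower u m i j : Om u ->
  \sum_k h u m k * christoffel h k i j u =
  2^-1 * (pd i (fun u => h u j m) u + pd j (fun u => h u i m) u - pd m (fun u => h u i j) u).
Proof.
move=> Ou; rewrite /christoffel; have dh := lt0r_neq0 (metric_det_gt0 Ou).
have [uh _] := inv2 dh.
transitivity (2^-1 * \sum_l (\sum_k h u m k * invmx (h u) k l) *
    (partial i h u j l + partial j h u i l - partial l h u i j)).
  rewrite mulr_sumr !sum2; ring.
have E l : \sum_k h u m k * invmx (h u) k l = (m == l)%:R.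
  by have /matrixP /(_ m l) := mulmxV uh; rewrite !mxE.
have ph k a b : partial k h u a b = pd k (fun u => h u a b) u.
  by rewrite (partial_entry a b k (Defs.metric_smooth mh) Ou) pdE.
congr (_ * _); under eq_bigr do rewrite E !ph.
rewrite (bigD1 m)//= big1 ?addr0 => [|l lm]; first by rewrite eqxx mul1r.
by rewrite eq_sym (negbTE lm) mul0r.
Qed.

Lemma christoffel_sym u k i j : Om u -> christoffel h k i j u = christoffel h k j i u.
Proof.
move=> Ou; rewrite /christoffel; congr (_ * _); apply: eq_bigr => l _; congr (_ * _).
rewrite [partial i h u j l + _]addrC; congr (_ - _).
rewrite !(partial_entry _ _ l (Defs.metric_smooth mh) Ou); apply: (partial_eqon l oOm) => // v Ov.
exact: metric_entry_sym.
Qed.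

Lemma metric_compat u c a b : Om u -> pd c (fun u => h u a b) u =
  \sum_e (christoffel h e c a u * h u e b + christoffel h e c b u * h u a e).
Proof.
move=> Ou; rewrite big_split /=.
have -> : \sum_e christoffel h e c a u * h u e b = \sum_e h u b e * christoffel h e c a u.
  by apply: eq_bigr => e _; rewrite mulrC (metric_entry_sym e b Ou).
have -> : \sum_e christoffel h e c b u * h u a e = \sum_e h u a e * christoffel h e c b u.
  by apply: eq_bigr => e _; rewrite mulrC.
rewrite !christoffel_lower//.
have sy i a' b' : pd i (fun u => h u a' b') u = pd i (fun u => h u b' a') u.
  by apply: (pd_eqon oOm) => // v Ov; exact: metric_entry_sym.
by rewrite (sy c b a); field.
Qed.

End Connection.

(** * The pulled back Levi-Civita connection *)

Section PullBack.
Context {R : realType} {n : nat}.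
Variables (U : set 'rV[R]_n) (oU : open U) (Om : set 'rV[R]_2) (oOm : open Om).
Variables (h : 'rV[R]_2 -> 'M[R]_2) (f : 'rV[R]_n -> 'rV[R]_2).
Hypotheses (mh : is_metric_on Om h) (fU : forall q, U q -> Om (f q)).
Hypothesis sf : forall b, sm U (fun q => f q 0 b).
Implicit Types X Y : 'I_2 -> 'rV[R]_n -> R.

(* Sections of the pull-back of the tangent bundle are given by their components
   [X : 'I_2 -> 'rV[R]_n -> R]. *)
Definition covd i X a (q : 'rV[R]_n) : R := pd i (X a) q +
  \sum_b \sum_c christoffel h a b c (f q) * pd i (fun q => f q 0 b) q * X c q.

Definition pb_inner X Y (q : 'rV[R]_n) : R := \sum_a \sum_b h (f q) a b * X a q * Y b q.

Let dpd k := pd_derivation k oU.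

Let dG k a b c : isD U (pd k) (fun q => christoffel h a b c (f q)) (fun q =>
  pd 0 (christoffel h a b c) (f q) * pd k (fun q => f q 0 0) q +
  pd 1 (christoffel h a b c) (f q) * pd k (fun q => f q 0 1) q).
Proof.
have sG : sm Om (christoffel h a b c) by exact: sm_christoffel.
split; first exact: (sm_comp oU oOm fU sf sG).
by move=> q Uq; rewrite (pd_comp k oOm sf sG Uq (fU Uq)) sum2 !pdE.
Qed.

Let dh k a b : isD U (pd k) (fun q => h (f q) a b) (fun q =>
  pd 0 (fun u => h u a b) (f q) * pd k (fun q => f q 0 0) q +
  pd 1 (fun u => h u a b) (f q) * pd k (fun q => f q 0 1) q).
Proof.
have sh : sm Om (fun u => h u a b) by exact: smooth_on_entry (Defs.metric_smooth mh).
split; first exact: (sm_comp oU oOm fU sf sh).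
by move=> q Uq; rewrite (pd_comp k oOm sf sh Uq (fU Uq)) sum2 !pdE.
Qed.

Let isD_pd k F : sm U F -> isD U (pd k) F (pd k F). Proof. by []. Qed.

Lemma covdE i X a q : covd i X a q = pd i (X a) q +
  (christoffel h a 0 0 (f q) * pd i (fun q => f q 0 0) q * X 0 q
  + christoffel h a 0 1 (f q) * pd i (fun q => f q 0 0) q * X 1 q
  + (christoffel h a 1 0 (f q) * pd i (fun q => f q 0 1) q * X 0 q
  + christoffel h a 1 1 (f q) * pd i (fun q => f q 0 1) q * X 1 q)).
Proof. by rewrite /covd !sum2. Qed.

Lemma pb_innerE X Y q : pb_inner X Y q = h (f q) 0 0 * X 0 q * Y 0 q + h (f q) 0 1 * X 0 q * Y 1 q
  + (h (f q) 1 0 * X 1 q * Y 0 q + h (f q) 1 1 * X 1 q * Y 1 q).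
Proof. by rewrite /pb_inner !sum2. Qed.

Lemma sm_covd i X a : (forall a, sm U (X a)) -> sm U (covd i X a).
Proof.
move=> sX; rewrite /covd; apply: sm_add => //; first exact: sm_pd.
apply: sm_sum => // b; apply: sm_sum => // c; apply: sm_mul => //.
by apply: sm_mul => //; [exact: (dG i a b c).1 | exact: sm_pd].
Qed.

Lemma pb_inner_compat k X Y q : (forall a, sm U (X a)) -> (forall a, sm U (Y a)) -> U q ->
  pd k (pb_inner X Y) q = pb_inner (covd k X) Y q + pb_inner X (covd k Y) q.
Proof.
move=> sX sY Uq.
rewrite (pd_eqon oU k (fun q _ => pb_innerE X Y q) Uq).
have h00 := dh k 0 0; have h01 := dh k 0 1; have h10 := dh k 1 0; have h11 := dh k 1 1.
have X0 := isD_pd k (sX 0); have X1 := isD_pd k (sX 1).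
have Y0 := isD_pd k (sY 0); have Y1 := isD_pd k (sY 1); have dk := dpd k.
eassert (H : isD U (pd k) (fun q => h (f q) 0 0 * X 0 q * Y 0 q + h (f q) 0 1 * X 0 q * Y 1 q
  + (h (f q) 1 0 * X 1 q * Y 0 q + h (f q) 1 1 * X 1 q * Y 1 q)) _) by der oU dk.
rewrite (H.2 _ Uq) !(metric_compat oOm mh _ _ _ (fU Uq)) !pb_innerE !covdE !sum2.
clear H h00 h01 h10 h11 X0 X1 Y0 Y1.
move: (pd k _ q) (pd k _ q) (pd k _ q) (pd k _ q) (pd k _ q) (pd k _ q) => x1 x2 x3 x4 x5 x6.
ring.
Qed.

Lemma covd_sym i j a q : U q ->
  covd i (fun a => pd j (fun q => f q 0 a)) a q = covd j (fun a => pd i (fun q => f q 0 a)) a q.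
Proof.
move=> Uq; rewrite !covdE (pd_swap oU i j (sf a) Uq); congr (_ + _).
rewrite (christoffel_sym oOm mh a 1 0 (fU Uq)).
by move: (pd i _ q) (pd i _ q) (pd j _ q) (pd j _ q) => x1 x2 x3 x4; ring.
Qed.

(** The curvature of the pulled back connection is the pull-back of the curvature; there is no
    bracket term because coordinate fields commute. *)
Lemma covd_commutator i j X a q : (forall a, sm U (X a)) -> U q ->
  covd i (covd j X) a q - covd j (covd i X) a q =
  curvature h (f q) (\row_b pd i (fun q => f q 0 b) q) (\row_b pd j (fun q => f q 0 b) q)
    (\row_b X b q) 0 a.
Proof.
move=> sX Uq; rewrite mxE !sum2 !mxE.
have E k l : pd k (covd l X a) q = pd k (pd l (X a)) q +
  ((christoffel h a 0 0 (f q) * (pd k (pd l (fun q => f q 0 0)) q * X 0 q + pd l (fun q => f q 0 0) q * pd k (X 0) q)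
  + (pd 0 (christoffel h a 0 0) (f q) * pd k (fun q => f q 0 0) q +
     pd 1 (christoffel h a 0 0) (f q) * pd k (fun q => f q 0 1) q) * (pd l (fun q => f q 0 0) q * X 0 q)
  + (christoffel h a 0 1 (f q) * (pd k (pd l (fun q => f q 0 0)) q * X 1 q + pd l (fun q => f q 0 0) q * pd k (X 1) q)
  + (pd 0 (christoffel h a 0 1) (f q) * pd k (fun q => f q 0 0) q +
     pd 1 (christoffel h a 0 1) (f q) * pd k (fun q => f q 0 1) q) * (pd l (fun q => f q 0 0) q * X 1 q)))
 + (christoffel h a 1 0 (f q) * (pd k (pd l (fun q => f q 0 1)) q * X 0 q + pd l (fun q => f q 0 1) q * pd k (X 0) q)
  + (pd 0 (christoffel h a 1 0) (f q) * pd k (fun q => f q 0 0) q +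
     pd 1 (christoffel h a 1 0) (f q) * pd k (fun q => f q 0 1) q) * (pd l (fun q => f q 0 1) q * X 0 q)
  + (christoffel h a 1 1 (f q) * (pd k (pd l (fun q => f q 0 1)) q * X 1 q + pd l (fun q => f q 0 1) q * pd k (X 1) q)
  + (pd 0 (christoffel h a 1 1) (f q) * pd k (fun q => f q 0 0) q +
     pd 1 (christoffel h a 1 1) (f q) * pd k (fun q => f q 0 1) q) * (pd l (fun q => f q 0 1) q * X 1 q)))).
  rewrite (pd_eqon oU k (fun q _ => covdE l X a q) Uq).
  have g00 := dG k a 0 0; have g01 := dG k a 0 1; have g10 := dG k a 1 0; have g11 := dG k a 1 1.
  have X0 := isD_pd k (sX 0); have X1 := isD_pd k (sX 1).
  have f0 := isD_pd k (sm_pd l (sf 0)); have f1 := isD_pd k (sm_pd l (sf 1)).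
  have Xa := isD_pd k (sm_pd l (sX a)); have dk := dpd k.
  eassert (H : isD U (pd k) (fun q => pd l (X a) q +
    (christoffel h a 0 0 (f q) * pd l (fun q => f q 0 0) q * X 0 q
    + christoffel h a 0 1 (f q) * pd l (fun q => f q 0 0) q * X 1 q
    + (christoffel h a 1 0 (f q) * pd l (fun q => f q 0 1) q * X 0 q
    + christoffel h a 1 1 (f q) * pd l (fun q => f q 0 1) q * X 1 q))) _) by der oU dk.
  rewrite (H.2 _ Uq); clear H g00 g01 g10 g11 X0 X1 f0 f1 Xa.
  move: (pd k (pd l _) q) (pd k (pd l _) q) (pd k (pd l _) q) => z1 z2 z3.
  move: (pd l _ q) (pd l _ q) (pd k _ q) (pd k _ q) (pd k _ q) (pd k _ q) => x1 x2 x3 x4 x5 x6.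
  move: (pd 0 _ _) (pd 1 _ _) (pd 0 _ _) (pd 1 _ _) (pd 0 _ _) (pd 1 _ _) (pd 0 _ _) (pd 1 _ _)
    => y1 y2 y3 y4 y5 y6 y7 y8.
  ring.
rewrite [covd i _ a q]covdE [covd j (covd i X) a q]covdE !E !covdE.
rewrite (pd_swap oU i j (sX a) Uq) (pd_swap oU i j (sf 0) Uq) (pd_swap oU i j (sf 1) Uq).
rewrite -!pdE.
move: (pd 0 _ _) (pd 1 _ _) (pd 0 _ _) (pd 1 _ _) (pd 0 _ _) (pd 1 _ _) (pd 0 _ _) (pd 1 _ _)
    => y1 y2 y3 y4 y5 y6 y7 y8.
move: (pd j (pd i _) q) (pd j (pd i _) q) (pd j (pd i _) q) => z1 z2 z3.
move: (pd i _ q) (pd i _ q) (pd i _ q) (pd i _ q)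
  (pd j _ q) (pd j _ q) (pd j _ q) (pd j _ q) => x1 x2 x3 x4 x5 x6 x7 x8.
ring.
Qed.

End PullBack.

(** * Tension and bitension fields on Sol space *)

Lemma partial_mx {R : realType} {n a b : nat} (U : set 'rV[R]_n) (oU : open U)
    (M : 'rV[R]_n -> 'M[R]_(a, b)) i p r c :
  (forall r c, sm U (fun q => M q r c)) -> U p ->
  partial i M p r c = pd i (fun q => M q r c) p.
Proof.
move=> sM Up; rewrite pdE /partial derive_mx ?mxE//.
by apply/derivable_mxP => r' c'; exact: (@sm_derivable _ _ U (fun q => M q r' c') i p (sM r' c') Up).
Qed.

Section SolMetric.
Context {R : realType}.

(* The diagonal of the inverse of the Sol metric. *)
Definition theta (i : 'I_3) (q : 'rV[R]_3) : R := nth 0 [:: ez q; (ez q)^-1; 1] i.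

Lemma theta_neq0 i q : theta i q != 0.
Proof.
by rewrite /theta; case: (I3P i) => -> /=; rewrite ?oner_eq0// ?invr_eq0 ez_neq0.
Qed.

Lemma sol_metricE q i j : sol_metric q i j = (i == j)%:R * (theta i q)^-1 :> R.
Proof.
have E : expR (2 * q 0 iz) = (ez q)^-1 by rewrite /ez mulNr expRN invrK.
have E' : expR (- (2 * q 0 iz)) = ez q by rewrite /ez mulNr.
rewrite /sol_metric -/iz E E' !mxE /theta.
case: eqVneq => [->|]; last by rewrite mulr0n mul0r.
by rewrite mulr1n mul1r; case: (I3P j) => -> /=; rewrite ?invrK ?invr1.
Qed.

Lemma invmx_sol_metric q i j : invmx (sol_metric q) i j = (i == j)%:R * theta i q :> R.
Proof.
pose D : 'M[R]_3 := \matrix_(a, b) ((a == b)%:R * theta a q).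
have DM : D *m sol_metric q = 1%:M.
  apply/matrixP => a b; rewrite !mxE (bigD1 a)//= big1 ?addr0 => [|c ca]; last first.
    by rewrite [D a c]mxE eq_sym (negbTE ca) !mul0r.
  rewrite [D a a]mxE eqxx mul1r sol_metricE; case: eqVneq => _; last by rewrite !mul0r mulr0.
  by rewrite mul1r mulfV// theta_neq0.
have [_ uM] := mulmx1_unit DM.
have -> : invmx (sol_metric q) = D by rewrite -[LHS]mul1mx -DM mulmxK.
by rewrite mxE.
Qed.

Lemma partial_sol_metric q i j l :
  partial i (@sol_metric R) q j l =
  (j == l)%:R * (i == iz)%:R * nth 0 [:: 2 / ez q; - 2 * ez q; 0] j.
Proof.
have oT : open [set: 'rV[R]_3] by exact: openT.
have De := pd_ez i oT; have dk := pd_derivation i oT.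
have Di : isD setT (pd i) (fun q : 'rV[R]_3 => (ez q)^-1) (fun q : 'rV[R]_3 => - ((ez q)^-1 * (ez q)^-1 *
   (- 2 * (i == iz)%:R * ez q))).
  exact: (isD_inv oT dk (fun p _ => ez_neq0 p) De).
have D j' l' : isD setT (pd i) (fun q : 'rV[R]_3 => sol_metric q j' l') (fun q : 'rV[R]_3 =>
    (j' == l')%:R * (i == iz)%:R * nth 0 [:: 2 / ez q; - 2 * ez q; 0] j').
  apply: (@isD_eqon _ _ _ oT _ dk (fun q : 'rV[R]_3 => (j' == l')%:R * nth 0 [:: (ez q)^-1; ez q; 1] j')).
    move=> p _; rewrite sol_metricE /theta; congr (_ * _).
    by case: (I3P j') => -> /=; rewrite ?invrK ?invr1.
  have D1 : isD setT (pd i) (fun q : 'rV[R]_3 => nth 0 [:: (ez q)^-1; ez q; 1] j') (fun q : 'rV[R]_3 =>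
      (i == iz)%:R * nth 0 [:: 2 / ez q; - 2 * ez q; 0] j').
    case: (I3P j') => -> /=.
    - by apply: isD_eq Di _ => p _; field; exact: ez_neq0.
    - by apply: isD_eq De _ => p _; ring.
    - by apply: isD_eq (isD_cst dk 1) _ => p _; rewrite mulr0.
  by apply: isD_eq (isD_mul oT dk (isD_cst dk _) D1) _ => p _; ring.
rewrite (partial_mx oT i (U := setT)) //; first by have [_ ->] := D j l.
by move=> r c; case: (D r c).
Qed.

(* The coordinates are harmonic functions on Sol space. *)
Lemma sol_christoffel_trace q k :
  \sum_i theta i q * christoffel (@sol_metric R) k i i q = 0.
Proof.
have e0 := ez_neq0 q.
pose P (i j l : 'I_3) : R :=
  (j == l)%:R * (i == iz)%:R * nth 0 [:: 2 / ez q; - 2 * ez q; 0] j.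
have E i : christoffel (@sol_metric R) k i i q =
    2^-1 * (theta k q * (P i i k + P i i k - P k i i)).
  rewrite /christoffel (bigD1 k)//= big1 ?addr0 => [|l lk].
    rewrite invmx_sol_metric eqxx mul1r.
    by congr (_ * (_ * (_ + _ - _))); exact: partial_sol_metric.
  by rewrite invmx_sol_metric eq_sym (negbTE lk) !mul0r.
under eq_bigr do rewrite E.
rewrite sum3 /P /theta; move: (ez q) e0 => e e0.
by case: (I3P k) => ->; rewrite !i3E /=; field.
Qed.

Lemma sol_trace m q (A : 'I_3 -> 'I_3 -> 'rV[R]_m) a :
  trace (@sol_metric R) q A 0 a = \sum_i theta i q * A i i 0 a.
Proof.
rewrite /trace summxE; apply: eq_bigr => i _.
rewrite (bigD1 i)// big1 => [|j /andP[_ ji]].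
  by rewrite /= addr0 mxE invmx_sol_metric eqxx mul1r.
by rewrite invmx_sol_metric eq_sym (negbTE ji) mul0r scale0r.
Qed.

(** Harmonicity of the coordinates removes the first order terms from the traces in the tension and
    the bitension. *)
Lemma sol_trace_hessian m q (A : 'I_3 -> 'I_3 -> 'rV[R]_m) (B : 'I_3 -> 'rV[R]_m) a :
  trace (@sol_metric R) q (fun i j =>
    A i j - \sum_k christoffel (@sol_metric R) k i j q *: B k) 0 a =
  \sum_i theta i q * A i i 0 a.
Proof.
rewrite sol_trace.
transitivity (\sum_i (theta i q * A i i 0 a - \sum_k
    theta i q * christoffel (@sol_metric R) k i i q * B k 0 a)).
  apply: eq_bigr => i _; rewrite mxE mxE summxE mulrBr mulr_sumr; congr (_ - _).
  by apply: eq_bigr => k _; rewrite mxE mulrA.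
rewrite sumrB exchange_big [X in _ - X]big1 ?subr0// => k _ /=.
by rewrite -mulr_suml sol_christoffel_trace mul0r.
Qed.

End SolMetric.

Section Coordinates.
Context {R : realType}.
Variables (U : set 'rV[R]_3) (oU : open U) (Om : set 'rV[R]_2) (oOm : open Om).
Variables (h : 'rV[R]_2 -> 'M[R]_2) (f : 'rV[R]_3 -> 'rV[R]_2).
Hypotheses (mh : is_metric_on Om h) (fU : forall q, U q -> Om (f q)).
Hypothesis sf : forall b, sm U (fun q => f q 0 b).

Definition map_pd (i : 'I_3) (b : 'I_2) : 'rV[R]_3 -> R := pd i (fun q => f q 0 b).

Definition tau_map (b : 'I_2) (q : 'rV[R]_3) : R :=
  \sum_i theta i q * covd h f i (map_pd i) b q.

Lemma sm_map_pd i b : sm U (map_pd i b). Proof. exact: sm_pd. Qed.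

Lemma sm_theta i : sm U (theta i).
Proof.
have e0 q : U q -> ez q != 0 by move=> _; exact: ez_neq0.
have se : sm U (@ez R) by case: (pd_ez iz oU).
case: (I3P i) => ->; [exact: se | exact: (sm_inv oU e0 se) | exact: sm_cst].
Qed.

Lemma sm_tau_map b : sm U (tau_map b).
Proof.
apply: sm_sum => // i; apply: sm_mul => //; first exact: sm_theta.
by apply: (sm_covd oU oOm mh fU sf) => c; exact: sm_map_pd.
Qed.

Lemma partial_map i q b : U q -> partial i f q 0 b = map_pd i b q.
Proof.
move=> Uq; have sM r c : sm U (fun q => f q r c) by rewrite ord1.
exact: (partial_mx oU i 0 b sM Uq).
Qed.

Lemma nabla_covd i (X : 'rV[R]_3 -> 'rV[R]_2) (Y : 'I_2 -> 'rV[R]_3 -> R) q a :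
  (forall p b, U p -> X p 0 b = Y b p) -> (forall b, sm U (Y b)) -> U q ->
  nabla h f i X q 0 a = covd h f i Y a q.
Proof.
move=> XY sY Uq; rewrite /nabla mxE mxE /covd; congr (_ + _).
  have sX r c : sm U (fun q => X q r c).
    by rewrite ord1; apply: (sm_eqon oU _ (sY c)) => p Up; rewrite XY.
  rewrite (partial_mx oU i 0 a sX Uq); apply: (pd_eqon oU) => // p Up.
  exact: XY.
apply: eq_bigr => b _; apply: eq_bigr => c _; congr (_ * _ * _); last exact: XY.
exact: partial_map.
Qed.

Lemma tension_tau q a : U q -> tension (@sol_metric R) h f q 0 a = tau_map a q.
Proof.
move=> Uq; rewrite /tension sol_trace_hessian; apply: eq_bigr => i _.
congr (_ * _); apply: nabla_covd => // [p b Up|b]; [exact: partial_map | exact: sm_map_pd].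
Qed.

Lemma bitension_covd q a : U q -> bitension (@sol_metric R) h f q 0 a =
  \sum_i theta i q * covd h f i (covd h f i tau_map) a q -
  \sum_i theta i q * curvature h (f q) (\row_b map_pd i b q) (\row_b tau_map b q)
    (\row_b map_pd i b q) 0 a.
Proof.
move=> Uq; have rowf i : partial i f q = \row_b map_pd i b q.
  by apply/rowP => b; rewrite mxE; exact: partial_map.
have rowt : tension (@sol_metric R) h f q = \row_b tau_map b q.
  by apply/rowP => b; rewrite mxE; exact: tension_tau.
rewrite /bitension mxE [X in _ + X]mxE sol_trace_hessian sol_trace; congr (_ - _).
  apply: eq_bigr => i _; congr (_ * _); apply: nabla_covd => // [p b Up|b].
    by apply: nabla_covd => // [p' b' Up'|b']; [exact: tension_tau | exact: sm_tau_map].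
  by apply: (sm_covd oU oOm mh fU sf) => c; exact: sm_tau_map.
by apply: eq_bigr => i _; rewrite rowf rowt.
Qed.

End Coordinates.

(** * Riemannian submersions in a chart *)

Section Differential.
Context {R : realType} {n : nat}.
Variables (U : set 'rV[R]_n) (oU : open U) (f : 'rV[R]_n -> 'rV[R]_2).
Hypothesis sf : forall b, sm U (fun q => f q 0 b).

Lemma diff_map q v a : U q ->
  ('d f q : 'rV[R]_n -> 'rV[R]_2) v 0 a = \sum_k v 0 k * pd k (fun q => f q 0 a) q.
Proof.
move=> Uq; have df b : differentiable (fun q => f q 0 b) q by exact: (sm_diff oU (sf b) Uq).
have fE : f = (fun q => f q 0 0 *: (delta_mx 0 0 : 'rV[R]_2)) +
              (fun q => f q 0 1 *: (delta_mx 0 1 : 'rV[R]_2)).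
  apply/funext => p; apply/rowP => b; rewrite !mxE; case: (I2P b) => ->;
  by rewrite ?eqxx /= ?mulr1 ?mulr0 ?addr0 ?add0r.
have dF : differentiable f q.
  by rewrite fE; apply: differentiableD; apply: differentiableZl.
rewrite -(deriveE _ dF) derive_mx; last exact: diff_derivable.
have [dfa E] := @c1_differentiable R n (fun q => f q 0 a) U q oU Uq
  (fun p i Up => sm_derivable (sf a) Up) (fun i => sm_cont (sm_partial i (sf a)) Uq).
rewrite mxE (deriveE _ dfa) E /lin_form.
by apply: eq_bigr => k _; rewrite pdE.
Qed.

End Differential.

Lemma grad_formE {R : realType} (f g : 'rV[R]_3 -> R) q :
  grad_form f g q = \sum_i theta i q * (pd i f q * pd i g q).
Proof. by rewrite sum3 /grad_form /theta /= mul1r. Qed.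

Section Submersion.
Context {R : realType}.
Variables (U : set 'rV[R]_3) (oU : open U) (f : 'rV[R]_3 -> 'rV[R]_2) (H : 'M[R]_2).
Hypothesis sf : forall b, sm U (fun q => f q 0 b).
Variables (q : 'rV[R]_3) (Uq : U q).
Let df := ('d f q : 'rV[R]_3 -> 'rV[R]_2).
Let horizontal v := forall w, df w = 0 -> inner (sol_metric q) v w = 0.
Hypothesis surj : forall u, exists v, df v = u.
Hypothesis iso : forall v w, horizontal v -> horizontal w ->
  inner H (df v) (df w) = inner (sol_metric q) v w.
Let f0 (q : 'rV[R]_3) : R := f q 0 0.
Let f1 (q : 'rV[R]_3) : R := f q 0 1.

(** By Cauchy-Binet for the differential and preimages of the two basis vectors, the determinant [1]
    is a combination of the three minors, which therefore cannot all vanish. *)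
Lemma submersion_minor :
  minor f0 f1 ix iy q = 0 -> minor f0 f1 ix iz q = 0 -> minor f0 f1 iy iz q != 0.
Proof.
have [v0 /rowP E0] := surj (\row_b (if b == 0 then 1 else 0)).
have [v1 /rowP E1] := surj (\row_b (if b == 1 then 1 else 0)).
have := E0 0; have := E0 1; have := E1 0; have := E1 1.
rewrite /df !(diff_map oU sf _ _ Uq) !mxE !sum3 -/f0 -/f1 /minor /=.
move: (pd ix f0 q) (pd iy f0 q) (pd iz f0 q) (pd ix f1 q) (pd iy f1 q) (pd iz f1 q).
move: (v0 0 ix) (v0 0 iy) (v0 0 iz) (v1 0 ix) (v1 0 iy) (v1 0 iz).
move=> a b c d e k x y z s t r e11 e10 e01 e00 m1 m2; apply/negP => /eqP m3.
have : (a * x + b * y + c * z) * (d * s + e * t + k * r) -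
    (a * s + b * t + c * r) * (d * x + e * y + k * z) = 1.
  by rewrite e00 e11 e01 e10 mul0r subr0 mulr1.
move=> E; have /eqP := oner_neq0 R; apply; rewrite -E.
transitivity ((x * t - y * s) * (a * e - b * d) + (x * r - z * s) * (a * k - c * d)
   + (y * r - z * t) * (b * k - c * e)); first by ring.
by rewrite m1 m2 m3; ring.
Qed.

Let F : 'M[R]_2 := \matrix_(a, b) grad_form (fun q => f q 0 a) (fun q => f q 0 b) q.

(** The gradients [v a] are horizontal and [df] maps them to the rows of the Gram matrix [F]. The
    isometry condition on them reads [F H F = F], and [F] is invertible. *)
Lemma submersion_cometric : F *m H = 1%:M.
Proof.
pose v a : 'rV[R]_3 := \row_k (theta k q * pd k (fun q => f q 0 a) q).
have innerv a w : inner (sol_metric q) (v a) w = df w 0 a.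
  rewrite /inner mxE /df (diff_map oU sf _ _ Uq); apply: eq_bigr => k _.
  rewrite !mxE (bigD1 k)//= big1 ?addr0 => [|l lk].
    rewrite sol_metricE eqxx mxE mul1r; have := theta_neq0 k q.
    by move: (theta k q) (pd k _ q) (w 0 k) => t x y t0; field.
  by rewrite sol_metricE (negbTE lk) mul0r mulr0.
have dv a b : df (v a) 0 b = F a b.
  rewrite /df (diff_map oU sf _ _ Uq) mxE grad_formE.
  by apply: eq_bigr => k _; rewrite mxE mulrA.
have hv a : horizontal (v a) by move=> w w0; rewrite innerv w0 mxE.
have Fs a b : F a b = F b a.
  by rewrite !mxE !grad_formE; apply: eq_bigr => i _; rewrite [pd i _ q * _]mulrC.
have FHF : F *m H *m F = F.
  apply/matrixP => a b; rewrite [RHS]Fs -dv -innerv -iso// /inner.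
  have dvr c : df (v c) = row c F by apply/rowP => d; rewrite dv [RHS]mxE.
  rewrite !dvr -row_mul mxE [RHS]mxE; apply: eq_bigr => c _.
  by congr (_ * _); [rewrite [RHS]mxE | rewrite [RHS]mxE [RHS]mxE Fs].
have detF : F 0 0 * F 1 1 - F 0 1 * F 1 0 != 0.
  rewrite !mxE -/f0 -/f1.
  (* Lagrange's identity: the Gram determinant is a positively weighted sum of the squares of the
     minors. *)
  have -> : grad_form f0 f0 q * grad_form f1 f1 q - grad_form f0 f1 q * grad_form f1 f0 q =
    minor f0 f1 ix iy q ^+ 2 + ez q * minor f0 f1 ix iz q ^+ 2
    + (ez q)^-1 * minor f0 f1 iy iz q ^+ 2.
    by rewrite /grad_form /minor; move: (ez q) (ez_neq0 q) => e e0; field.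
  have e0 : 0 < ez q by exact: expR_gt0.
  have p1 := sqr_ge0 (minor f0 f1 ix iy q).
  have p2 : 0 <= ez q * minor f0 f1 ix iz q ^+ 2 by rewrite mulr_ge0 ?sqr_ge0 ?ltW.
  have p3 : 0 <= (ez q)^-1 * minor f0 f1 iy iz q ^+ 2.
    by rewrite mulr_ge0 ?sqr_ge0// invr_ge0 ltW.
  rewrite paddr_eq0 ?addr_ge0// paddr_eq0// !mulf_eq0 invr_eq0 (gt_eqF e0) /= !orbb.
  apply/negP => /andP[/andP[/eqP m1 /eqP m2]]; apply/negP; exact: submersion_minor.
have [uF _] := inv2 detF.
by apply: (can_inj (mulmxK uF)); rewrite FHF mul1mx.
Qed.

End Submersion.

(** * The bitension in an orthonormal frame *)

Section Computation.
Context {R : realType}.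

(* With [(u, v, w)] the frame coordinates of the vertical Killing field and
   [n] its squared norm, the numerators over [n ^+ 2] of the inner products of
   [nabla_l (df E_i)] with [df E_j]. *)
Definition sol_gamma (u v w : R) (l i j : 'I_3) : R := nth 0 (nth [::] (nth [::] [::
   [:: [:: u * v ^+ 2 * w + u * w ^+ 3;
       - (2 * (u ^+ 2 * v * w)) + v ^+ 3 * w + v * w ^+ 3;
       u ^+ 2 * v ^+ 2 - u ^+ 2 * w ^+ 2 - v ^+ 4 - v ^+ 2 * w ^+ 2];
       [:: u ^+ 2 * v * w;
           - (u * v ^+ 2 * w);
           - (u ^+ 3 * v) + u * v ^+ 3];
       [:: - (u ^+ 2 * v ^+ 2) + v ^+ 4 + 2 * (v ^+ 2 * w ^+ 2) + w ^+ 4;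
           u ^+ 3 * v - u * v ^+ 3 - 2 * (u * v * w ^+ 2);
           - (u * w ^+ 3)]];
   [:: [:: u ^+ 2 * v * w;
       - (u * v ^+ 2 * w);
       - (u ^+ 3 * v) + u * v ^+ 3];
       [:: - (u ^+ 3 * w) + 2 * (u * v ^+ 2 * w) - u * w ^+ 3;
           - (u ^+ 2 * v * w) - v * w ^+ 3;
           u ^+ 4 - u ^+ 2 * v ^+ 2 + u ^+ 2 * w ^+ 2 + v ^+ 2 * w ^+ 2];
       [:: u ^+ 3 * v - u * v ^+ 3 + 2 * (u * v * w ^+ 2);
           - (u ^+ 4) + u ^+ 2 * v ^+ 2 - 2 * (u ^+ 2 * w ^+ 2) - w ^+ 4;
           v * w ^+ 3]];
   [:: [:: - (2 * (u ^+ 2 * v ^+ 2)) - u ^+ 2 * w ^+ 2;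
       2 * (u ^+ 3 * v) - u * v * w ^+ 2;
       u ^+ 3 * w + u * v ^+ 2 * w];
       [:: - (2 * (u * v ^+ 3)) + u * v * w ^+ 2;
           2 * (u ^+ 2 * v ^+ 2) + v ^+ 2 * w ^+ 2;
           - (u ^+ 2 * v * w) - v ^+ 3 * w];
       [:: - (4 * (u * v ^+ 2 * w)) - u * w ^+ 3;
           4 * (u ^+ 2 * v * w) + v * w ^+ 3;
           u ^+ 2 * w ^+ 2 - v ^+ 2 * w ^+ 2]]] l) i) j.

(* The numerators over [n ^+ 3] of the inner products of [nabla_i tau] with [df E_j]. *)
Definition sol_hess (u v w : R) (i j : 'I_3) : R := nth 0 (nth [::] [::
   [:: - (u ^+ 4 * v ^+ 2) + 2 * (u ^+ 2 * v ^+ 4) + 3 * (u ^+ 2 * v ^+ 2 * w ^+ 2)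
         + u ^+ 2 * w ^+ 4 - v ^+ 6 - v ^+ 4 * w ^+ 2 + v ^+ 2 * w ^+ 4 + w ^+ 6;
       u ^+ 5 * v - 2 * (u ^+ 3 * v ^+ 3) + 3 * (u ^+ 3 * v * w ^+ 2) + u * v ^+ 5
         + 3 * (u * v ^+ 3 * w ^+ 2) + 2 * (u * v * w ^+ 4);
       - (6 * (u ^+ 3 * v ^+ 2 * w)) - u ^+ 3 * w ^+ 3 - 2 * (u * v ^+ 4 * w)
         - 3 * (u * v ^+ 2 * w ^+ 3) - u * w ^+ 5];
   [:: u ^+ 5 * v - 2 * (u ^+ 3 * v ^+ 3) + 3 * (u ^+ 3 * v * w ^+ 2) + u * v ^+ 5
         + 3 * (u * v ^+ 3 * w ^+ 2) + 2 * (u * v * w ^+ 4);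
       - (u ^+ 6) + 2 * (u ^+ 4 * v ^+ 2) - u ^+ 4 * w ^+ 2 - u ^+ 2 * v ^+ 4
         + 3 * (u ^+ 2 * v ^+ 2 * w ^+ 2) + u ^+ 2 * w ^+ 4 + v ^+ 2 * w ^+ 4 + w ^+ 6;
       - (2 * (u ^+ 4 * v * w)) - 6 * (u ^+ 2 * v ^+ 3 * w) - 3 * (u ^+ 2 * v * w ^+ 3)
         - v ^+ 3 * w ^+ 3 - v * w ^+ 5];
   [:: - (6 * (u ^+ 3 * v ^+ 2 * w)) - u ^+ 3 * w ^+ 3 - 2 * (u * v ^+ 4 * w)
         - 3 * (u * v ^+ 2 * w ^+ 3) - u * w ^+ 5;
       - (2 * (u ^+ 4 * v * w)) - 6 * (u ^+ 2 * v ^+ 3 * w) - 3 * (u ^+ 2 * v * w ^+ 3)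
         - v ^+ 3 * w ^+ 3 - v * w ^+ 5;
       8 * (u ^+ 4 * v ^+ 2) + u ^+ 4 * w ^+ 2 + 8 * (u ^+ 2 * v ^+ 4)
         + 6 * (u ^+ 2 * v ^+ 2 * w ^+ 2) + u ^+ 2 * w ^+ 4 + v ^+ 4 * w ^+ 2
         + v ^+ 2 * w ^+ 4]] i) j.

(* The numerators over [n] of the inner products of the tension with [df E_j]. *)
Definition sol_tension (u v w : R) (j : 'I_3) : R :=
  nth 0 [:: - (u * w); v * w; u ^+ 2 - v ^+ 2] j.

(* For the frame e^(-z) d/dx, e^z d/dy, d/dz of the Sol metric:
   [E_i, E_z] = - sol_weight i *: E_i. *)
Definition sol_weight (i : 'I_3) : R := nth 0 [:: -1; 1; 0] i.

Ltac der_coef H D F oV dD :=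
  eassert (H : isD _ D F _); [by rewrite /sol_hess /sol_gamma /=; der oV dD |].

Section Frame.
Variables (V : set 'rV[R]_3) (oV : open V).
Variables (E : 'I_3 -> ('rV[R]_3 -> R) -> 'rV[R]_3 -> R) (dE : forall i, derivation V (E i)).
Variables (u v : 'rV[R]_3 -> R) (w : R).
Let n q := u q ^+ 2 + v q ^+ 2 + w ^+ 2.
Let k (i : 'I_3) (q : 'rV[R]_3) := nth 0 [:: u q; v q; w] i.
Hypothesis n0 : forall q, V q -> n q != 0.
Hypothesis Eu : forall i, isD V (E i) u (fun q => nth 0 [:: - w; 0; u q] i).
Hypothesis Ev : forall i, isD V (E i) v (fun q => nth 0 [:: 0; w; - v q] i).

Variables (G : 'I_3 -> 'I_3 -> 'rV[R]_3 -> R) (Ga : 'I_3 -> 'I_3 -> 'I_3 -> 'rV[R]_3 -> R).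
Hypothesis GE : forall i j q, V q -> G i j q = (i == j)%:R - k i q * k j q / n q.
Hypothesis compat : forall l i j q, V q -> E l (G i j) q = Ga l i j q + Ga l j i q.
Hypothesis torsion : forall l i j q, V q -> Ga l i j q - Ga i l j q =
  (l == iz)%:R * sol_weight i * G i j q - (i == iz)%:R * sol_weight l * G l j q.

Let isD_n i : isD V (E i) n (fun q => 2 * (u q * nth 0 [:: - w; 0; u q] i
   + v q * nth 0 [:: 0; w; - v q] i)).
Proof.
have du := Eu i; have dv := Ev i; have di := dE i.
eassert (H : isD V (E i) (fun q => u q ^+ 2 + v q ^+ 2 + w ^+ 2) _) by der oV di.
by apply: isD_eq H _ => q _; ring.
Qed.

(* Koszul's formula, in the frame [E] whose brackets are given by [sol_weight]. *)
Lemma frame_christoffel l i j q : V q -> Ga l i j q = sol_gamma (u q) (v q) w l i j / n q ^+ 2.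
Proof.
have EG a b c : isD V (E a) (fun q => (b == c)%:R - k b q * k c q * (n q)^-1) (fun q =>
   - ((k b q * nth 0 [:: nth 0 [:: - w; 0; u q] a; nth 0 [:: 0; w; - v q] a; 0] c +
       k c q * nth 0 [:: nth 0 [:: - w; 0; u q] a; nth 0 [:: 0; w; - v q] a; 0] b) / n q
     - k b q * k c q * (2 * (u q * nth 0 [:: - w; 0; u q] a
   + v q * nth 0 [:: 0; w; - v q] a)) / n q ^+ 2)).
  have Ek d : isD V (E a) (k d) (fun q =>
     nth 0 [:: nth 0 [:: - w; 0; u q] a; nth 0 [:: 0; w; - v q] a; 0] d).
    case: (I3P d) => ->; [exact: Eu | exact: Ev | exact: isD_cst].
  have dn := isD_n a; have db := Ek b; have dc := Ek c; have da := dE a.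
  eassert (H : isD V (E a) (fun q => (b == c)%:R - k b q * k c q * (n q)^-1) _).
    by der oV da; exact: n0.
  by apply: isD_eq H _ => p Vp; have := n0 Vp; move: (n p) => m m0; field.
move=> Vq.
have EGq a b c := etrans (der_eqon (dE a) (@GE b c) Vq) ((EG a b c).2 _ Vq).
have := compat l i j Vq; have := compat i l j Vq; have := compat j l i Vq.
have := torsion l i j Vq; have := torsion i j l Vq; have := torsion l j i Vq.
rewrite !EGq !GE// => t3 t2 t1 e3 e2 e1.
have := n0 Vq.
suff : 2 * Ga l i j q = 2 * (sol_gamma (u q) (v q) w l i j / n q ^+ 2).
  by move=> H _; have : (2 : R) != 0 by []; move=> /mulfI; apply.
have -> : 2 * Ga l i j q = (Ga l i j q + Ga l j i q) + (Ga i l j q + Ga i j l q)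
  - (Ga j l i q + Ga j i l q) + (Ga l i j q - Ga i l j q) - (Ga i j l q - Ga j i l q)
  - (Ga l j i q - Ga j l i q) by ring.
rewrite t1 t2 t3 -e1 -e2 -e3 /n /k; move: (n0 Vq); rewrite /n.
move: (u q) (v q) w => a b c.
by case: (I3P l) => ->; case: (I3P i) => ->; case: (I3P j) => ->;
  rewrite /sol_gamma /sol_weight /= => d0; field.
Qed.

Variable tau : 'I_3 -> 'rV[R]_3 -> R.
Hypothesis tauE : forall j q, V q -> tau j q = \sum_i Ga i i j q.
Variable T : 'I_3 -> 'I_3 -> 'rV[R]_3 -> R.
Hypothesis TE : forall i j q, V q ->
  T i j q = E i (tau j) q - \sum_l tau l q * Ga i j l q.

Lemma frame_tension j q : V q -> tau j q = sol_tension (u q) (v q) w j / n q.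
Proof.
move=> Vq; rewrite tauE// sum3 !frame_christoffel//; move: (n0 Vq); rewrite /n.
move: (u q) (v q) w => a b c.
by case: (I3P j) => ->; rewrite /sol_gamma /sol_tension /= => d0; field.
Qed.

(** [TE] is the product rule for [<tau, df E_j>], with [tau] expanded in the vectors [df E_l]; such
    an expansion holds although they are dependent. *)
Lemma frame_hessian i j q : V q -> T i j q = sol_hess (u q) (v q) w i j / n q ^+ 3.
Proof.
move=> Vq; rewrite TE// sum3 !frame_tension// !frame_christoffel//.
rewrite (der_eqon (dE i) (@frame_tension j) Vq).
have du := Eu i; have dv := Ev i; have dn := isD_n i; have di := dE i.
have : isD V (E i) (fun p => sol_tension (u p) (v p) w j * (n p)^-1) (fun p =>
   nth 0 [:: - (nth 0 [:: - w; 0; u p] i * w); nth 0 [:: 0; w; - v p] i * w;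
     2 * (u p * nth 0 [:: - w; 0; u p] i - v p * nth 0 [:: 0; w; - v p] i)] j / n p
   - sol_tension (u p) (v p) w j * (2 * (u p * nth 0 [:: - w; 0; u p] i
   + v p * nth 0 [:: 0; w; - v p] i)) / n p ^+ 2).
  rewrite /sol_tension; case: (I3P j) => -> /=.
  - eassert (H : isD V (E i) (fun p => - (u p * w) * (n p)^-1) _) by (der oV di; exact: n0).
    by apply: isD_eq H _ => p Vp; have := n0 Vp; move: (n p) => m m0; field.
  - eassert (H : isD V (E i) (fun p => (v p * w) * (n p)^-1) _) by (der oV di; exact: n0).
    by apply: isD_eq H _ => p Vp; have := n0 Vp; move: (n p) => m m0; field.
  - eassert (H : isD V (E i) (fun p => (u p ^+ 2 - v p ^+ 2) * (n p)^-1) _) by (der oV di; exact: n0).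
    by apply: isD_eq H _ => p Vp; have := n0 Vp; move: (n p) => m m0; field.
move=> [_ -> //]; move: (n0 Vq); rewrite /n.
move: (u q) (v q) w => a b c.
by case: (I3P i) => ->; case: (I3P j) => ->;
  rewrite /sol_gamma /sol_tension /sol_hess /= => d0; field.
Qed.

Let isD_quot i m (F : 'rV[R]_3 -> R) g : isD V (E i) F g ->
  isD V (E i) (fun p => F p / n p ^+ m) (fun p => g p / n p ^+ m -
    m%:R * F p * (2 * (u p * nth 0 [:: - w; 0; u p] i + v p * nth 0 [:: 0; w; - v p] i))
     / n p ^+ m.+1).
Proof.
move=> dF; have dn := isD_n i; have di := dE i.
apply: (@isD_eqon _ _ _ oV _ di (fun p => F p * ((n p)^-1) ^+ m)).
  by move=> p _; rewrite exprVn.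
eassert (H : isD V (E i) (fun p => F p * ((n p)^-1) ^+ m) _) by (der oV di; exact: n0).
apply: isD_eq H _ => p Vp; have := n0 Vp; move: (n p) => d d0.
case: m => [|m]; first by rewrite /= mul0r !mul0r !mulr0 expr0 invr1; ring.
rewrite /= !exprVn [d ^+ m.+2]exprS [d ^+ m.+1]exprS.
have dm : d ^+ m != 0 by rewrite expf_neq0.
by move: (m.+1%:R : R) (d ^+ m) dm => x y y0; field; rewrite y0.
Qed.

(** The inner product of [R (df E_i, df E_l) df E_i] with [df E_z]. The products of [Ga] come from
    expanding in the [df E_r], the last line from the bracket [[E_i, E_l]]. *)
Let Rm i l q := E i (Ga l i iz) q - E l (Ga i i iz) q
  - \sum_r Ga l i r q * Ga i iz r q + \sum_r Ga i i r q * Ga l iz r q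
  - ((i == iz)%:R * sol_weight l * Ga l i iz q - (l == iz)%:R * sol_weight i * Ga i i iz q).

(** The left side is the component of the bitension along [df E_z]. The fields [nabla_(E_i) E_i] of
    Sol add up to zero, so the rough Laplacian is the plain sum of second derivatives along the
    frame. *)
Lemma frame_bitension q : V q ->
  \sum_i (E i (T i iz) q - \sum_l T i l q * Ga i iz l q)
    - \sum_i \sum_l tau l q * Rm i l q =
  - ((u q ^+ 2 - v q ^+ 2) * (16 * u q ^+ 2 * v q ^+ 2 + 3 * n q ^+ 2
       - n q * (u q ^+ 2 + v q ^+ 2))) / n q ^+ 3.
Proof.
move=> Vq.
have dGa i l m g : isD V (E i) (fun p => sol_gamma (u p) (v p) w l m iz) g ->
  E i (Ga l m iz) q = g q / n q ^+ 2 - 2 * sol_gamma (u q) (v q) w l m iz *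
    (2 * (u q * nth 0 [:: - w; 0; u q] i + v q * nth 0 [:: 0; w; - v q] i)) / n q ^+ 3.
  move=> /(isD_quot 2)[_ <-//]; apply: (der_eqon (dE i)) => // p Vp.
  exact: frame_christoffel.
have dT i g : isD V (E i) (fun p => sol_hess (u p) (v p) w i iz) g ->
  E i (T i iz) q = g q / n q ^+ 3 - 3 * sol_hess (u q) (v q) w i iz *
    (2 * (u q * nth 0 [:: - w; 0; u q] i + v q * nth 0 [:: 0; w; - v q] i)) / n q ^+ 4.
  move=> /(isD_quot 3)[_ <-//]; apply: (der_eqon (dE i)) => // p Vp.
  exact: frame_hessian.
have dux := Eu ix; have duy := Eu iy; have duz := Eu iz.
have dvx := Ev ix; have dvy := Ev iy; have dvz := Ev iz.
have dx := dE ix; have dy := dE iy; have dz := dE iz.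
der_coef Tx (E ix) (fun p => sol_hess (u p) (v p) w ix iz) oV dx; move/dT: Tx => Tx.
der_coef Ty (E iy) (fun p => sol_hess (u p) (v p) w iy iz) oV dy; move/dT: Ty => Ty.
der_coef Tz (E iz) (fun p => sol_hess (u p) (v p) w iz iz) oV dz; move/dT: Tz => Tz.
der_coef Gxy (E ix) (fun p => sol_gamma (u p) (v p) w iy ix iz) oV dx; move/dGa: Gxy => Gxy.
der_coef Gxz (E ix) (fun p => sol_gamma (u p) (v p) w iz ix iz) oV dx; move/dGa: Gxz => Gxz.
der_coef Gyx (E iy) (fun p => sol_gamma (u p) (v p) w ix iy iz) oV dy; move/dGa: Gyx => Gyx.
der_coef Gyz (E iy) (fun p => sol_gamma (u p) (v p) w iz iy iz) oV dy; move/dGa: Gyz => Gyz.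
der_coef Gzx (E iz) (fun p => sol_gamma (u p) (v p) w ix iz iz) oV dz; move/dGa: Gzx => Gzx.
der_coef Gzy (E iz) (fun p => sol_gamma (u p) (v p) w iy iz iz) oV dz; move/dGa: Gzy => Gzy.
der_coef Gyxx (E iy) (fun p => sol_gamma (u p) (v p) w ix ix iz) oV dy; move/dGa: Gyxx => Gyxx.
der_coef Gzxx (E iz) (fun p => sol_gamma (u p) (v p) w ix ix iz) oV dz; move/dGa: Gzxx => Gzxx.
der_coef Gxyy (E ix) (fun p => sol_gamma (u p) (v p) w iy iy iz) oV dx; move/dGa: Gxyy => Gxyy.
der_coef Gzyy (E iz) (fun p => sol_gamma (u p) (v p) w iy iy iz) oV dz; move/dGa: Gzyy => Gzyy.
der_coef Gxzz (E ix) (fun p => sol_gamma (u p) (v p) w iz iz iz) oV dx; move/dGa: Gxzz => Gxzz.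
der_coef Gyzz (E iy) (fun p => sol_gamma (u p) (v p) w iz iz iz) oV dy; move/dGa: Gyzz => Gyzz.
have Rii i : Rm i i q = 0 by rewrite /Rm; ring.
rewrite !sum3 !Rii /Rm !sum3 Tx Ty Tz Gxy Gxz Gyx Gyz Gzx Gzy Gyxx Gzxx Gxyy Gzyy Gxzz Gyzz.
rewrite !frame_tension// !frame_hessian// !frame_christoffel//.
move: (n0 Vq); rewrite /n.
move: (u q) (v q) w => a b c.
rewrite /sol_gamma /sol_tension /sol_hess /sol_weight !i3E /=.
by move=> d0; field.
Qed.

Lemma frame_not_biharmonic q : V q -> ~ (forall p, V p ->
  \sum_i (E i (T i iz) p - \sum_l T i l p * Ga i iz l p)
    - \sum_i \sum_l tau l p * Rm i l p = 0).
Proof.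
move=> Vq bit.
have uv p : V p -> u p ^+ 2 - v p ^+ 2 = 0.
  move=> Vp; have := bit p Vp; rewrite frame_bitension// => /eqP.
  rewrite mulf_eq0 invr_eq0 expf_eq0 (negbTE (n0 Vp)) orbF oppr_eq0 mulf_eq0.
  (* Since [u^2 + v^2 <= n], the other factor is at least [2 n^2]. *)
  case/orP => /eqP // H; exfalso; move: (n0 Vp); apply/negP; rewrite negbK -sqrf_eq0.
  move: H; rewrite /n; move: (u p) (v p) w => a b c H.
  have a2 := sqr_ge0 a; have b2 := sqr_ge0 b; have c2 := sqr_ge0 c.
  have ab := mulr_ge0 a2 b2; have ac := mulr_ge0 a2 c2; have bc := mulr_ge0 b2 c2.
  have cc := mulr_ge0 c2 c2; have aa := mulr_ge0 a2 a2; have bb := mulr_ge0 b2 b2.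
  rewrite eq_le sqr_ge0 andbT.
  by nra.
have Euv (i : 'I_3) p : V p -> u p * nth 0 [:: - w; 0; u p] i - v p * nth 0 [:: 0; w; - v p] i = 0.
  move=> Vp; have du := Eu i; have dv := Ev i; have di := dE i.
  eassert (H : isD V (E i) (fun q => u q ^+ 2 - v q ^+ 2) _) by der oV di.
  have := H.2 _ Vp; rewrite (der_eqon di uv Vp) (der_cst di 0 Vp) /= => E0.
  by have two : (2 : R) != 0 by []; apply: (mulfI two); rewrite mulr0 [RHS]E0; ring.
have u0 p : V p -> u p = 0.
  move=> Vp; have /= E0 := Euv iz _ Vp; apply/eqP; rewrite -sqrf_eq0 eq_le sqr_ge0 andbT.
  by have := sqr_ge0 (v p); nra.
have v0 p : V p -> v p = 0.
  by move=> Vp; apply/eqP; rewrite -sqrf_eq0 -oppr_eq0 -(uv _ Vp) u0// expr0n sub0r.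
have := (Eu ix).2 _ Vq; rewrite (der_eqon (dE ix) u0 Vq) (der_cst (dE ix) 0 Vq) /= => /esym w0.
have := n0 Vq; rewrite /n u0// v0// -[w]opprK w0 oppr0 expr0n /= !addr0.
by rewrite eqxx.
Qed.
End Frame.
End Computation.

(** [h] is the inverse Gram matrix of [a] and [b] in R^3, so the left side is the matrix of the
    orthogonal projection onto their span, whose complement is the line of [k]. *)
Lemma gram_projection {R : realType} (a b k : 'I_3 -> R) (h00 h01 h10 h11 : R) :
  let aa := \sum_i a i * a i in let ab := \sum_i a i * b i in
  let bb := \sum_i b i * b i in let n := \sum_i k i ^+ 2 in
  aa * h00 + ab * h10 = 1 -> aa * h01 + ab * h11 = 0 ->
  ab * h00 + bb * h10 = 0 -> ab * h01 + bb * h11 = 1 ->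
  \sum_i k i * a i = 0 -> \sum_i k i * b i = 0 -> n != 0 ->
  forall i j, h00 * a i * a j + h01 * a i * b j + (h10 * b i * a j + h11 * b i * b j) =
    (i == j)%:R - k i * k j / n.
Proof.
move=> aa ab bb n e1 e2 e3 e4 ka kb n0.
have d0 : aa * bb - ab * ab != 0.
  apply/negP => /eqP d0; have /eqP := oner_neq0 R; apply.
  transitivity ((aa * bb - ab * ab) * (h00 * h11 - h01 * h10)); last by rewrite d0 mul0r.
  rewrite -[LHS]mulr1 -{1}e1 -e4 -[LHS]subr0 -(mul0r 0) -{1}e2 -e3; ring.
have H00 : h00 = bb / (aa * bb - ab * ab).
  apply: (mulfI d0); transitivity (bb * (aa * h00 + ab * h10) - ab * (ab * h00 + bb * h10)).
    by ring.
  by rewrite e1 e3; field.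
have H01 : h01 = - ab / (aa * bb - ab * ab).
  apply: (mulfI d0); transitivity (bb * (aa * h01 + ab * h11) - ab * (ab * h01 + bb * h11)).
    by ring.
  by rewrite e2 e4; field.
have H10 : h10 = - ab / (aa * bb - ab * ab).
  apply: (mulfI d0); transitivity (aa * (ab * h00 + bb * h10) - ab * (aa * h00 + ab * h10)).
    by ring.
  by rewrite e1 e3; field.
have H11 : h11 = aa / (aa * bb - ab * ab).
  apply: (mulfI d0); transitivity (aa * (ab * h01 + bb * h11) - ab * (aa * h01 + ab * h11)).
    by ring.
  by rewrite e2 e4; field.
pose m (i : 'I_3) := nth 0 [:: a iy * b iz - a iz * b iy; a iz * b ix - a ix * b iz;
  a ix * b iy - a iy * b ix] i.
(* Both [k] and the cross product [m] are orthogonal to [a] and [b]. *)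
have km i j : k i * m j = k j * m i.
  apply/eqP; rewrite -subr_eq0; apply/eqP.
  move: ka kb; rewrite !sum3 => ka kb; rewrite /m.
  have z : forall x y, x * (k ix * b ix + k iy * b iy + k iz * b iz) -
    y * (k ix * a ix + k iy * a iy + k iz * a iz) = 0.
    by move=> x y; rewrite ka kb !mulr0 subr0.
  case: (I3P i) => ->; case: (I3P j) => -> /=; rewrite ?subrr//.
  - by rewrite -[RHS](z (a iz) (b iz)); ring.
  - by rewrite -[RHS](z (- a iy) (- b iy)); ring.
  - by rewrite -[RHS](z (- a iz) (- b iz)); ring.
  - by rewrite -[RHS](z (a ix) (b ix)); ring.
  - by rewrite -[RHS](z (a iy) (b iy)); ring.
  - by rewrite -[RHS](z (- a ix) (- b ix)); ring.
have dE : aa * bb - ab * ab = \sum_i m i ^+ 2.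
  by rewrite /aa /bb /ab !sum3 /m /=; ring.
have km2 i j : k i * k j / n = m i * m j / (aa * bb - ab * ab).
  apply: (mulfI n0); apply: (mulfI d0).
  transitivity (k i * k j * (aa * bb - ab * ab)); first by field.
  transitivity (n * (m i * m j)); last by field.
  rewrite dE /n mulr_sumr mulr_suml; apply: eq_bigr => l _.
  transitivity ((k i * m l) * (k j * m l)); first by ring.
  by rewrite (km i l) (km j l); ring.
move=> i j; rewrite km2 H00 H01 H10 H11 /m.
move: d0; rewrite /aa /bb /ab !sum3.
by case: (I3P i) => ->; case: (I3P j) => -> /= d0; field.
Qed.

Lemma scaled_derivation {R : realType} {n : nat} (U : set 'rV[R]_n) (oU : open U) c D :
  sm U c -> derivation U D -> derivation U (fun F q => c q * D F q).
Proof.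
move=> sc dD; split.
- by move=> F sF; apply: sm_mul => //; exact: (der_sm dD).
- by move=> F G FG q Uq; rewrite (der_eqon dD FG Uq).
- by move=> a q Uq; rewrite (der_cst dD)// mulr0.
- by move=> F G q sF sG Uq; rewrite (der_add dD)// mulrDr.
- by move=> F G q sF sG Uq; rewrite (der_mul dD)//; ring.
Qed.

(** Only trilinearity of the curvature matters later; [K] hides the Christoffel symbols. *)
Lemma curvature_coef {R : realType} m (h : 'rV[R]_m -> 'M[R]_m) u a :
  exists K : 'I_m -> 'I_m -> 'I_m -> R, forall X Y Z, curvature h u X Y Z 0 a =
    \sum_b \sum_c \sum_d X 0 b * Y 0 c * Z 0 d * K b c d.
Proof. by eexists => X Y Z; rewrite mxE. Qed.

(** * The pulled back orthonormal frame *)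

Section PulledBackFrame.
Context {R : realType}.
Variables (V : set 'rV[R]_3) (oV : open V) (Om : set 'rV[R]_2) (oOm : open Om).
Variables (h : 'rV[R]_2 -> 'M[R]_2) (f : 'rV[R]_3 -> 'rV[R]_2).
Hypotheses (mh : is_metric_on Om h) (fV : forall q, V q -> Om (f q)).
Hypothesis sf : forall b, sm V (fun q => f q 0 b).
Hypothesis cometric : forall q a b, V q ->
  \sum_c grad_form (fun q => f q 0 a) (fun q => f q 0 c) q * h (f q) c b = (a == b)%:R.

(* The orthonormal frame is [frame_coef i *: d/dx_i]. *)
Definition frame_coef (i : 'I_3) (q : 'rV[R]_3) : R :=
  nth 0 [:: expR (- q 0 iz); expR (q 0 iz); 1] i.

Let E (i : 'I_3) (F : 'rV[R]_3 -> R) (q : 'rV[R]_3) := frame_coef i q * pd i F q.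
Let N (i : 'I_3) (X : 'I_2 -> 'rV[R]_3 -> R) a (q : 'rV[R]_3) := frame_coef i q * covd h f i X a q.
Let eps (i : 'I_3) a (q : 'rV[R]_3) := frame_coef i q * map_pd f i a q.
Let g := pb_inner h f.
Let tau := tau_map h f.

Lemma frame_coef_sqr i q : frame_coef i q * frame_coef i q = theta i q.
Proof.
rewrite /frame_coef /theta; case: (I3P i) => -> /=; last by rewrite mulr1.
  by rewrite -expRD /ez; congr expR; ring.
by rewrite -expRD /ez -expRN; congr expR; ring.
Qed.

Lemma pd_frame_coef i k : isD V (pd k) (frame_coef i)
  (fun q => (k == iz)%:R * sol_weight i * frame_coef i q).
Proof.
have sz : sm V (fun q : 'rV[R]_3 => q 0 iz) by exact: sm_coord.
have sz' : sm V (fun q : 'rV[R]_3 => - q 0 iz) by exact: sm_opp.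
have dk := pd_derivation k oV.
rewrite /sol_weight /frame_coef; case: (I3P i) => -> /=.
- split; first by exact: (sm_exp oV sz').
  move=> q Vq; rewrite (pd_exp k sz' Vq).
  have Hz : isD V (pd k) (fun q : 'rV[R]_3 => q 0 iz) (fun=> (k == iz)%:R).
    by split=> // p _; exact: pd_coord.
  by have [_ ->//] := isD_opp oV dk Hz; ring.
- split; first by exact: (sm_exp oV sz).
  by move=> q Vq; rewrite (pd_exp k sz Vq) pd_coord; ring.
- by apply: isD_eq (isD_cst dk 1) _ => q _; ring.
Qed.

Let see i : sm V (frame_coef i). Proof. by case: (pd_frame_coef i iz). Qed.
Let weight_iz : sol_weight iz = 0 :> R. Proof. by []. Qed.
Let frame_coef_iz q : frame_coef iz q = 1. Proof. by []. Qed.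

(* The factor [(i == iz)%:R] is nonzero only where [frame_coef i = 1]. *)
Let frame_coef_deriv i l q : V q ->
  frame_coef i q * pd i (frame_coef l) q = (i == iz)%:R * sol_weight l * frame_coef l q.
Proof.
move=> Vq; have [_ ->//] := pd_frame_coef l i.
by case: eqVneq => [->|_]; rewrite ?frame_coef_iz ?mul0r ?mulr0 ?mul1r.
Qed.

Let dE i : derivation V (E i).
Proof. by apply: scaled_derivation => //; exact: pd_derivation. Qed.

Let seps i a : sm V (eps i a).
Proof. by apply: sm_mul => //; exact: sm_map_pd. Qed.

Let sN i X a : (forall a, sm V (X a)) -> sm V (N i X a).
Proof. by move=> sX; apply: sm_mul => //; exact: (sm_covd oV oOm mh fV sf). Qed.

Let stau a : sm V (tau a). Proof. exact: (sm_tau_map oV oOm mh fV sf). Qed.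

Let E_g i X Y q : (forall a, sm V (X a)) -> (forall a, sm V (Y a)) -> V q ->
  E i (g X Y) q = g (N i X) Y q + g X (N i Y) q.
Proof.
move=> sX sY Vq; rewrite /E /g (pb_inner_compat oV oOm mh fV sf)// !pb_innerE /N.
by move: (covd _ _ _ _ _ _) (covd _ _ _ _ _ _) (covd _ _ _ _ _ _) (covd _ _ _ _ _ _)
  => x1 x2 x3 x4; ring.
Qed.

Let g_sym X Y q : V q -> g X Y q = g Y X q.
Proof.
move=> Vq; rewrite /g !pb_innerE (metric_entry_sym mh 1 0 (fV Vq)); ring.
Qed.

Let g_sum (I : finType) (c : I -> R) (X : I -> 'I_2 -> 'rV[R]_3 -> R) Z Y q :
  (forall a, Z a q = \sum_i c i * X i a q) -> g Z Y q = \sum_i c i * g (X i) Y q.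
Proof.
move=> ZX; rewrite /g pb_innerE !ZX !(mulr_sumr, mulr_suml) -!big_split.
by apply: eq_bigr => i _; rewrite pb_innerE /=; ring.
Qed.

Let g_sub X X' Z Y q : (forall a, Z a q = X a q - X' a q) -> g Z Y q = g X Y q - g X' Y q.
Proof. by move=> ZX; rewrite /g !pb_innerE !ZX; ring. Qed.

(** The Parseval property: by [cometric], the sum of the [eps l c * eps l d] is the inverse of the
    target metric, although three vectors of a plane are dependent. *)
Let frame_expansion X a q : V q -> X a q = \sum_l g X (eps l) q * eps l a q.
Proof.
move=> Vq.
have F c d : \sum_l eps l c q * eps l d q = grad_form (fun q => f q 0 c) (fun q => f q 0 d) q.
  rewrite grad_formE; apply: eq_bigr => l _; rewrite -frame_coef_sqr /eps /map_pd.
  by move: (pd l _ q) (pd l _ q) => x y; ring.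
transitivity (\sum_b X b q * (a == b)%:R).
  by rewrite (bigD1 a)//= big1 ?addr0 ?eqxx ?mulr1// => b ba; rewrite eq_sym (negbTE ba) mulr0.
rewrite sum2 -!(cometric a _ Vq) !sum2 -!F /g.
under [RHS]eq_bigr do rewrite pb_innerE (metric_entry_sym mh 1 0 (fV Vq)).
rewrite (metric_entry_sym mh 1 0 (fV Vq)) !sum3.
by move: (eps _ 0 q) (eps _ 0 q) (eps _ 0 q) (eps _ 1 q) (eps _ 1 q) (eps _ 1 q)
  (eps _ a q) (eps _ a q) (eps _ a q) => x1 x2 x3 x4 x5 x6 x7 x8 x9; ring.
Qed.

Let g_expansion X Y q : V q -> g X Y q = \sum_l g X (eps l) q * g (eps l) Y q.
Proof. by move=> Vq; apply: g_sum => a; exact: frame_expansion. Qed.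

Let G i j := g (eps i) (eps j).
Let Ga l i j := g (N l (eps i)) (eps j).
Let tauc j := g tau (eps j).
Let T i j := g (N i tau) (eps j).

Let compat l i j q : V q -> E l (G i j) q = Ga l i j q + Ga l j i q.
Proof.
move=> Vq; rewrite /G E_g//; congr (_ + _); exact: g_sym.
Qed.

Let covd_scale i c (X : 'I_2 -> 'rV[R]_3 -> R) a q : sm V c -> (forall a, sm V (X a)) -> V q ->
  covd h f i (fun a q => c q * X a q) a q = pd i c q * X a q + c q * covd h f i X a q.
Proof. by move=> sc sX Vq; rewrite !covdE (pd_mul i sc (sX a) Vq); ring. Qed.

Let N_eps l i a q : V q ->
  N l (eps i) a q = (l == iz)%:R * sol_weight i * eps i a q
    + frame_coef l q * frame_coef i q * covd h f l (map_pd f i) a q.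
Proof.
move=> Vq; rewrite /N /eps (covd_scale _ _ (see i) _ Vq) => [|b]; last exact: sm_map_pd.
by rewrite mulrDr mulrA frame_coef_deriv// !mulrA.
Qed.

Let NN i l X a q : (forall a, sm V (X a)) -> V q ->
  N i (N l X) a q = (i == iz)%:R * sol_weight l * N l X a q
    + frame_coef i q * frame_coef l q * covd h f i (covd h f l X) a q.
Proof.
move=> sX Vq; rewrite {1}/N (covd_scale _ _ (see l) _ Vq) => [|b].
  by rewrite mulrDr mulrA frame_coef_deriv// !mulrA.
exact: (sm_covd oV oOm mh fV sf).
Qed.

Let torsion l i j q : V q -> Ga l i j q - Ga i l j q =
  (l == iz)%:R * sol_weight i * G i j q - (i == iz)%:R * sol_weight l * G l j q.
Proof.
move=> Vq; have D a : N l (eps i) a q - N i (eps l) a q =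
    (l == iz)%:R * sol_weight i * eps i a q - (i == iz)%:R * sol_weight l * eps l a q.
  by rewrite !N_eps// (covd_sym oV oOm mh fV sf l i a Vq); ring.
rewrite /Ga /G -(g_sub (Z := fun a q => N l (eps i) a q - N i (eps l) a q))// /g !pb_innerE !D.
by ring.
Qed.

Let tauE a q : V q -> tau a q = \sum_i 1 * N i (eps i) a q.
Proof.
move=> Vq; apply: eq_bigr => i _; rewrite N_eps// frame_coef_sqr mul1r.
case: eqVneq => [->|_]; first by rewrite weight_iz mulr0 mul0r add0r.
by rewrite !mul0r add0r.
Qed.

Let taucE j q : V q -> tauc j q = \sum_i Ga i i j q.
Proof.
move=> Vq; apply: (etrans (g_sum (eps j) (fun a => tauE a Vq))).
by apply: eq_bigr => i _; rewrite mul1r.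
Qed.

Let E_component i X j q : (forall a, sm V (X a)) -> V q ->
  E i (g X (eps j)) q - \sum_l g X (eps l) q * Ga i j l q = g (N i X) (eps j) q.
Proof.
move=> sX Vq; rewrite E_g// (g_expansion X (N i (eps j)) Vq).
have -> : \sum_l g X (eps l) q * g (eps l) (N i (eps j)) q =
    \sum_l g X (eps l) q * Ga i j l q.
  by apply: eq_bigr => l _; congr (_ * _); exact: g_sym.
by rewrite addrK.
Qed.

Let Rv i l a q := N i (N l (eps i)) a q - N l (N i (eps i)) a q
  - ((i == iz)%:R * sol_weight l * N l (eps i) a q
     - (l == iz)%:R * sol_weight i * N i (eps i) a q).

Let Rm i l q := E i (Ga l i iz) q - E l (Ga i i iz) q
  - \sum_r Ga l i r q * Ga i iz r q + \sum_r Ga i i r q * Ga l iz r q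
  - ((i == iz)%:R * sol_weight l * Ga l i iz q - (l == iz)%:R * sol_weight i * Ga i i iz q).

Let RmE i l q : V q -> Rm i l q = g (Rv i l) (eps iz) q.
Proof.
move=> Vq; have := @E_component l (N i (eps i)) iz q (fun a => sN i a (seps i)) Vq.
have := @E_component i (N l (eps i)) iz q (fun a => sN l a (seps i)) Vq.
have -> : g (Rv i l) (eps iz) q = g (N i (N l (eps i))) (eps iz) q
    - g (N l (N i (eps i))) (eps iz) q
    - ((i == iz)%:R * sol_weight l * g (N l (eps i)) (eps iz) q
       - (l == iz)%:R * sol_weight i * g (N i (eps i)) (eps iz) q).
  by rewrite /g !pb_innerE /Rv; ring.
by rewrite /Rm /Ga => <- <-; ring.
Qed.

(** Linearity of the curvature in its second argument, as [tau] is the sum of the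
    [tauc l * eps l]. *)
Let sum_Rv i a q : V q -> \sum_l tauc l q * Rv i l a q =
  theta i q * curvature h (f q) (\row_b map_pd f i b q) (\row_b tau b q)
    (\row_b map_pd f i b q) 0 a.
Proof.
move=> Vq; have [K KE] := curvature_coef h (f q) a.
have RvE l : Rv i l a q = frame_coef i q * frame_coef l q * \sum_b \sum_c \sum_d
    map_pd f i b q * map_pd f l c q * eps i d q * K b c d.
  have := covd_commutator oV oOm mh fV sf i l a (fun a => seps i a) Vq.
  rewrite KE => C; rewrite /Rv !NN//.
  transitivity (frame_coef i q * frame_coef l q *
     (covd h f i (covd h f l (eps i)) a q - covd h f l (covd h f i (eps i)) a q)); first by ring.
  rewrite C; congr (_ * _).
  by apply: eq_bigr => b _; apply: eq_bigr => c _; apply: eq_bigr => d _; rewrite !mxE.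
have tE b : tau b q = \sum_l tauc l q * (frame_coef l q * map_pd f l b q) by exact: frame_expansion.
rewrite KE (eq_bigr _ (fun l _ => congr1 (fun x => tauc l q * x) (RvE l))) -frame_coef_sqr.
rewrite sum3 !sum2 !mxE !tE !sum3 /eps.
move: (map_pd _ _ _ _) (map_pd _ _ _ _) (map_pd _ _ _ _) (map_pd _ _ _ _)
  => y1 y2 y3 y4.
move: (tauc _ q) (tauc _ q) (tauc _ q) (frame_coef _ q) (frame_coef _ q) (frame_coef _ q) => x1 x2 x3 x4 x5 x6.
ring.
Qed.

Let bitension_component q : V q -> (forall a, bitension (@sol_metric R) h f q 0 a = 0) ->
  \sum_i (E i (T i iz) q - \sum_l T i l q * Ga i iz l q)
    - \sum_i \sum_l tauc l q * Rm i l q = 0.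
Proof.
move=> Vq bit.
(* The coefficients [tauc l q] are frozen at [q]: [g] is evaluated at [q] only, and [g_sum] takes
   numbers as coefficients. *)
pose W i a (p : 'rV[R]_3) := N i (N i tau) a p - \sum_l tauc l q * Rv i l a p.
pose Z a (p : 'rV[R]_3) := \sum_i 1 * W i a p.
have Z0 a : Z a q = 0.
  rewrite -(bit a) (bitension_covd oV oOm mh fV sf)// -sumrB; apply: eq_bigr => i _.
  rewrite mul1r /W sum_Rv// NN// frame_coef_sqr; congr (_ - _).
  case: eqVneq => [->|_]; first by rewrite weight_iz mulr0 mul0r add0r.
  by rewrite !mul0r add0r.
transitivity (g Z (eps iz) q); last by rewrite /g pb_innerE !Z0 !(mulr0, mul0r, addr0).
rewrite (@g_sum _ (fun=> 1) W Z (eps iz) q) // -sumrB; apply: eq_bigr => i _.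
pose S a (p : 'rV[R]_3) := \sum_l tauc l q * Rv i l a p.
rewrite mul1r (@g_sub (N i (N i tau)) S (W i) (eps iz) q)//.
rewrite (@E_component i (N i tau) iz q (fun a => sN i a stau) Vq); congr (_ - _).
rewrite (@g_sum _ (fun l => tauc l q) (Rv i) S (eps iz) q)//.
by apply: eq_bigr => l _; rewrite RmE.
Qed.

Lemma killing_not_biharmonic (xi1 xi2 : 'rV[R]_3 -> R) (w : R) q0 : V q0 ->
  sm V xi1 -> sm V xi2 ->
  (forall q k, V q -> pd k xi1 q = - (w * (k == ix)%:R)) ->
  (forall q k, V q -> pd k xi2 q = w * (k == iy)%:R) ->
  (forall q b, V q -> xi1 q * map_pd f ix b q + xi2 q * map_pd f iy b q + w * map_pd f iz b q = 0) ->
  (forall q, V q -> [|| xi1 q != 0, xi2 q != 0 | w != 0]) ->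
  ~ (forall q a, V q -> bitension (@sol_metric R) h f q 0 a = 0).
Proof.
move=> Vq0 s1 s2 d1 d2 ker nz bit.
(* Frame coordinates of the Killing field. The indices cross because [frame_coef iy = e^z] is the
   inverse of [frame_coef ix]. *)
pose u (q : 'rV[R]_3) := xi1 q * frame_coef iy q; pose v (q : 'rV[R]_3) := xi2 q * frame_coef ix q.
have eexy q : frame_coef ix q * frame_coef iy q = 1.
  by rewrite /frame_coef /= -expRD addNr expR0.
have ee0 i q : frame_coef i q != 0.
  by rewrite /frame_coef; case: (I3P i) => -> /=; rewrite ?oner_eq0// gt_eqF// expR_gt0.
have n0 q : V q -> u q ^+ 2 + v q ^+ 2 + w ^+ 2 != 0.
  move=> Vq; rewrite !paddr_eq0 ?addr_ge0 ?sqr_ge0// !sqrf_eq0 !mulf_eq0.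
  by rewrite !(negbTE (ee0 _ _)) !orbF !negb_and -orbA nz.
have Du k : isD V (pd k) xi1 (fun=> - (w * (k == ix)%:R)) by split=> // q Vq; exact: d1.
have Dv k : isD V (pd k) xi2 (fun=> w * (k == iy)%:R) by split=> // q Vq; exact: d2.
have toE i F F' : isD V (pd i) F F' -> isD V (E i) F (fun q => frame_coef i q * F' q).
  by move=> [sF HF]; split=> // q Vq; rewrite /E HF.
have Eu i : isD V (E i) u (fun q => nth 0 [:: - w; 0; u q] i).
  have H := toE i _ _ (isD_mul oV (pd_derivation i oV) (Du i) (pd_frame_coef iy i)).
  apply: isD_eq H _ => q Vq; have := eexy q.
  by rewrite /u; case: (I3P i) => -> /=; rewrite ?i3E ?frame_coef_iz /sol_weight /= => E1;
    ring: E1.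
have Ev i : isD V (E i) v (fun q => nth 0 [:: 0; w; - v q] i).
  have H := toE i _ _ (isD_mul oV (pd_derivation i oV) (Dv i) (pd_frame_coef ix i)).
  apply: isD_eq H _ => q Vq; have := eexy q.
  by rewrite /v; case: (I3P i) => -> /=; rewrite ?i3E ?frame_coef_iz /sol_weight /= => E1; ring: E1.
apply: (@frame_not_biharmonic R V oV E dE u v w n0 Eu Ev G Ga _ compat torsion tauc taucE T _ q0 Vq0).
- move=> i j q Vq.
  pose k (i : 'I_3) := nth 0 [:: u q; v q; w] i.
  have nE : \sum_i k i ^+ 2 = u q ^+ 2 + v q ^+ 2 + w ^+ 2 by rewrite sum3.
  have F c d : \sum_l eps l c q * eps l d q =
      grad_form (fun q => f q 0 c) (fun q => f q 0 d) q.
    rewrite grad_formE; apply: eq_bigr => l _; rewrite -frame_coef_sqr /eps /map_pd.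
    by move: (pd l _ q) (pd l _ q) => x y; ring.
  have kerb b : \sum_i k i * eps i b q = 0.
    rewrite -[RHS](ker q b Vq) sum3 /k /eps /u /v /= frame_coef_iz; have := eexy q.
    by move: (map_pd f ix b q) (map_pd f iy b q) (map_pd f iz b q) => y1 y2 y3 E1; ring: E1.
  rewrite /G /g pb_innerE -nE;
  apply: (@gram_projection R (fun i => eps i 0 q) (fun i => eps i 1 q) k) => /=.
  + by have := cometric 0 0 Vq; rewrite sum2 -!F.
  + by have := cometric 0 1 Vq; rewrite sum2 -!F.
  + have := cometric 1 0 Vq; rewrite sum2 -!F.
    by under eq_bigr do rewrite mulrC.
  + by have := cometric 1 1 Vq; rewrite sum2 -!F; under eq_bigr do rewrite mulrC.
  + exact: kerb.
  + exact: kerb.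
  + by rewrite nE n0.
- by move=> i j q Vq; rewrite E_component.
- by move=> q Vq; apply: bitension_component => // a; exact: bit.
Qed.

End PulledBackFrame.

(** * Conclusion *)

(** The cometric is [h^-1] composed with [f], so the chain rule gives the two coefficients as
    partial derivatives of an entry of [h^-1]. *)
Lemma cometric_basic {R : realType} (U : set 'rV[R]_3) (oU : open U) (Om : set 'rV[R]_2)
    (oOm : open Om) (h : 'rV[R]_2 -> 'M[R]_2) (f : 'rV[R]_3 -> 'rV[R]_2) a b :
  is_metric_on Om h -> (forall q, U q -> Om (f q)) -> (forall b, sm U (fun q => f q 0 b)) ->
  (forall q a b, U q ->
    \sum_c grad_form (fun q => f q 0 a) (fun q => f q 0 c) q * h (f q) c b = (a == b)%:R) ->
  basic U (fun q => f q 0 0) (fun q => f q 0 1)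
    (grad_form (fun q => f q 0 a) (fun q => f q 0 b)).
Proof.
move=> mh fU sf cometric q Uq.
have E p : U p -> grad_form (fun q => f q 0 a) (fun q => f q 0 b) p = invmx (h (f p)) a b.
  move=> Up; pose F : 'M[R]_2 :=
    \matrix_(i, j) grad_form (fun q => f q 0 i) (fun q => f q 0 j) p.
  have FH : F *m h (f p) = 1%:M.
    apply/matrixP => i j; rewrite !mxE -(cometric p i j Up).
    by apply: eq_bigr => c _; rewrite mxE.
  have [_ uH] := mulmx1_unit FH.
  have -> : invmx (h (f p)) = F by rewrite -[LHS]mul1mx -FH mulmxK.
  by rewrite mxE.
exists (partial 0 (fun u => invmx (h u) a b) (f q)), (partial 1 (fun u => invmx (h u) a b) (f q)).
move=> k; rewrite (pd_eqon oU k E Uq).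
by rewrite (pd_comp k oOm sf (sm_invmx_metric oOm mh a b) Uq (fU _ Uq)) sum2.
Qed.

Theorem theorem3p5 (R : realType) (N : riemannian_manifold R 2) :
  ~ exists phi : 'rV[R]_3 -> N,
      riemannian_submersion (@sol_metric R) phi /\
      biharmonic (@sol_metric R) phi.
Proof.
move=> [phi [[[cphi sphi] subm] [_ bih]]].
(* Any point would do in place of [0], since the contradiction is local. *)
have [c ac c0] := atlas_cover (phi 0).
pose U : set 'rV[R]_3 := phi @^-1` cdom c; pose f := cmap c \o phi; pose h := Defs.metric c.
have oU : open U by apply: open_comp => [x _|]; [exact: cphi | exact: cdom_open].
have oOm : open (ccod c) by exact: ccod_open.
have mh : is_metric_on (ccod c) h by exact: metricP.
have fU q : U q -> ccod c (f q) by move=> Uq; exists (phi q).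
have sf b : sm U (fun q => f q 0 b) by exact: smooth_on_entry oU (sphi c ac).
have cometric q a b : U q ->
    \sum_c grad_form (fun q => f q 0 a) (fun q => f q 0 c) q * h (f q) c b = (a == b)%:R.
  move=> Uq; have [surj iso] := subm c ac q Uq.
  have /matrixP /(_ a b) := submersion_cometric oU sf Uq surj iso.
  by rewrite !mxE => <-; apply: eq_bigr => d _; rewrite mxE.
have cb a b : basic U (fun q => f q 0 0) (fun q => f q 0 1)
    (grad_form (fun q => f q 0 a) (fun q => f q 0 b)) by exact: (cometric_basic oU oOm a b mh fU sf cometric).
have minors q : U q -> minor (fun q => f q 0 0) (fun q => f q 0 1) ix iy q = 0 ->
    minor (fun q => f q 0 0) (fun q => f q 0 1) ix iz q = 0 ->
    minor (fun q => f q 0 0) (fun q => f q 0 1) iy iz q != 0.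
  by move=> Uq; have [surj _] := subm c ac q Uq; exact: (submersion_minor oU sf Uq surj).
have [V [q1 [xi1 [xi2 [w [oV VU Vq1 [s1 s2] killing]]]]]] :=
  vertical_killing oU (sf 0) (sf 1) (cb 0 0) (cb 0 1) (cb 1 1) c0 minors.
apply: (@killing_not_biharmonic R V oV (ccod c) oOm h f mh
  (fun q Vq => fU q (VU q Vq)) (fun b => sm_sub VU (sf b))
  (fun q a b Vq => cometric q a b (VU q Vq)) xi1 xi2 w q1 Vq1 s1 s2).
- by move=> q k /killing[->].
- by move=> q k /killing[_ ->].
- by move=> q b /killing[_ _ k0 k1 _]; case: (I2P b) => ->.
- by move=> q /killing[].
- by move=> q a Vq; have := bih c ac q (VU q Vq); rewrite -/f -/h => ->; rewrite mxE.
Qed.
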